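(* Let $p>3$ be a prime and let $t\in\mathbb{F}_p$ with $t\neq 0,1$. Then $${_2}G_2\left[\begin{array}{cc}\frac13, & \frac23\\ 0, & 0\end{array}\Big|\,\frac1t\right]_p=\varphi(-3)\cdot{_2}G_2\left[\begin{array}{cc}\frac13, & \frac23\\ 0, & 0\end{array}\Big|\,\frac1{1-t}\right]_p,$$ where ${_2}G_2[\cdots]_p$ is McCarthy's $p$-adic hypergeometric function and $\varphi$ is the quadratic character on $\mathbb{F}_p$.
   Context: Let $p$ be an odd prime, $\mathbb{F}_p$ the field with $p$ elements, $\mathbb{Z}_p$ the $p$-adic integers, $\mathbb{Q}_p$ the $p$-adic numbers. Multiplicative characters $\chi$ of $\mathbb{F}_p^\times$ are extended to $\mathbb{F}_p$ by $\chi(0):=0$ (including the trivial character). $\varphi$ is the quadratic character on $\mathbb{F}_p$ (the Legendre symbol). $\omega:\mathbb{F}_p^\times\to\mathbb{Z}_p^\times$ is the Teichmüller character: $\omega(a)$ is the $(p-1)$-th root of unity in $\mathbb{Z}_p$ with $\omega(a)\equiv a\pmod p$; $\overline{\omega}=\omega^{-1}$. For $x\in\mathbb{Q}$, $\lfloor x\rfloor$ is the greatest integer $\le x$ and $\langle x\rangle:=x-\lfloor x\rfloor$. The $p$-adic gamma function is defined on positive integers by $\Gamma_p(n):=(-1)^n\prod_{0<j<n,\ p\nmid j}j$, extended continuously to $\Gamma_p:\mathbb{Z}_p\to\mathbb{Z}_p^\times$ by $\Gamma_p(0):=1$ and $\Gamma_p(x):=\lim_{x_n\to x}\Gamma_p(x_n)$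 for $x\neq0$, where $x_n$ runs through any sequence of positive integers $p$-adically approaching $x$. McCarthy's $p$-adic hypergeometric function: for $t\in\mathbb{F}_p$, a positive integer $n$, and $a_k,b_k\in\mathbb{Q}\cap\mathbb{Z}_p$ ($1\le k\le n$), $${_n}G_n\left[\begin{array}{cccc}a_1,&a_2,&\ldots,&a_n\\ b_1,&b_2,&\ldots,&b_n\end{array}\Big|\,t\right]_p:=\frac{-1}{p-1}\sum_{a=0}^{p-2}(-1)^{an}\,\overline{\omega}^a(t)\prod_{k=1}^n(-p)^{-\lfloor\langle a_k\rangle-\frac{a}{p-1}\rfloor-\lfloor\langle -b_k\rangle+\frac{a}{p-1}\rfloor}\frac{\Gamma_p(\langle a_k-\frac{a}{p-1}\rangle)}{\Gamma_p(\langle a_k\rangle)}\cdot\frac{\Gamma_p(\langle -b_k+\frac{a}{p-1}\rangle)}{\Gamma_p(\langle -b_k\rangle)}\in\mathbb{Q}_p.$$ *)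

(* Defs.v *)
From HB Require Import structures.
From mathcomp Require Import all_boot all_order all_algebra.
From mathcomp Require Import boolp classical_sets filter.

Set Implicit Arguments.
Unset Strict Implicit.
Unset Printing Implicit Defensive.

Import Order.TTheory GRing.Theory Num.Theory.
Local Open Scope ring_scope.
Local Open Scope classical_set_scope.

(* Z_p as the inverse limit of the Z/p^n: [x n] is the residue of x modulo    *)
(* p^n, represented by an integer in [0, p^n[ (the bounds follow from         *)
(* coherence, since modz returns the least non-negative residue). The proof   *)
(* that p is prime is a parameter of the type so that the integral domain     *)
(* structure, hence {fraction _}, can be inferred.                            *)
Record padic_int (p : nat) (pr_p : prime p) := PadicInt {
  padic_res :> nat -> int;
  padic_resP : forall n, (padic_res n.+1 %% (p ^ n)%N%:Z)%Z = padic_res n }.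

Section PadicIntRing.
Variables (p : nat) (pr_p : prime p).
Local Notation Zp := (padic_int pr_p).
Local Notation "''q_' n" := ((p ^ n)%N%:Z) (at level 8, n at level 2).

Lemma padic_intP (x y : Zp) : (forall n, x n = y n) -> x = y.
Proof.
case: x y => [x xP] [y yP] /= /funext exy.
by case: y / exy yP => yP; congr PadicInt; exact: Prop_irrelevance.
Qed.

Lemma padic_res_mod (x : Zp) n : (x n %% 'q_n)%Z = x n.
Proof. by rewrite -[in LHS]padic_resP modz_mod padic_resP. Qed.

Lemma padic_coherent_mod (u : nat -> int) :
    (forall n, (u n.+1 = u n %[mod 'q_n])%Z) ->
  forall n, ((u n.+1 %% 'q_n.+1)%Z %% 'q_n)%Z = (u n %% 'q_n)%Z.
Proof.
move=> uP n; rewrite -(uP n) [in RHS](divz_eq (u n.+1) 'q_n.+1).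
by rewrite expnS PoszM mulrA modzMDl.
Qed.

Definition padic_of (u : nat -> int)
    (uP : forall n, (u n.+1 = u n %[mod 'q_n])%Z) : Zp :=
  @PadicInt p pr_p (fun n => (u n %% 'q_n)%Z) (padic_coherent_mod uP).

Lemma padic_resS (x : Zp) n : (x n.+1 = x n %[mod 'q_n])%Z.
Proof. by rewrite padic_resP padic_res_mod. Qed.

Lemma padic_const_subproof (c : int) n : (c = c %[mod 'q_n])%Z.
Proof. by []. Qed.

Lemma padic_opp_subproof (x : Zp) n : (- x n.+1 = - x n %[mod 'q_n])%Z.
Proof. by rewrite -modzNm padic_resS modzNm. Qed.

Lemma padic_add_subproof (x y : Zp) n :
  (x n.+1 + y n.+1 = x n + y n %[mod 'q_n])%Z.
Proof. by rewrite -modzDm !padic_resS modzDm. Qed.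

Lemma padic_mul_subproof (x y : Zp) n :
  (x n.+1 * y n.+1 = x n * y n %[mod 'q_n])%Z.
Proof. by rewrite -modzMm !padic_resS modzMm. Qed.

Definition padic_const c := padic_of (padic_const_subproof c).
Definition padic_opp x := padic_of (padic_opp_subproof x).
Definition padic_add x y := padic_of (padic_add_subproof x y).
Definition padic_mul x y := padic_of (padic_mul_subproof x y).

HB.instance Definition _ := gen_eqMixin Zp.
HB.instance Definition _ := gen_choiceMixin Zp.

Fact padic_addA : associative padic_add.
Proof. by move=> x y z; apply: padic_intP => n /=; rewrite modzDml modzDmr addrA. Qed.

Fact padic_addC : commutative padic_add.
Proof. by move=> x y; apply: padic_intP => n /=; rewrite addrC. Qed.

Fact padic_add0 : left_id (padic_const 0) padic_add.
Proof. by move=> x; apply: padic_intP => n /=; rewrite modzDml add0r padic_res_mod. Qed.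

Fact padic_addN : left_inverse (padic_const 0) padic_opp padic_add.
Proof. by move=> x; apply: padic_intP => n /=; rewrite modzDml addNr. Qed.

HB.instance Definition _ :=
  GRing.isZmodule.Build Zp padic_addA padic_addC padic_add0 padic_addN.

Fact padic_mulA : associative padic_mul.
Proof. by move=> x y z; apply: padic_intP => n /=; rewrite modzMml modzMmr mulrA. Qed.

Fact padic_mulC : commutative padic_mul.
Proof. by move=> x y; apply: padic_intP => n /=; rewrite mulrC. Qed.

Fact padic_mul1 : left_id (padic_const 1) padic_mul.
Proof. by move=> x; apply: padic_intP => n /=; rewrite modzMml mul1r padic_res_mod. Qed.

Fact padic_mulDl : left_distributive padic_mul padic_add.
Proof. by move=> x y z; apply: padic_intP => n /=; rewrite modzMml modzDm mulrDl. Qed.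

Fact padic_one_neq0 : padic_const 1 != padic_const 0.
Proof.
apply/eqP => /(congr1 (fun x : Zp => x 1%N)) /=; rewrite expn1 mod0z.
by rewrite modz_small // ltz_nat prime_gt1.
Qed.

HB.instance Definition _ := GRing.Zmodule_isComNzRing.Build Zp
  padic_mulA padic_mulC padic_mul1 padic_mulDl padic_one_neq0.

Definition padic_unit : {pred Zp} := fun x => `[< exists y : Zp, y * x = 1 >].

Definition padic_inv (x : Zp) : Zp := xget x [set y | y * x = 1].

Fact padic_mulV : {in padic_unit, left_inverse 1 padic_inv *%R}.
Proof.
move=> x /asboolP[y yx1]; rewrite /padic_inv.
by case: xgetP => [z -> //|/(_ y)]; case.
Qed.

Fact padic_unitP (x y : Zp) : y * x = 1 -> padic_unit x.
Proof. by move=> yx1; apply/asboolP; exists y. Qed.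

Fact padic_inv_out : {in [predC padic_unit], padic_inv =1 id}.
Proof.
move=> x /asboolP nex; rewrite /padic_inv xgetPN // => y yx1.
by apply: nex; exists y.
Qed.

HB.instance Definition _ := GRing.ComNzRing_hasMulInverse.Build Zp
  padic_mulV padic_unitP padic_inv_out.

Lemma padic_res_le (x : Zp) m n : (m <= n)%N -> (x n = x m %[mod 'q_m])%Z.
Proof.
elim: n => [|n IHn]; first by rewrite leqn0 => /eqP->.
rewrite leq_eqVlt => /predU1P[->//|le_mn]; rewrite -IHn //.
apply/eqP; rewrite eqz_mod_dvd.
have /eqP := padic_resS x n; rewrite eqz_mod_dvd; apply: dvdz_trans.
by rewrite dvdzE !absz_nat dvdn_exp2l.
Qed.

Lemma padic_neq0 (x : Zp) : x != 0 -> exists m, ~~ ('q_m %| x m)%Z.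
Proof.
move=> x0; apply: contrapT => /forallNP xP; move/eqP: x0; apply.
apply: padic_intP => n /=; have /negP := xP n; rewrite negbK => /dvdz_mod0P.
by rewrite padic_res_mod mod0z => ->.
Qed.

Lemma padic_mulf_eq0 : GRing.integral_domain_axiom Zp.
Proof.
move=> x y xy0; apply/norP => -[/padic_neq0[m xm] /padic_neq0[n yn]].
have /(congr1 (fun z : Zp => z (m + n)%N)) /= := xy0.
rewrite mod0z => /dvdz_mod0P; apply/negP.
have {}xm : ~~ ('q_m %| x (m + n)%N)%Z.
  apply: contra xm => /dvdz_mod0P xm; apply/dvdz_mod0P.
  by rewrite -(padic_res_le x (leq_addr n m)).
have {}yn : ~~ ('q_n %| y (m + n)%N)%Z.
  apply: contra yn => /dvdz_mod0P yn; apply/dvdz_mod0P.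
  by rewrite -(padic_res_le y (leq_addl m n)).
move: xm yn; rewrite !dvdzE !abszM !absz_nat.
move: `|x _|%N `|y _|%N => a b pa pb.
have a0 : (0 < a)%N by case: a pa; rewrite ?dvdn0.
have b0 : (0 < b)%N by case: b pb; rewrite ?dvdn0.
move: pa pb; rewrite !pfactor_dvdn ?muln_gt0 ?a0 // lognM // -!ltnNge.
by move=> lt_am lt_bn; rewrite -addnS leq_add // ltnW.
Qed.

HB.instance Definition _ :=
  GRing.ComUnitRing_isIntegral.Build Zp padic_mulf_eq0.

End PadicIntRing.

Notation padic_num pr_p := {fraction (padic_int pr_p)}.

Section McCarthyG.
Variables (p : nat) (pr_p : prime p).
Local Notation Zp := (padic_int pr_p).
Local Notation Qp := (padic_num pr_p).

Definition padic_eqmod (k : nat) (x y : Zp) : Prop :=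
  exists z : Zp, x - y = p%:R ^+ k * z.

Definition padic_cvg (u : nat -> Zp) (l : Zp) : Prop :=
  forall k, \forall n \near \oo, padic_eqmod k (u n) l.

(* The default value 0 of xget is never taken for a != 0, as there is then a  *)
(* unique such root of unity.                                                 *)
Definition teichmuller (a : 'F_p) : Zp :=
  xget 0 [set x : Zp | x ^+ p.-1 = 1 /\ padic_eqmod 1 x (a : nat)%:R].

(* The k-th power of the inverse of the Teichmuller character, extended by 0  *)
(* at 0 (also for the trivial character k = 0).                               *)
Definition teichmuller_conj_exp (k : nat) (a : 'F_p) : Zp :=
  if a == 0 then 0 else teichmuller a ^- k.

Definition padic_gamma_nat (n : nat) : Zp :=
  (-1) ^+ n * \prod_(1 <= j < n | ~~ (p %| j)%N) j%:R.

(* For p odd the limit exists and is unique, so that the default value of     *)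
(* xget is not taken.                                                         *)
Definition padic_gamma (x : Zp) : Zp :=
  if x == 0 then 1 else
  xget 0 [set y : Zp | forall u : nat -> nat, (forall n, (0 < u n)%N) ->
    padic_cvg (fun n => (u n)%:R) x ->
    padic_cvg (fun n => padic_gamma_nat (u n)) y].

(* Meaningful for q in Q with denominator prime to p: ratr q is then the      *)
(* image of q in Zp, where ratr divides in Zp itself.                         *)
Definition padic_gamma_rat (q : rat) : Qp :=
  FracField.tofrac (padic_gamma (ratr q)).

Definition frac_part (x : rat) : rat := x - (Num.floor x)%:~R.

Definition mccarthyG (n : nat) (a b : n.-tuple rat) (t : 'F_p) : Qp :=
  - 1 / (p.-1)%:R *
  \sum_(j < p.-1)
    (-1) ^+ (j * n)%N * FracField.tofrac (teichmuller_conj_exp j t) *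
    \prod_(k < n)
      ((let r : rat := j%:R / (p.-1)%:R in
        let ak := tnth a k in
        let bk := tnth b k in
        (- p%:R) ^ (- Num.floor (frac_part ak - r)
                    - Num.floor (frac_part (- bk) + r)) *
        (padic_gamma_rat (frac_part (ak - r)) /
           padic_gamma_rat (frac_part ak)) *
        (padic_gamma_rat (frac_part (- bk + r)) /
           padic_gamma_rat (frac_part (- bk)))) : Qp).

End McCarthyG.

Definition quad_char (p : nat) (x : 'F_p) : int :=
  if x == 0 then 0 else if [exists y : 'F_p, y ^+ 2 == x] then 1 else -1.

(* Main.v *)
Require Import Defs.
From HB Require Import structures.
From mathcomp Require Import all_boot all_order all_algebra.
From mathcomp Require Import all_fingroup all_solvable all_field.
From mathcomp Require Import boolp.
From mathcomp Require classical_sets filter.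
From mathcomp Require Import ring lra zify.

(** Let [n(s)] be the number of triples [(x, y, z)] over [F_p] with [x + y + z = 1] and
[x y z = s]. The theorem follows from two facts about [n]: the value of the
hypergeometric sum at [1 / t] is [- (n(t / 27) - p + 2)] ([mccarthyG_count]), and
[n(t / 27) - p + 2] equals [phi(-3) (n((1 - t) / 27) - p + 2)]
([card_sum1_prod_isogeny]).

The second fact is elementary. The triples are the ordered root systems of the cubics
[T^3 - T^2 + q T - s], and over a finite field a cubic has [phi(disc) - 1 + 2 N] of
them if it has [N] roots: the only case that is not plain counting is that of an
irreducible cubic, whose discriminant is a square because Frobenius permutes the roots
cyclically. The [N] add up to [p - 1] over all [q], so [n(s) - p + 2] is the sum of
[phi(disc)] over [q]. Another change of variables makes [n(u / 27) - p + 2] the sum of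
[phi((3 m - u)^2 - 4 m^3)] over [m]. Up to a factor [-27], the discriminant for
[s = (1 - t) / 27] is the second polynomial for [u = t], at [m = 1 - 3 q]. (These are
the two curves of a 3-isogeny.)

The first fact says that the p-adic gamma values in the sum combine into Gauss sums.
Put [r = j / (p - 1)]. The multiplication formula for 3 and the reflection formula
([padic_gamma_triple], [padic_gamma_reflect]) reduce the gamma values of the [j]-th term
to [Gamma(r)^3 Gamma(<- 3 r>)], which up to a power of [-p] is the product of the Gauss
sums of index [j], [j], [j] and [-3 j] by the Gross-Koblitz formula; the sum over [j] of
such products counts points ([gauss_count]).

The Gross-Koblitz formula is needed in this form: the numbers
[g_j = - pi^j Gamma(j / (p - 1))] of the ring [K = Q_p[X] / (X^(p-1) + p)], with [pi] the
class of [X], are the Gauss sums of an additive character of [F_p] with values in [K].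
Following Dwork, let [f = exp (X + X^p / p)], with coefficients [b_n].
- The coefficients [b_n] have small denominators ([dwork_wint]), so that [f] can be
  evaluated at [x pi] for a Teichmuller representative [x].
- The value there is additive in [x]: for [x + y = z + p w], the series [f(x X) f(y X)]
  and [f(z X)] differ by the factor [exp (p w X) exp (w X^p)], and the value of that
  factor at [pi] is 1 because [pi^p = - p pi] ([sums_theta_add]).
- Grouping degrees modulo [p - 1], the Mellin coefficients of this additive character
  are the sums of [(-p)^m b_(j + (p-1) m)] over [m], and [1 - p] times such a sum is
  [Gamma(j / (p - 1))] ([gross_koblitz]). The sum is the trace of the matrix
  [(-p)^m b_(j + p m - n)]. The recurrence [n b_n = b_(n-1) + b_(n-p)] lets one move from
  the diagonal to the column [n = 0] at the cost of [p] times the trace; that column gives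
  a Newton series, which at a natural number [k] is the quotient
  [(-p)^k k! / (j + p k)!]. For [k] close to [- j / (p - 1)] this is, up to sign, the
  inverse of a product of the [i] prime to [p], that is, a gamma value by reflection.

All limits are taken as families of congruences modulo powers of [p], in [Z_p], in its
fraction field and in [K]. *)

Set Implicit Arguments.
Unset Strict Implicit.
Unset Printing Implicit Defensive.

Import Order.TTheory GRing.Theory Num.Theory.
Local Open Scope ring_scope.

(** * The quadratic character of a finite field *)

Section QuadraticCharacter.
Variable F : finFieldType.
Implicit Types x y d : F.

(** The Legendre symbol, over an arbitrary finite field: on prime fields it unfolds
to [quad_char]. *)
Definition qchar x : int :=
  if x == 0 then 0 else if [exists y : F, y ^+ 2 == x] then 1 else -1.

Lemma qchar0 : qchar 0 = 0. Proof. by rewrite /qchar eqxx. Qed.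

Lemma qchar_sqr x : x != 0 -> qchar (x ^+ 2) = 1.
Proof.
move=> x0; rewrite /qchar expf_eq0 (negbTE x0) /=.
by case: existsP => // -[]; exists x.
Qed.

(** The unit group is cyclic, and the non-squares are the odd powers of a generator. *)
Lemma nonsquareM x y : x != 0 -> y != 0 -> ~~ [exists z : F, z ^+ 2 == x] ->
  ~~ [exists z : F, z ^+ 2 == y] -> [exists z : F, z ^+ 2 == x * y].
Proof.
move=> x0 y0 Nx Ny.
have [g Dg] : exists g : {unit F}, [set: {unit F}] = <[g]>%g.
  by apply/cyclicP/field_unit_group_cyclic.
have gen z : z != 0 -> exists n, z = val g ^+ n.
  move=> z0; have zU : z \is a GRing.unit by rewrite unitfE.
  have : FinRing.Unit zU \in <[g]>%g by rewrite -Dg inE.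
  by case/cycleP=> n /(congr1 val) /= ->; exists n; rewrite FinRing.val_unitX.
have odd_exp z n : ~~ [exists t : F, t ^+ 2 == z] -> z = val g ^+ n -> odd n.
  move=> Nz Dz; apply: contraR Nz => n_even; apply/existsP.
  exists (val g ^+ n./2); rewrite -exprM Dz muln2.
  by rewrite -[n in X in _ == X]odd_double_half (negbTE n_even).
have [m Dx] := gen _ x0; have [n Dy] := gen _ y0.
have mo := odd_exp _ _ Nx Dx; have no := odd_exp _ _ Ny Dy.
apply/existsP; exists (val g ^+ (m + n)./2).
rewrite -exprM muln2 Dx Dy -exprD.
by rewrite -[(m + n)%N in X in _ == X]odd_double_half oddD mo no.
Qed.

Lemma qcharM x y : qchar (x * y) = qchar x * qchar y.
Proof.
rewrite /qchar mulf_eq0.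
have [->|x0] := eqVneq x 0; first by rewrite /= mul0r.
have [->|y0] := eqVneq y 0; first by rewrite /= mulr0.
rewrite /=; case: ifPn => [/existsP[z /eqP Dz]|Nxy].
  case: ifPn => [/existsP[a /eqP Da]|Nx]; case: ifPn => [/existsP[b /eqP Db]|Ny] //.
    case/negP: Ny; apply/existsP; exists (z / a).
    by rewrite expr_div_n Dz Da mulrC mulKf.
  case/negP: Nx; apply/existsP; exists (z / b).
  by rewrite expr_div_n Dz Db mulfK.
case: ifPn => [/existsP[a /eqP Da]|Nx]; case: ifPn => [/existsP[b /eqP Db]|Ny] //.
  by case/negP: Nxy; apply/existsP; exists (a * b); rewrite exprMn Da Db.
by rewrite (nonsquareM x0 y0 Nx Ny) in Nxy.
Qed.

Lemma qchar_sqrM c x : c != 0 -> qchar (c ^+ 2 * x) = qchar x.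
Proof. by move=> c0; rewrite qcharM qchar_sqr ?mul1r. Qed.

Hypothesis two_neq0 : 2%:R != 0 :> F.

Lemma card_sqrt d : #|[set y | y ^+ 2 == d]|%:Z = 1 + qchar d.
Proof.
rewrite /qchar; have [->|d0] := eqVneq d 0.
  have -> : [set y : F | y ^+ 2 == 0] = [set 0].
    by apply/setP=> y; rewrite !inE expf_eq0.
  by rewrite cards1.
case: ifPn => [/existsP[z /eqP Dz]|Nd].
  have -> : [set y : F | y ^+ 2 == d] = [set z; - z].
    by apply/setP=> y; rewrite !inE -Dz eqf_sqr.
  rewrite cards2; suff -> : z != - z by [].
  rewrite -subr_eq0 opprK -mulr2n -mulr_natl mulf_neq0 //.
  by apply: contraNneq d0 => z0; rewrite -Dz z0 expr0n.
have -> : [set y : F | y ^+ 2 == d] = set0.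
  apply/setP=> y; rewrite !inE; apply: contraNF Nd => Dy.
  by apply/existsP; exists y.
by rewrite cards0.
Qed.

(** Completing the square: [2 y - b] runs over the square roots of the discriminant. *)
Lemma card_quadratic_roots b c :
  #|[set y | y ^+ 2 - b * y + c == 0]|%:Z = 1 + qchar (b ^+ 2 - 4%:R * c).
Proof.
have four_neq0 : 4%:R != 0 :> F by rewrite (natrM F 2 2) mulf_neq0.
have inj : injective (fun y : F => 2%:R * y - b).
  by move=> y z /addIr/(mulfI two_neq0).
rewrite -card_sqrt -(card_imset _ inj); congr Posz.
apply: eq_card => y; rewrite [RHS]inE; apply/imsetP/eqP => [[z]|Dy].
  rewrite inE => /eqP Dz ->; apply/eqP; rewrite -subr_eq0; apply/eqP.
  by transitivity (4%:R * (z ^+ 2 - b * z + c)); [ring | rewrite Dz mulr0].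
exists ((y + b) / 2%:R); last by field.
rewrite inE; apply/eqP; apply: (mulfI four_neq0).
rewrite mulr0; transitivity (y ^+ 2 - (b ^+ 2 - 4%:R * c)); first by field.
by rewrite Dy subrr.
Qed.

End QuadraticCharacter.

(** * Counting the points of x + y + z = 1, x y z = s *)

Section Cubic.
Variable F : finFieldType.
Implicit Types x y z q s : F.
Hypothesis two_neq0 : 2%:R != 0 :> F.
Hypothesis three_neq0 : 3%:R != 0 :> F.

(** Discriminant of [T^3 - T^2 + q T - s]. *)
Definition cubic_disc q s :=
  q ^+ 2 - 4%:R * q ^+ 3 - 4%:R * s + 18%:R * q * s - 27%:R * s ^+ 2.

Definition cubic_roots q s := [set x : F | x ^+ 3 - x ^+ 2 + q * x - s == 0].

Definition split_cubic q s (v : F * F * F) :=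
  let: (x, y, z) := v in
  [&& x + y + z == 1, x * y + y * z + z * x == q & x * y * z == s].

Definition cubic_splittings q s := [set v | split_cubic q s v].

Lemma split_root q s x y z : split_cubic q s (x, y, z) ->
  forall t, (t \in cubic_roots q s) = [|| t == x, t == y | t == z].
Proof.
case/and3P=> /eqP e1 /eqP e2 /eqP e3 t; rewrite inE.
have -> : t ^+ 3 - t ^+ 2 + q * t - s = (t - x) * ((t - y) * (t - z)).
  by rewrite -[t ^+ 2]mulr1 -e1 -e2 -e3; ring.
by rewrite !mulf_eq0 !subr_eq0.
Qed.

Lemma split_disc q s x y z : split_cubic q s (x, y, z) ->
  cubic_disc q s = ((x - y) * (y - z) * (z - x)) ^+ 2.
Proof.
case/and3P=> /eqP e1 /eqP <- /eqP <-.
have -> : z = 1 - x - y by rewrite -e1; ring.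
by rewrite /cubic_disc; ring.
Qed.

Lemma split_perm q s x y z : split_cubic q s (x, y, z) ->
  cubic_splittings q s =
  [set (x, y, z); (x, z, y); (y, x, z); (y, z, x); (z, x, y); (z, y, x)].
Proof.
move=> sp; apply/setP=> -[[a b] c]; rewrite inE.
have perm_sp u v w : [&& u + v + w == 1, u * v + v * w + w * u == q &
   u * v * w == s] -> split_cubic q s (u, v, w) by [].
apply/idP/idP => [sp'|]; last first.
  case/and3P: sp => /eqP e1 /eqP e2 /eqP e3.
  rewrite !inE !xpair_eqE -!orbA => /or4P[|||/or3P[]];
   case/andP=> /andP[/eqP-> /eqP->] /eqP->;
   by apply: perm_sp; rewrite -e1 -e2 -e3; apply/and3P; split; apply/eqP; ring.
have := split_root sp' a; rewrite eqxx (split_root sp a) /=.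
case/and3P: sp sp' => /eqP e1 /eqP e2 /eqP e3 /and3P[/eqP f1 /eqP f2 /eqP f3].
have Dc : c = x + y + z - a - b by rewrite e1 -f1; ring.
have two u v : u + v = x + y + z - a -> a * (u + v) + u * v = q -> b = u \/ b = v.
  move=> g1 g2; have : (b - u) * (b - v) == 0.
    apply/eqP; transitivity (a * (u + v) + u * v - (a * b + b * c + c * a)).
      by rewrite Dc -g1; ring.
    by rewrite g2 f2 subrr.
  by rewrite mulf_eq0 !subr_eq0 => /orP[] /eqP; [left | right].
rewrite !inE !xpair_eqE -!orbA => /or3P[] /eqP Da.
- have [||Db|Db] := two y z; rewrite ?Da -?e2; try ring.
    by rewrite Dc Db Da (_ : x + y + z - x - y = z) ?eqxx //; ring.
  by rewrite Dc Db Da (_ : x + y + z - x - z = y) ?eqxx ?orbT //; ring.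
- have [||Db|Db] := two x z; rewrite ?Da -?e2; try ring.
    by rewrite Dc Db Da (_ : x + y + z - y - x = z) ?eqxx ?orbT //; ring.
  by rewrite Dc Db Da (_ : x + y + z - y - z = x) ?eqxx ?orbT //; ring.
have [||Db|Db] := two x y; rewrite ?Da -?e2; try ring.
  by rewrite Dc Db Da (_ : x + y + z - z - x = y) ?eqxx ?orbT //; ring.
by rewrite Dc Db Da (_ : x + y + z - z - y = x) ?eqxx ?orbT //; ring.
Qed.

(** Three distinct roots have 6 orderings and a nonzero square discriminant, a double
and a simple root have 3 orderings, a triple root only 1. *)
Lemma count_split_cubic q s x y z : split_cubic q s (x, y, z) ->
  #|cubic_splittings q s|%:Z =
  qchar (cubic_disc q s) - 1 + 2%:Z * #|cubic_roots q s|%:Z.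
Proof.
move=> sp; rewrite (split_perm sp) (split_disc sp).
have -> : cubic_roots q s = [set x; y; z].
  by apply/setP=> t; rewrite (split_root sp) !inE orbA.
have [<-|xy] := eqVneq x y.
  rewrite subrr !mul0r expr0n qchar0.
  have [<-|xz] := eqVneq x z; first by rewrite !setUid !cards1.
  rewrite setUid cards2 xz /=.
  have -> : [set (x, x, z); (x, z, x); (x, x, z); (x, z, x); (z, x, x); (z, x, x)]
     = [set (x, x, z); (x, z, x); (z, x, x)].
    by apply/setP=> u; rewrite !inE; do 3!case: (u == _).
  by rewrite setUC cardsU1 cards2 !inE !xpair_eqE eqxx /= !(eq_sym z) (negbTE xz) !andbF.
have [<-|xz] := eqVneq x z.
  rewrite subrr mulr0 expr0n qchar0.
  have -> : [set x; y; x] = [set x; y].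
    by apply/setP=> u; rewrite !inE orbAC orbb.
  rewrite cards2 xy /=.
  have -> : [set (x, y, x); (x, x, y); (y, x, x); (y, x, x); (x, x, y); (x, y, x)]
     = [set (x, y, x); (x, x, y); (y, x, x)].
    by apply/setP=> u; rewrite !inE; do 3!case: (u == _).
  by rewrite setUC cardsU1 cards2 !inE !xpair_eqE eqxx /= !(eq_sym y) (negbTE xy) !andbF.
have [<-|yz] := eqVneq y z.
  rewrite subrr mulr0 mul0r expr0n qchar0.
  have -> : [set x; y; y] = [set x; y].
    by apply/setP=> u; rewrite !inE -orbA orbb.
  rewrite cards2 xy /=.
  have -> : [set (x, y, y); (x, y, y); (y, x, y); (y, y, x); (y, x, y); (y, y, x)]
     = [set (x, y, y); (y, x, y); (y, y, x)].
    by apply/setP=> u; rewrite !inE; do 3!case: (u == _).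
  by rewrite setUC cardsU1 cards2 !inE !xpair_eqE eqxx /= !(eq_sym y) (negbTE xy) !andbF.
rewrite qchar_sqr; last by rewrite !mulf_neq0 ?subr_eq0 // eq_sym.
have yx : y != x by rewrite eq_sym.
have zx : z != x by rewrite eq_sym.
have zy : z != y by rewrite eq_sym.
rewrite -!setUA !cardsU1 !cards1 !inE !xpair_eqE !eqxx.
by rewrite (negbTE xy) (negbTE xz) (negbTE yz) (negbTE yx) (negbTE zx) (negbTE zy).
Qed.

(** With exactly one root the cofactor is a quadratic without roots, so its
discriminant, which equals that of the cubic up to a square, is not a square. *)
Lemma count_unsplit_root q s x :
  x ^+ 3 - x ^+ 2 + q * x - s = 0 -> (forall v, ~~ split_cubic q s v) ->
  #|cubic_splittings q s|%:Z =
  qchar (cubic_disc q s) - 1 + 2%:Z * #|cubic_roots q s|%:Z.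
Proof.
move=> Dx nosplit; pose c := x ^+ 2 - x + q; pose b := 1 - x.
have Ds : s = x ^+ 3 - x ^+ 2 + q * x by apply/eqP; rewrite eq_sym -subr_eq0 Dx.
have noroot y : y ^+ 2 - b * y + c != 0.
  apply: contra (nosplit (x, y, b - y)) => /eqP Dy; apply/and3P.
  have Dq : q = b * y - y ^+ 2 - x ^+ 2 + x.
    by rewrite -[LHS](subr0) -Dy /c; ring.
  by rewrite Ds Dq /b; split; apply/eqP; ring.
have Droots : cubic_roots q s = [set x].
  apply/setP=> t; rewrite !inE.
  have -> : t ^+ 3 - t ^+ 2 + q * t - s = (t - x) * (t ^+ 2 - b * t + c).
    by rewrite Ds /b /c; ring.
  by rewrite mulf_eq0 (negbTE (noroot t)) orbF subr_eq0.
have -> : cubic_splittings q s = set0.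
  by apply/setP=> v; rewrite !inE (negbTE (nosplit v)).
have fx0 : x ^+ 2 - b * x + c != 0 by [].
have -> : cubic_disc q s = (x ^+ 2 - b * x + c) ^+ 2 * (b ^+ 2 - 4%:R * c).
  by rewrite /cubic_disc Ds /b /c; ring.
rewrite qchar_sqrM // Droots cards1 cards0.
have := card_quadratic_roots two_neq0 b c.
have -> : [set y | y ^+ 2 - b * y + c == 0] = set0.
  by apply/setP=> y; rewrite !inE (negbTE (noroot y)).
by rewrite cards0 => /esym/eqP; rewrite addrC addr_eq0 => /eqP ->.
Qed.

(** In a splitting field, the Frobenius generator has no fixed root, hence it permutes
the three roots cyclically. It therefore fixes the square root
[(r1 - r2) (r2 - r3) (r3 - r1)] of the discriminant, which thus lies in [F]. *)
Lemma disc_irreducible q s : (forall x, x ^+ 3 - x ^+ 2 + q * x - s != 0) ->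
  qchar (cubic_disc q s) = 1.
Proof.
move=> noroot.
pose f : {poly F} := 'X^3 - 'X^2 + q *: 'X - s%:P.
have fE x : f.[x] = x ^+ 3 - x ^+ 2 + q * x - s by rewrite /f !hornerE.
have f_neq0 : f != 0.
  by apply: contraNneq (noroot 0) => f0; rewrite -fE f0 horner0.
have size_f : size f = 4%N.
  rewrite /f -!addrA size_polyDl size_polyXn //.
  rewrite (leq_ltn_trans (size_polyD _ _)) // gtn_max size_polyN size_polyXn /=.
  rewrite (leq_ltn_trans (size_polyD _ _)) // gtn_max size_polyN.
  rewrite (leq_ltn_trans (size_scale_leq _ _)) ?size_polyX //=.
  by rewrite (leq_ltn_trans (size_polyC_leq1 _)).
have lead_f : f \is monic.
  by rewrite monicE lead_coefE size_f /f !coefE /= mulr0 !subr0 addr0.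
have [L [rs Dfr _]] := FinSplittingFieldFor f_neq0.
have Df : map_poly (in_alg L) f = \prod_(z <- rs) ('X - z%:P).
  by apply/eqP; rewrite -eqp_monic ?monic_map ?monic_prod_XsubC.
have size_rs : size rs = 3%N.
  have := congr1 (fun p : {poly L} => size p) Df.
  by rewrite size_map_poly size_f size_prod_XsubC => -[].
case: rs size_rs Df {Dfr} => [|r1 [|r2 [|r3 [|//]]]] // _ Df.
have {Df} : 'X^3 - 'X^2 + (q%:A *: 'X) - (s%:A)%:P =
   'X^3 - (r1 + r2 + r3) *: 'X^2 + (r1 * r2 + r2 * r3 + r3 * r1) *: 'X
   - (r1 * r2 * r3)%:P :> {poly L}.
  transitivity (map_poly (in_alg L) f : {poly L}).
    by rewrite /f !(rmorphB, rmorphD) /= !map_polyXn map_polyZ map_polyX map_polyC.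
  rewrite Df !big_cons big_nil mulr1 -!mul_polyC !rmorphD !rmorphM /=; ring.
move=> Df; have e1 := congr1 (fun p : {poly L} => p`_2) Df.
have e2 := congr1 (fun p : {poly L} => p`_1) Df.
have e3 := congr1 (fun p : {poly L} => p`_0) Df.
rewrite !coefE /= in e1 e2 e3.
have {}e1 : r1 + r2 + r3 = 1.
  by apply/eqP; rewrite -subr_eq0 -oppr_eq0; apply/eqP; move: e1;
     rewrite !mulr0 !mulr1 !subr0 !addr0 !sub0r => /oppr_inj <-; rewrite subrr oppr0.
have {}e2 : r1 * r2 + r2 * r3 + r3 * r1 = q%:A.
  by move: e2; rewrite !mulr1 !mulr0 !subr0 !add0r.
have {}e3 : r1 * r2 * r3 = s%:A.
  by move: e3; rewrite !mulr0 !subr0 !add0r => /oppr_inj.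
have [al _ Dal] := finField_galois_generator (sub1v {:L}).
have alA a : al a%:A = a%:A by rewrite linearZ /= rmorph1.
have al_root t : (t - r1) * (t - r2) * (t - r3) = 0 ->
    [/\ al t != t & [|| al t == r1, al t == r2 | al t == r3]].
  have expand u : (u - r1) * (u - r2) * (u - r3) = u ^+ 3 - u ^+ 2 + q%:A * u - s%:A.
    by rewrite -e2 -e3 -[u ^+ 2]mul1r -e1; ring.
  rewrite expand => rt; split.
    apply/eqP => fix_t; have : t \in 1%VS.
      by rewrite Fermat's_little_theorem -Dal ?memvf ?fix_t.
    case/vlineP=> a Da; case/eqP: (noroot a); apply: (fmorph_inj (in_alg L)).
    by rewrite !(rmorph0, rmorphB, rmorphD, rmorphXn, rmorphM) /= -Da.
  have : al (t ^+ 3 - t ^+ 2 + q%:A * t - s%:A) = 0 by rewrite rt rmorph0.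
  rewrite !(rmorphB, rmorphD, rmorphXn, rmorphM) /= !alA => /eqP.
  by rewrite -expand !mulf_eq0 !subr_eq0 orbA.
have alsum : al r1 + al r2 + al r3 = r1 + r2 + r3.
  by rewrite -!rmorphD e1 rmorph1.
have [n1 a1] : [/\ al r1 != r1 & [|| al r1 == r1, al r1 == r2 | al r1 == r3]].
  by apply: al_root; rewrite subrr !mul0r.
have [n2 a2] : [/\ al r2 != r2 & [|| al r2 == r1, al r2 == r2 | al r2 == r3]].
  by apply: al_root; rewrite subrr mulr0 mul0r.
have [n3 a3] : [/\ al r3 != r3 & [|| al r3 == r1, al r3 == r2 | al r3 == r3]].
  by apply: al_root; rewrite subrr mulr0.
rewrite (negbTE n1) (negbTE n2) (negbTE n3) /= ?orbF in a1 a2 a3.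
pose de := (r1 - r2) * (r2 - r3) * (r3 - r1).
have [al_de de_neq0] : al de = de /\ de != 0.
  rewrite /de !rmorphM !rmorphB /=.
  have by_sum (u v a b : L) : a = b -> u - v = a - b -> u = v.
    by move=> -> /eqP; rewrite subrr subr_eq0 => /eqP.
  case/orP: a1 => /eqP E1; case/orP: a2 => /eqP E2; case/orP: a3 => /eqP E3;
    move: alsum n1 n2 n3; rewrite E1 E2 E3 => sum n1 n2 n3;
  (* Six of the eight cases give two roots the same image: then the trace forces
     one root to be fixed. The other two are the 3-cycles. *)
  first [ by case/eqP: n1; apply: (by_sum _ _ _ _ sum); ring
        | by case/eqP: n2; apply: (by_sum _ _ _ _ sum); ring
        | by case/eqP: n3; apply: (by_sum _ _ _ _ sum); ring
        | by split; [ring | rewrite !mulf_neq0 ?subr_eq0 // eq_sym] ].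
have : de \in 1%VS by rewrite Fermat's_little_theorem -Dal ?memvf ?al_de.
case/vlineP=> a Da.
have a0 : a != 0 by apply: contraNneq de_neq0 => a0; rewrite Da a0 scale0r.
suff -> : cubic_disc q s = a ^+ 2 by rewrite qchar_sqr.
apply: (fmorph_inj (in_alg L)); rewrite /cubic_disc.
rewrite !(rmorph_nat, rmorphXn, rmorphB, rmorphM, rmorphD) /= -Da -e2 -e3 /de.
have -> : r3 = 1 - r1 - r2 by rewrite -e1; ring.
ring.
Qed.

(** A uniform count over all root configurations. It is affine in the number of roots,
which has a known sum over [q], so that only the character sum remains. *)
Lemma count_splittings q s :
  #|cubic_splittings q s|%:Z =
  qchar (cubic_disc q s) - 1 + 2%:Z * #|cubic_roots q s|%:Z.
Proof.
have [[[x y] z] sp|nosplit] := pickP (split_cubic q s); first exact: count_split_cubic sp.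
have [x Dx|noroot] := pickP (fun x => x ^+ 3 - x ^+ 2 + q * x - s == 0).
  by apply: (count_unsplit_root (eqP Dx)) => v; rewrite nosplit.
have -> : cubic_splittings q s = set0.
  by apply/setP=> v; rewrite !inE nosplit.
have -> : cubic_roots q s = set0 by apply/setP=> x; rewrite !inE noroot.
by rewrite disc_irreducible ?cards0 // => x; rewrite noroot.
Qed.

Definition sum1_prod s :=
  [set v : F * F * F | (v.1.1 + v.1.2 + v.2 == 1) && (v.1.1 * v.1.2 * v.2 == s)].

(** Each nonzero [x] is a root for exactly one value of [q], and [0] for none. *)
Lemma sum_cubic_roots s : s != 0 -> (\sum_q #|cubic_roots q s| = #|F|.-1)%N.
Proof.
move=> s0; under eq_bigr do rewrite -sum1_card (eq_bigl _ _ (fun x => in_set _ x)).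
rewrite (exchange_big_dep predT) //= (bigD1 0) //= big1 ?add0n; last first.
  by move=> q; rewrite mulr0 !expr0n /= subr0 addr0 sub0r oppr_eq0 (negbTE s0).
rewrite -[RHS](cardC1 (0 : F)) -sum1_card; apply: eq_bigr => x x0.
rewrite (big_pred1 ((s - x ^+ 3 + x ^+ 2) / x)) // => q /=.
apply/eqP/eqP => [Dq|->]; last by field.
by apply: (mulIf x0); rewrite divfK //; apply/eqP; rewrite -subr_eq0 -Dq; apply/eqP; ring.
Qed.

(** The triples are sorted by their second symmetric function [q]. *)
Lemma card_sum1_prod_disc s : s != 0 ->
  #|sum1_prod s|%:Z = \sum_q qchar (cubic_disc q s) + #|F|%:Z - 2%:Z.
Proof.
move=> s0.
have -> : #|sum1_prod s| = (\sum_q #|cubic_splittings q s|)%N.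
  rewrite -sum1_card (partition_big (fun v => v.1.1 * v.1.2 + v.1.2 * v.2 + v.2 * v.1.1) predT) //=.
  apply: eq_bigr => q _; rewrite -sum1_card; apply: eq_bigl => -[[x y] z].
  by rewrite !inE /=; do 3!case: (_ == _).
rewrite -[LHS]natz natr_sum.
under eq_bigr do rewrite natz count_splittings.
rewrite big_split sumrB -mulr_sumr /= sumr_const.
have -> : \sum_q #|cubic_roots q s|%:Z = #|F|.-1%:Z.
  by rewrite -(sum_cubic_roots s0) -[RHS]natz natr_sum; apply: eq_bigr => q _; rewrite natz.
have : (0 < #|F|)%N by apply/card_gt0P; exists 0.
by case: #|F| => // n _; rewrite /= natz; ring.
Qed.

(** The change of variables [m = u / (3 z)], [a = u x / z] turns the two equations into
[a^2 - (3 m - u) a + m^3 = 0]; the triples are sorted by [m]. *)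
Lemma card_sum1_prod_quad (u : F) : u != 0 ->
  #|sum1_prod (u / 27%:R)|%:Z =
  \sum_m qchar ((3%:R * m - u) ^+ 2 - 4%:R * m ^+ 3) + #|F|%:Z - 2%:Z.
Proof.
move=> u0.
have n27 : 27%:R != 0 :> F by rewrite (natrM F 3 9) (natrM F 3 3) !mulf_neq0.
pose P := [set w : F * F | (w.1 != 0) &&
  (w.2 ^+ 2 - (3%:R * w.1 - u) * w.2 + w.1 ^+ 3 == 0)].
have -> : #|sum1_prod (u / 27%:R)| = #|P|.
  pose g (w : F * F) := (w.2 / (3%:R * w.1),
    1 - w.2 / (3%:R * w.1) - u / (3%:R * w.1), u / (3%:R * w.1)).
  have gK : {in P &, injective g}.
    move=> [m a] [m' a']; rewrite !inE /= => /andP[m0 _] /andP[m'0 _] [Ea _ Em].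
    have Dm : m = m'.
      apply: (mulfI three_neq0); apply: invr_inj; exact: (mulfI u0).
    congr pair => //; move: Ea; rewrite Dm => /mulIf; apply.
    by rewrite invr_neq0 // mulf_neq0.
  rewrite -(card_in_imset gK); apply: eq_card => -[[x y] z].
  rewrite inE /=; apply/andP/imsetP => [[/eqP e1 /eqP e2]|[[m a]]].
    have [x0 y0 z0] : [/\ x != 0, y != 0 & z != 0].
      by split; apply: contraNneq u0 => E; move: e2; rewrite E ?mulr0 ?mul0r => /esym/eqP;
        rewrite mulf_eq0 invr_eq0 (negbTE n27) orbF.
    exists (u / (3%:R * z), u * x / z).
      have Dy : y = 1 - x - z by rewrite -e1; ring.
      have Du : u = 27%:R * (x * y * z) by rewrite e2 mulrC divfK.
      rewrite inE /= !mulf_neq0 ?invr_neq0 ?mulf_neq0 //=.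
      have -> : (u / (3%:R * z)) ^+ 3 = u ^+ 2 * (27%:R * (x * y * z)) / (27%:R * z ^+ 3).
        by rewrite -Du; field; rewrite z0 three_neq0 n27.
      rewrite Dy; apply/eqP; field; rewrite z0 three_neq0 n27 //.
    rewrite /g /=; have Dy : y = 1 - x - z by rewrite -e1; ring.
    by congr (_, _, _); rewrite ?Dy; field; rewrite ?z0 ?u0 ?three_neq0.
  rewrite inE /= => /andP[m0 /eqP Da] [-> -> ->].
  split; apply/eqP; first by ring.
  have Db : a * (3%:R * m - a - u) = m ^+ 3.
    by apply/eqP; rewrite -subr_eq0 -oppr_eq0 -Da; apply/eqP; ring.
  transitivity (u * (a * (3%:R * m - a - u)) / (27%:R * m ^+ 3)).
    by field; rewrite m0 three_neq0 n27.
  by rewrite Db; field; rewrite m0 n27.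
have -> : #|P| = (\sum_(m : F | m != 0%R)
    #|[set y : F | (y ^+ 2 - (3%:R * m - u) * y + m ^+ 3 == 0)%R]|)%N.
  rewrite -sum1_card (partition_big (fun w : F * F => w.1) (fun m : F => m != 0)) /=; last first.
    by move=> w; rewrite inE => /andP[].
  apply: eq_bigr => m m0; rewrite -sum1_card.
  rewrite (reindex_onto (fun y : F => (m, y)) (fun w : F * F => w.2)) /=; last first.
    by move=> [a b] /andP[_ /= /eqP->].
  by apply: eq_bigl => y; rewrite !inE /= m0 !eqxx !andbT.
(* The missing value m = 0 contributes qchar (u ^+ 2) = 1 to the character sum. *)
rewrite -[LHS]natz natr_sum.
under eq_bigr do rewrite natz card_quadratic_roots //.
rewrite big_split /= sumr_const [in RHS](bigD1 0) //= mulr0 sub0r expr0n mulr0 subr0.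
rewrite sqrrN qchar_sqr //.
rewrite (_ : #|_| = #|F|.-1) -?(cardC1 (0 : F)) //.
have : (0 < #|F|)%N by apply/card_gt0P; exists 0.
rewrite cardC1; case: #|F| => // n _; rewrite /= natz; ring.
Qed.

(** The curves [w^2 = (3 m - t)^2 - 4 m^3] and [w^2 = cubic_disc q ((1 - t) / 27)] are
3-isogenous up to the twist by [-3]. On character sums this is a termwise identity:
the left-hand side is counted by [card_sum1_prod_quad], the right-hand side by
[card_sum1_prod_disc], and the substitution [m = 1 - 3 q] turns the
first polynomial into [-27] times the second. *)
Lemma card_sum1_prod_isogeny t : t != 0 -> 1 - t != 0 ->
  #|sum1_prod (t / 27%:R)|%:Z - #|F|%:Z + 2%:Z =
  qchar (- 3%:R : F) * (#|sum1_prod ((1 - t) / 27%:R)|%:Z - #|F|%:Z + 2%:Z).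
Proof.
move=> t0 t1.
have n27 : 27%:R != 0 :> F by rewrite (natrM F 3 9) (natrM F 3 3) !mulf_neq0.
rewrite card_sum1_prod_quad // card_sum1_prod_disc ?mulf_neq0 ?invr_neq0 //.
have simp (S : int) (n : nat) : S + n%:Z - 2%:Z - n%:Z + 2%:Z = S by ring.
rewrite !simp mulr_sumr.
have inj : injective (fun q : F => 1 - 3%:R * q).
  by move=> a b /addrI/oppr_inj/(mulfI three_neq0).
rewrite [LHS](reindex_inj inj) /=; apply: eq_bigr => q _.
rewrite -qcharM -[RHS](@qchar_sqrM _ 3%:R) //.
congr qchar; rewrite /cubic_disc; field; rewrite ?n27 //.
Qed.
End Cubic.

(** * Congruences in the p-adic integers *)

Section PadicCongruence.
Variables (p : nat) (pr_p : prime p).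
Local Notation Zp := (padic_int pr_p).
Local Notation q_ n := ((p ^ n)%N%:Z).
Implicit Types x y z : Zp.

Lemma padic_addE x y n : (x + y) n = ((x n + y n) %% q_ n)%Z. Proof. by []. Qed.

Lemma padic_natE (m n : nat) : (m%:R : Zp) n = (m%:Z %% q_ n)%Z.
Proof.
elim: m => [|m IHm]; first by [].
by rewrite -addn1 natrD /= IHm modzDml modzDmr PoszD.
Qed.

Lemma padic_exp_p0 k z : (p%:R ^+ k * z : Zp) k = 0.
Proof.
rewrite -natrX /= padic_natE modzz mul0r mod0z //.
Qed.

Lemma padic_divp_exp k (d : Zp) : d k = 0 -> exists z, d = p%:R ^+ k * z.
Proof.
move=> dk0.
have pk0 i : q_ i != 0 by rewrite eqz_nat -lt0n expn_gt0 prime_gt0.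
have dvd_d i : (q_ k %| d (k + i)%N)%Z.
  apply/dvdz_mod0P; have := padic_res_le d (leq_addr i k).
  by rewrite dk0 mod0z.
pose u i := (d (k + i)%N %/ q_ k)%Z.
have uK i : u i * q_ k = d (k + i)%N by rewrite /u divzK.
have uP i : (u i.+1 = u i %[mod q_ i])%Z.
  apply/eqP; rewrite eqz_mod_dvd -(dvdz_mul2r (pk0 k)).
  rewrite mulrBl !uK -PoszM -expnD (addnC i k) -eqz_mod_dvd addnS.
  by apply/eqP; rewrite padic_res_le.
exists (padic_of pr_p uP); apply: padic_intP => i.
rewrite -natrX /= padic_natE modzMmr modzMml mulrC uK.
by rewrite (padic_res_le d (leq_addl k i)) padic_res_mod.
Qed.

(** In the inverse limit, divisibility by [p^k] is the vanishing of the [k]-th residue.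
All congruence rules reduce to this. *)
Lemma padic_eqmodE k x y : padic_eqmod k x y <-> x k = y k.
Proof.
split=> [[z Dz]|Exy].
  have -> : x = y + p%:R ^+ k * z by rewrite -Dz addrC subrK.
  by rewrite padic_addE padic_exp_p0 addr0 padic_res_mod.
apply: padic_divp_exp; rewrite /= modzDmr Exy subrr mod0z //.
Qed.

Lemma eqmod_refl k x : padic_eqmod k x x. Proof. by apply/padic_eqmodE. Qed.
Hint Resolve eqmod_refl : core.

Lemma eqmod_sym k x y : padic_eqmod k x y -> padic_eqmod k y x.
Proof. by move/padic_eqmodE => E; apply/padic_eqmodE. Qed.

Lemma eqmod_trans k y x z :
  padic_eqmod k x y -> padic_eqmod k y z -> padic_eqmod k x z.
Proof. by move=> /padic_eqmodE Ex /padic_eqmodE Ey; apply/padic_eqmodE; rewrite Ex. Qed.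

Lemma eqmodD k x y x' y' : padic_eqmod k x x' -> padic_eqmod k y y' ->
  padic_eqmod k (x + y) (x' + y').
Proof. by move=> /padic_eqmodE Ex /padic_eqmodE Ey; apply/padic_eqmodE; rewrite /= Ex Ey. Qed.

Lemma eqmodN k x x' : padic_eqmod k x x' -> padic_eqmod k (- x) (- x').
Proof. by move=> /padic_eqmodE Ex; apply/padic_eqmodE; rewrite /= Ex. Qed.

Lemma eqmodM k x y x' y' : padic_eqmod k x x' -> padic_eqmod k y y' ->
  padic_eqmod k (x * y) (x' * y').
Proof. by move=> /padic_eqmodE Ex /padic_eqmodE Ey; apply/padic_eqmodE; rewrite /= Ex Ey. Qed.

Lemma eqmodX k n x x' : padic_eqmod k x x' -> padic_eqmod k (x ^+ n) (x' ^+ n).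
Proof.
by move=> E; elim: n => [|n IHn]; rewrite ?expr0 // !exprS; apply: eqmodM.
Qed.

Lemma eqmod_sum k (I : Type) (r : seq I) (P : pred I) (f g : I -> Zp) :
  (forall i, P i -> padic_eqmod k (f i) (g i)) ->
  padic_eqmod k (\sum_(i <- r | P i) f i) (\sum_(i <- r | P i) g i).
Proof. by move=> E; elim/big_ind2: _ => // *; apply: eqmodD. Qed.

Lemma eqmod_prod k (I : Type) (r : seq I) (P : pred I) (f g : I -> Zp) :
  (forall i, P i -> padic_eqmod k (f i) (g i)) ->
  padic_eqmod k (\prod_(i <- r | P i) f i) (\prod_(i <- r | P i) g i).
Proof. by move=> E; elim/big_ind2: _ => // *; apply: eqmodM. Qed.

Lemma eqmod_leq k l x y : (l <= k)%N -> padic_eqmod k x y -> padic_eqmod l x y.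
Proof.
move=> le_lk [z Dz]; exists (p%:R ^+ (k - l) * z).
by rewrite mulrA -exprD subnKC.
Qed.

Lemma eqmod0 x y : padic_eqmod 0 x y.
Proof. by exists (x - y); rewrite expr0 mul1r. Qed.

Lemma eqmod_eq x y : (forall k, padic_eqmod k x y) -> x = y.
Proof. by move=> E; apply: padic_intP => k; apply/padic_eqmodE. Qed.

Lemma eqmod_exp_p0 k z : padic_eqmod k (p%:R ^+ k * z) 0.
Proof. by exists z; rewrite subr0. Qed.

Lemma eqmod_nat (k m n : nat) :
  padic_eqmod k (m%:R : Zp) n%:R <-> (m = n %[mod p ^ k])%N.
Proof.
split=> [/padic_eqmodE|E].
  by rewrite !padic_natE !modz_nat => -[].
by apply/padic_eqmodE; rewrite !padic_natE !modz_nat E.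
Qed.

Lemma padic_complete (v : nat -> Zp) :
  (forall n, padic_eqmod n (v n.+1) (v n)) ->
  exists l, forall n, padic_eqmod n (v n) l.
Proof.
move=> vP.
have uP n : (v n.+1 n.+1 = v n n %[mod q_ n])%Z.
  by have /padic_eqmodE <- := vP n; rewrite padic_resS.
exists (padic_of pr_p uP) => n; apply/padic_eqmodE.
by rewrite /= padic_res_mod.
Qed.

Lemma padic_approx k x : exists m : nat, padic_eqmod k x m%:R.
Proof.
have : 0 <= x k.
  by rewrite -padic_res_mod modz_ge0 // eqz_nat -lt0n expn_gt0 prime_gt0.
case Dm: (x k) => [m|//] _; exists m; apply/padic_eqmodE.
by rewrite padic_natE -Dm padic_res_mod.
Qed.

(** Up to an integer factor, [x] is [1 - p z], with inverse the geometric series. *)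
Lemma padic_unit_of_Nmod_p x : ~ padic_eqmod 1 x 0 -> x \is a GRing.unit.
Proof.
move=> xN0; have [m Dm] := padic_approx 1 x.
have co_mp : coprime m p.
  rewrite coprime_sym prime_coprime //; apply/negP => /dvdnP[n Dn]; apply: xN0.
  apply: eqmod_trans Dm _; rewrite Dn natrM mulrC -[p%:R]expr1.
  exact: eqmod_exp_p0.
have m0 : (0 < m)%N.
  by case: m co_mp {Dm} => //; rewrite /coprime gcd0n gtn_eqF ?prime_gt1.
have [a /eqP Da] : exists a, (a * m == 1 %[mod p])%N.
  have [u v Duv _] := egcdnP p m0; exists u; rewrite Duv.
  by rewrite (eqP co_mp) modnMDl.
have [z Dz] : padic_eqmod 1 1 (a%:R * x).
  apply: eqmod_sym; apply: (eqmod_trans (eqmodM (eqmod_refl _ _) Dm)).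
  by rewrite -natrM; apply/(@eqmod_nat 1 _ 1); rewrite expn1 Da.
rewrite expr1 in Dz; set w := p%:R * z in Dz.
have w_exp n : padic_eqmod n (w ^+ n) 0 by rewrite exprMn; apply: eqmod_exp_p0.
have [n|l lP] := @padic_complete (fun n => a%:R * \sum_(i < n) w ^+ i).
  rewrite -[X in padic_eqmod _ _ X]addr0 big_ord_recr mulrDr; apply: eqmodD => //=.
  by rewrite -[X in padic_eqmod _ _ X](mulr0 a%:R); apply: eqmodM.
apply/unitrP; exists l; rewrite [x * l]mulrC; suff -> : l * x = 1 by [].
apply: eqmod_eq => n.
apply: (eqmod_trans (eqmodM (eqmod_sym (lP n)) (eqmod_refl _ _))).
have -> : a%:R * (\sum_(i < n) w ^+ i) * x = 1 - w ^+ n.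
  by rewrite mulrAC -[a%:R * x](subKr 1) Dz -[RHS]opprB subrX1 -[RHS]mulNr opprB.
by rewrite -[X in padic_eqmod _ _ X]subr0; apply: eqmodD => //; apply: eqmodN.
Qed.

Lemma padic_nat_unit (m : nat) : ~~ (p %| m)%N -> (m%:R : Zp) \is a GRing.unit.
Proof.
move=> pNm; apply: padic_unit_of_Nmod_p => /(@eqmod_nat 1 m 0).
by rewrite expn1 mod0n => /eqP; apply/negP.
Qed.

Lemma padic_nat_neq0 (m : nat) : (0 < m)%N -> (m%:R : Zp) != 0.
Proof.
move=> m0; apply/eqP => E.
have : padic_eqmod m (m%:R : Zp) 0%:R by rewrite E.
move/eqmod_nat; rewrite mod0n modn_small; last by rewrite ltn_expl ?prime_gt1.
by move=> E0; rewrite E0 in m0.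
Qed.

(** [x^p - y^p] is [x - y] times a sum of [p] terms that agree modulo [p]. This is what
makes the Teichmuller sequence converge and its limit unique. *)
Lemma eqmod_expp k x y : (0 < k)%N -> padic_eqmod k x y ->
  padic_eqmod k.+1 (x ^+ p) (y ^+ p).
Proof.
move=> k0 E; have [z Dz] := E.
have : padic_eqmod 1 (\sum_(i < p) x ^+ (p.-1 - i) * y ^+ i) 0.
  have E1 := eqmod_leq k0 E.
  apply: (@eqmod_trans _ (\sum_(i < p) y ^+ p.-1)).
    apply: eqmod_sum => i _; have le_ip : (i <= p.-1)%N by rewrite -ltnS prednK ?prime_gt0.
    rewrite -[in X in padic_eqmod _ _ X](subnK le_ip) exprD.
    by apply: eqmodM => //; apply: eqmodX.
  rewrite sumr_const card_ord -mulr_natl -[p%:R]expr1; exact: eqmod_exp_p0.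
case=> w; rewrite subr0 expr1 => Dw; exists (z * w).
by rewrite subrXX Dz Dw exprSr; ring.
Qed.

End PadicCongruence.
#[export] Hint Resolve eqmod_refl : core.

(** * The Teichmuller character *)

Section Teichmuller.
Variables (p : nat) (pr_p : prime p).
Local Notation Zp := (padic_int pr_p).
Local Notation teich := (teichmuller pr_p).
Implicit Types (x y : Zp) (a b : 'F_p).

Lemma Fp_natE (m : nat) a : m%:R = a <-> padic_eqmod 1 (m%:R : Zp) (a : nat)%:R.
Proof.
split=> [<-|/eqmod_nat]; [apply/eqmod_nat|]; rewrite expn1; first by rewrite val_Fp_nat // modn_mod.
move=> E; apply: val_inj; rewrite /= val_Fp_nat // E modn_small //.
by have := ltn_ord a; rewrite [X in (_ < X)%N]Fp_cast.
Qed.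

Lemma FpD a b : padic_eqmod 1 (((a + b)%R : nat)%:R : Zp) ((a : nat)%:R + (b : nat)%:R).
Proof. by apply: eqmod_sym; rewrite -natrD; apply/Fp_natE; rewrite natrD !natr_Zp. Qed.

Lemma FpM a b : padic_eqmod 1 (((a * b)%R : nat)%:R : Zp) ((a : nat)%:R * (b : nat)%:R).
Proof. by apply: eqmod_sym; rewrite -natrM; apply/Fp_natE; rewrite natrM !natr_Zp. Qed.

Lemma Fp_eqmod a b : padic_eqmod 1 ((a : nat)%:R : Zp) (b : nat)%:R -> a = b.
Proof. by move/Fp_natE; rewrite natr_Zp. Qed.

Lemma Fp_neq0 a : a != 0 -> ~ padic_eqmod 1 ((a : nat)%:R : Zp) 0.
Proof. by move=> a0 /(@Fp_eqmod a 0) E; rewrite E eqxx in a0. Qed.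

Lemma root_unity_uniq x y : x ^+ p = x -> y ^+ p = y -> padic_eqmod 1 x y -> x = y.
Proof.
move=> Dx Dy E; apply: eqmod_eq => -[|k]; first exact: eqmod0.
by elim: k => // k IHk; rewrite -Dx -Dy; apply: eqmod_expp.
Qed.

(** The limit of the [p^n]-th powers of [m]. *)
Lemma teich_exists (m : nat) : exists x : Zp, x ^+ p = x /\ padic_eqmod 1 x m%:R.
Proof.
pose v n : Zp := m%:R ^+ (p ^ n).
have vS n : v n.+1 = v n ^+ p by rewrite /v -exprM expnSr.
have v10 : padic_eqmod 1 (v 1%N) (v 0%N).
  rewrite /v expn1 expr1 -natrX; apply/eqmod_nat; rewrite expn1.
  exact: fermat_little.
have vE n : padic_eqmod n.+1 (v n.+1) (v n).
  elim: n => // n IHn; rewrite [X in padic_eqmod _ X _]vS [X in padic_eqmod _ _ X]vS.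
  exact: eqmod_expp.
have [l lP] := padic_complete (fun n => eqmod_leq (leqnSn n) (vE n)).
exists l; split; last by apply: eqmod_trans (eqmod_sym (lP 1%N)) v10.
apply: eqmod_eq => n; apply: (@eqmod_trans _ pr_p n (v n) _ l _ (lP n)).
apply: (@eqmod_trans _ pr_p _ (v n.+1)); last exact: eqmod_leq (leqnSn n) (vE n).
by rewrite vS; apply: eqmodX; apply: eqmod_sym.
Qed.

Lemma teichP a : a != 0 ->
  teich a ^+ p.-1 = 1 /\ padic_eqmod 1 (teich a) (a : nat)%:R.
Proof.
move=> a0; have [x [xp Ex]] := teich_exists a.
rewrite /teichmuller; case: classical_sets.xgetP => [y _ //|/(_ x)]; case; split=> //.
have : x != 0.
  apply/eqP => x0; rewrite x0 in Ex; apply: (Fp_neq0 a0); exact: eqmod_sym.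
move/mulIf; apply; rewrite mul1r -exprSr prednK ?prime_gt0 //.
Qed.

Lemma teich_exp a : a != 0 -> teich a ^+ p.-1 = 1.
Proof. by case/teichP. Qed.

Lemma teich0 : teich 0 = 0.
Proof.
rewrite /teichmuller; case: classical_sets.xgetP => //= y _ [yp]; rewrite -[0%:R]/(0 : Zp) => y0.
have p1 : (0 < p.-1)%N by rewrite -subn1 subn_gt0 prime_gt1.
have : padic_eqmod 1 (1 : Zp) 0%:R.
  rewrite -yp -(prednK p1) exprS.
  apply: (@eqmod_trans _ pr_p 1 (0 * y ^+ p.-1.-1)); first exact: eqmodM.
  by rewrite mul0r.
by move/(@eqmod_nat _ pr_p 1 1 0); rewrite expn1 mod0n modn_small ?prime_gt1.
Qed.

Lemma teich_eqmod a : padic_eqmod 1 (teich a) (a : nat)%:R.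
Proof. by have [->|/teichP[]//] := eqVneq a 0; rewrite teich0. Qed.

Lemma teich_expp a : teich a ^+ p = teich a.
Proof.
have -> : teich a ^+ p = teich a ^+ p.-1.+1 by rewrite prednK ?prime_gt0.
rewrite exprS; have [->|a0] := eqVneq a 0.
  by rewrite teich0 mul0r.
by rewrite teich_exp // mulr1.
Qed.

Lemma teich_uniq a x : x ^+ p = x -> padic_eqmod 1 x (a : nat)%:R -> x = teich a.
Proof.
move=> Dx Ex; apply: root_unity_uniq => //; first exact: teich_expp.
exact: eqmod_trans Ex (eqmod_sym (teich_eqmod a)).
Qed.

Lemma teichM a b : teich (a * b) = teich a * teich b.
Proof.
apply/esym/teich_uniq; first by rewrite exprMn !teich_expp.
apply: eqmod_trans (eqmod_sym (FpM a b)).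
by apply: eqmodM; apply: teich_eqmod.
Qed.

Lemma teich1 : teich 1 = 1.
Proof. by apply/esym/teich_uniq; rewrite ?expr1n //; apply/(@Fp_natE 1). Qed.

Lemma teichX a n : teich (a ^+ n) = teich a ^+ n.
Proof. by elim: n => [|n IHn]; rewrite ?teich1 // !exprS teichM IHn. Qed.

Lemma teich_inj : injective teich.
Proof.
move=> a b E; apply: Fp_eqmod; apply: eqmod_trans (teich_eqmod b).
by rewrite -E; apply/eqmod_sym/teich_eqmod.
Qed.

Lemma teichV a : a != 0 -> teich a^-1 = (teich a)^-1.
Proof.
move=> a0; have E : teich a^-1 * teich a = 1 by rewrite -teichM mulVf // teich1.
by rewrite -[RHS]mul1r -E mulrK //; apply/unitrP; exists (teich a^-1); rewrite [teich a * _]mulrC E.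
Qed.

Lemma sum_teich_exp a : a != 0 ->
  \sum_(j < p.-1) teich a ^+ j = if a == 1 then p.-1%:R else 0.
Proof.
move=> a0; case: eqP => [->|/eqP a1].
  by rewrite teich1 -[in RHS](card_ord p.-1) -sumr_const; apply: eq_bigr => i _; rewrite expr1n.
have t1 : teich a - 1 != 0 by rewrite subr_eq0 -teich1 (inj_eq teich_inj).
by apply: (mulfI t1); rewrite mulr0 -subrX1 teich_exp // subrr.
Qed.

(** A factor [teich b ^+ k != 1] exists unless [p - 1] divides [k], because [X^r - 1]
has at most [r] roots; translating by [b] then multiplies the sum by that factor. *)
Lemma sum_teich k : \sum_(a | a != 0) teich a ^+ k = if (p.-1 %| k)%N then p.-1%:R else 0.
Proof.
case: ifPn => [/dvdnP[m ->]|ndvd].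
  rewrite (eq_bigr (fun=> 1)) => [|a a0]; last by rewrite mulnC exprM teich_exp // expr1n.
  by rewrite sumr_const cardC1 card_Fp.
have [b b0 bk] : exists2 b : 'F_p, b != 0 & b ^+ k != 1.
  have p1 : (0 < p.-1)%N by rewrite -subn1 subn_gt0 prime_gt1.
  set r := (k %% p.-1)%N; have r0 : (0 < r)%N by rewrite lt0n.
  have lt_r : (r < p.-1)%N by rewrite ltn_mod.
  pose f : {poly 'F_p} := 'X^r - 1.
  have f0 : f != 0 by rewrite -size_poly_eq0 size_XnsubC.
  have : ~~ all (root f) (enum (predC1 (0 : 'F_p))).
    apply: contraTN lt_r => /(max_poly_roots f0)/(_ (enum_uniq _)).
    by rewrite -cardE cardC1 card_Fp // size_XnsubC // ltnS -leqNgt.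
  case/allPn=> b; rewrite mem_enum inE => b0 fb; exists b => //.
  apply: contra fb => /eqP bk; rewrite rootE !hornerE subr_eq0.
  have bp : b ^+ p.-1 = 1 by apply: teich_inj; rewrite teichX teich1 teich_exp.
  by rewrite -bk [in X in _ == X](divn_eq k p.-1) exprD mulnC exprM bp expr1n mul1r.
have t1 : teich b ^+ k - 1 != 0.
  by rewrite subr_eq0 -teichX -teich1 (inj_eq teich_inj).
apply: (mulfI t1); rewrite mulr0 mulrBl mul1r mulr_sumr.
rewrite [X in _ - X](reindex_onto (fun a => b * a) (fun a => a / b)) /=; last first.
  by move=> a _; rewrite mulrC divfK.
rewrite [X in _ - X](eq_bigl (fun a => a != 0)) => [|a]; last first.
  by rewrite mulf_eq0 (negbTE b0) mulrAC divff // mul1r eqxx andbT.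
by rewrite -sumrB big1 // => a a0; rewrite teichM exprMn subrr.
Qed.
End Teichmuller.

(** * Functional equations of the p-adic gamma function *)

Lemma ceil_div p a n A : (a < p)%N -> (0 < n)%N -> (n + a = p * A)%N -> (0 < A)%N ->
  ((n.-1 %/ p).+1 = A)%N.
Proof.
case: A => // B lt_ap n0 n_a _; congr _.+1.
have -> : n.-1 = (B * p + (p - a).-1)%N.
  by move: n_a; rewrite mulnS [(p * B)%N]mulnC; move: (B * p)%N; lia.
rewrite divnMDl ?(leq_trans _ lt_ap) // divn_small ?addn0 //.
by rewrite prednK ?subn_gt0 // leq_subr.
Qed.

Lemma big_ord_block (R : Type) (idx : R) (op : Monoid.law idx) (f : nat -> R) m n :
  \big[op/idx]_(j < m * n) f j =
  \big[op/idx]_(i < m) \big[op/idx]_(v < n) f (v + i * n)%N.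
Proof.
elim: m => [|m IHm]; first by rewrite !big_ord0.
have -> : (m.+1 * n = m * n + n)%N by rewrite mulSn addnC.
rewrite big_ord_recr -IHm big_split_ord /=; congr (op _ _).
by apply: eq_bigr => i _; rewrite addnC.
Qed.

Section PadicGamma.
Variables (p : nat) (pr_p : prime p) (p_odd : odd p) (p_gt3 : (3 < p)%N).
Local Notation Zp := (padic_int pr_p).
Local Notation gnat := (padic_gamma_nat pr_p).
Local Notation eqm := (@padic_eqmod p pr_p).

(** From [j] to [j + 1], [padic_gamma_nat] is multiplied by [- unit_part j]. This includes
[j = 0], where the value is 1. *)
Definition unit_part (j : nat) : Zp := if (p %| j)%N then 1 else j%:R.

Lemma unit_part_unit j : unit_part j \is a GRing.unit.
Proof. by rewrite /unit_part; case: ifPn => [_|]; [exact: unitr1 | exact: padic_nat_unit]. Qed.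

Lemma eqmod_of_eq k (x y : Zp) : x = y -> eqm k x y.
Proof. by move=> ->. Qed.

Lemma gnat0 : gnat 0 = 1.
Proof. by rewrite /padic_gamma_nat big_geq ?mulr1. Qed.

Lemma gnatS m : gnat m.+1 = - unit_part m * gnat m.
Proof.
rewrite /padic_gamma_nat; case: m => [|m].
  by rewrite !big_geq // /unit_part dvdn0 expr1 expr0 !mulr1.
rewrite big_mkcond big_nat_recr //= -big_mkcond /= exprS /unit_part.
by case: (p %| m.+1)%N => /=; ring.
Qed.

Lemma gnat_prod n : gnat n = (-1) ^+ n * \prod_(i < n) unit_part i.
Proof.
elim: n => [|n IHn]; first by rewrite gnat0 big_ord0 mulr1.
by rewrite gnatS IHn big_ord_recr exprS /=; ring.
Qed.

Lemma unit_part_eqmod k m n : (0 < k)%N -> eqm k m%:R n%:R ->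
  eqm k (unit_part m) (unit_part n).
Proof.
move=> k0 E; rewrite /unit_part.
suff -> : (p %| m)%N = (p %| n)%N by case: ifP.
have /(eqmod_leq k0)/eqmod_nat := E; rewrite expn1 => Em.
by rewrite /dvdn Em.
Qed.

(** First-order expansion in [c] of the product over an arithmetic progression. *)
Lemma prod_arith (v c : Zp) n : exists z,
  \prod_(i < n.+1) (v + i%:R * c) =
  v ^+ n.+1 + c * (\sum_(i < n.+1) i%:R) * v ^+ n + c ^+ 2 * z.
Proof.
elim: n => [|n [z IHn]].
  by exists 0; rewrite !big_ord1 mul0r !mulr0 mul0r !addr0.
exists ((\sum_(i < n.+1) i%:R) * n.+1%:R * v ^+ n + z * (v + n.+1%:R * c)).
rewrite big_ord_recr IHn [\sum_(i < n.+2) _]big_ord_recr /= !exprS.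
by move: (bigop.body _ _ _) => S; ring.
Qed.

(** Wilson's theorem modulo [p^(k+1)]. The residues below [p^(k+2)] fall into [p]
translates of those below [p^(k+1)]; since the sum of the [i < p] is divisible by [p],
the product over the translates of [v] is [v^p], and [p]-th powers raise the level. *)
Lemma wilson_exp k : eqm k.+1 (\prod_(j < p ^ k.+1) unit_part j) (-1).
Proof.
elim: k => [|k IHk].
  have -> : \prod_(j < p ^ 1) unit_part j = (p.-1)`!%:R.
    rewrite expn1 fact_prod natr_prod.
    rewrite -(big_mkord xpredT unit_part) big_ltn ?prime_gt0 //.
    rewrite {1}/unit_part dvdn0 mul1r prednK ?prime_gt0 //.
    rewrite big_nat [RHS]big_nat; apply: eq_bigr => j /andP[j0 ltjp].
    by rewrite /unit_part gtnNdvd.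
  have /eqP : (p %| ((p.-1)`!).+1)%N by rewrite -Wilson ?prime_gt1.
  move=> Df; have : eqm 1 ((p.-1)`!.+1)%:R 0.
    by apply/(@eqmod_nat _ pr_p 1 _ 0); rewrite expn1 mod0n.
  rewrite -natr1 => E.
  have := eqmodD E (eqmod_refl 1 (-1 : Zp)).
  by rewrite addrK add0r.
have k0 : (0 < k.+1)%N by [].
apply: (@eqmod_trans _ _ _ ((\prod_(j < p ^ k.+1) unit_part j) ^+ p)); last first.
  have -> : (-1 : Zp) = (-1) ^+ p by rewrite -signr_odd p_odd.
  exact: eqmod_expp.
have -> : \prod_(j < p ^ k.+2) unit_part j =
   \prod_(i < p) \prod_(v < p ^ k.+1) unit_part (v + i * p ^ k.+1).
  exact: (big_ord_block _ unit_part p (p ^ k.+1)).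
rewrite exchange_big /= -prodrXl.
apply: eqmod_prod => v _; rewrite /unit_part.
have [pv|pNv] := boolP (p %| v)%N.
  rewrite expr1n big1 => [//|i _].
  by rewrite dvdn_addl ?pv // expnS mulnCA dvdn_mulr.
have -> : \prod_(i < p) unit_part (v + i * p ^ k.+1) =
   \prod_(i < p.-1.+1) (v%:R + i%:R * p%:R ^+ k.+1).
  rewrite prednK ?prime_gt0 //; apply: eq_bigr => i _.
  rewrite /unit_part dvdn_addl; last by rewrite expnS mulnCA dvdn_mulr.
  by rewrite (negbTE pNv) natrD natrM natrX.
have [z ->] := prod_arith v%:R (p%:R ^+ k.+1) p.-1.
rewrite prednK ?prime_gt0 //.
have -> : (\sum_(i < p) i%:R : Zp) = p%:R * (p./2)%:R.
  rewrite -natr_sum -natrM -(big_mkord xpredT id) bin2_sum bin2odd //.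
  by rewrite -[in X in (_ * X)%N](odd_double_half p) p_odd add1n /= doubleK.
apply: (@eqmod_trans _ _ _ (v%:R ^+ p + 0 + 0)); last by rewrite !addr0.
apply: eqmodD; first apply: eqmodD => //.
  rewrite mulrA -exprSr -mulrA; exact: eqmod_exp_p0.
rewrite -exprM; apply: (@eqmod_leq _ _ (k.+1 * 2)); last exact: eqmod_exp_p0.
by rewrite muln2 -addnn addSn ltnS leq_addl.
Qed.

Lemma gnat_period k m : eqm k (gnat (m + p ^ k)) (gnat m).
Proof.
case: k => [|k]; first exact: eqmod0.
elim: m => [|m IHm].
  rewrite add0n gnat0 gnat_prod -signr_odd oddX p_odd orbT expr1.
  apply: (@eqmod_trans _ _ _ (-1 * -1)); last by rewrite mulrNN mulr1.
  by apply: eqmodM => //; apply: wilson_exp.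
rewrite addSn !gnatS; apply: eqmodM => //; apply: eqmodN.
apply: unit_part_eqmod => //; apply/eqmod_nat.
by rewrite modnDr.
Qed.

Lemma gnat_eqmod k m n : eqm k m%:R n%:R -> eqm k (gnat m) (gnat n).
Proof.
move/eqmod_nat => E.
have red l : eqm k (gnat l) (gnat (l %% p ^ k)).
  rewrite {1}(divn_eq l (p ^ k)); elim: (l %/ p ^ k)%N => [|t IHt].
    by rewrite mul0n add0n.
  rewrite mulSn -addnA addnC; apply: eqmod_trans IHt; exact: gnat_period.
by apply: eqmod_trans (red m) _; rewrite E; apply/eqmod_sym/red.
Qed.

(** Existence of the limit that defines [padic_gamma], with an explicit modulus. By
periodicity any integer approximation of [x] modulo [p^k] gives the value modulo
[p^k]; all identities below are proved on such integers. *)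
Lemma padic_gammaE k x m : eqm k x m%:R -> eqm k (padic_gamma x) (gnat m).
Proof.
rewrite /padic_gamma; have [->|x0] := eqVneq x 0.
  by move=> E; rewrite -gnat0; apply: gnat_eqmod.
(* The term p ^ n makes the approximations positive. *)
pose a n := (`|x n|%N + p ^ n)%N.
have aE n : eqm n x (a n)%:R.
  have [i Ei] := padic_approx n x.
  apply: (eqmod_trans Ei); apply/eqmod_nat; rewrite /a modnDr.
  have /padic_eqmodE -> := Ei; rewrite padic_natE modz_nat absz_nat.
  by rewrite modn_mod.
have vP n : eqm n (gnat (a n.+1)) (gnat (a n)).
  apply: gnat_eqmod; apply: eqmod_trans (aE n); apply: eqmod_sym.
  exact: eqmod_leq (leqnSn n) (aE n.+1).
have [l lP] := padic_complete vP.
have lE n i : eqm n x i%:R -> eqm n l (gnat i).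
  move=> Ei; apply: (eqmod_trans (eqmod_sym (lP n))); apply: gnat_eqmod.
  by apply: eqmod_trans Ei; apply/eqmod_sym/aE.
case: classical_sets.xgetP => [y _ yP|/(_ l)]; last first.
  case=> u _ uP n; have [N _ HN] := uP n; exists N => // i /HN /= Ei.
  by apply/eqmod_sym/lE/eqmod_sym.
move=> E; have a_gt0 (n : nat) : (0 < a n)%N.
  by rewrite /a ltn_addl // expn_gt0 prime_gt0.
have a_cvg : padic_cvg (fun n => (a n)%:R) x.
  move=> n; exists n => // i /= le_ni; exact: (eqmod_leq le_ni (eqmod_sym (aE i))).
have [N _ HN] := yP a a_gt0 a_cvg k.
apply: (@eqmod_trans _ _ _ (gnat (a (maxn N k)))).
  exact/eqmod_sym/(HN (maxn N k))/leq_maxl.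
apply: gnat_eqmod; apply: eqmod_trans E; apply: eqmod_sym.
exact: eqmod_leq (leq_maxr _ _) (aE _).
Qed.

Lemma ratr_eqmod k (q : rat) (d c m : nat) : ~~ (p %| d)%N ->
  d%:R * q = c%:R -> (d * m = c %[mod p ^ k])%N ->
  eqm k (ratr q) m%:R.
Proof.
move=> pNd Dq Em.
have dU : (d%:R : Zp) \is a GRing.unit by exact: padic_nat_unit.
have Eint : d%:Z * numq q = c%:Z * denq q.
  apply: (@intr_inj rat); rewrite !rmorphM /= -!pmulrn -Dq -mulrA; congr (_ * _).
  exact: numqE.
have den_dvd : (`|denq q| %| d)%N.
  have : (denq q %| d%:Z * numq q)%Z by rewrite Eint dvdz_mull.
  rewrite dvdzE abszM absz_nat Gauss_dvdl // coprime_sym.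
  exact: coprime_num_den.
have Dden : (denq q)%:~R = (`|denq q|%N)%:R :> Zp.
  by rewrite -[denq q in LHS]gez0_abs // denq_ge0.
have denU : ((denq q)%:~R : Zp) \is a GRing.unit.
  rewrite Dden; apply: padic_nat_unit; apply: contra pNd => pd; exact: dvdn_trans pd den_dvd.
have Dr : d%:R * (ratr q : Zp) = c%:R.
  rewrite /ratr mulrA; apply: (mulIr denU); rewrite divrK //.
  by have := congr1 (fun z : int => z%:~R : Zp) Eint; rewrite !rmorphM.
have : eqm k (d%:R * ratr q) (d%:R * m%:R).
  by rewrite Dr -natrM; apply/eqmod_nat.
by move/(eqmodM (eqmod_refl k (d%:R)^-1)); rewrite !mulKr.
Qed.

Lemma padic_gamma_ratE k (q : rat) (d c m : nat) : ~~ (p %| d)%N ->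
  d%:R * q = c%:R -> (d * m = c %[mod p ^ k])%N ->
  eqm k (padic_gamma (ratr q)) (gnat m).
Proof. by move=> pNd Dq Em; apply/padic_gammaE/(ratr_eqmod pNd Dq). Qed.

Lemma gnat_unit m : gnat m \is a GRing.unit.
Proof.
elim: m => [|m IHm]; first by rewrite gnat0 unitr1.
by rewrite gnatS unitrM unitrN unit_part_unit.
Qed.

Lemma padic_gamma_unit (x : Zp) : padic_gamma x \is a GRing.unit.
Proof.
have [m Em] := padic_approx 1 x; apply: padic_unit_of_Nmod_p => E.
have := gnat_unit m; case/unitrP=> y [ym _].
have : eqm 1 1%:R 0%:R.
  rewrite -[1%:R]ym; apply: (@eqmod_trans _ _ _ (y * 0)); last by rewrite mulr0.
  apply: eqmodM => //; apply: eqmod_trans E.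
  exact/eqmod_sym/padic_gammaE.
by move/eqmod_nat; rewrite expn1 mod0n modn_small ?prime_gt1.
Qed.

(** Reflection on integers: when [n + K] is 0 modulo [p^k] the factors of
[padic_gamma_nat n] and of the product cancel pairwise, up to one sign per multiple
of [p]. *)
Lemma gnat_reflect k K n : (0 < k)%N -> (p ^ k %| n + K)%N ->
  eqm k (gnat n * \prod_(i < K.+1) unit_part i) ((-1) ^+ (K %/ p)).
Proof.
move=> k0; elim: K n => [|K IHK] n dvd_nK.
  rewrite big_ord1 /unit_part dvdn0 mulr1 div0n expr0 -gnat0.
  by apply/gnat_eqmod/eqmod_nat; rewrite mod0n; apply/eqP; rewrite addn0 in dvd_nK.
rewrite big_ord_recr /= divnS ?prime_gt0 //.
have := IHK n.+1; rewrite addSnnS => /(_ dvd_nK).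
rewrite gnatS => E.
have pk : (p %| n + K.+1)%N by apply: dvdn_trans dvd_nK; rewrite dvdn_exp.
have En : eqm k n%:R (- K.+1%:R).
  rewrite -[n%:R](addrK K.+1%:R) -natrD -[X in eqm _ _ X]add0r.
  apply: eqmodD => //; apply/(@eqmod_nat _ pr_p k _ 0).
  by rewrite mod0n; apply/eqP.
have pn : (p %| n)%N = (p %| K.+1)%N.
  by apply/idP/idP => h; [rewrite dvdn_addr in pk | rewrite dvdn_addl in pk].
move: E; rewrite /unit_part pn; case: ifP => [_|_] /= E.
  rewrite mulr1 add1n exprS mulN1r; have := eqmodN E.
  by rewrite mulN1r mulNr opprK.
rewrite add0n; apply: eqmod_trans E.
apply: (@eqmod_trans _ _ _ (gnat n * (\prod_(i < K.+1) unit_part i * - n%:R))).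
  do 2 apply: eqmodM => //; rewrite -[X in eqm _ X _]opprK.
  exact/eqmodN/eqmod_sym.
rewrite (_ : gnat n * (_ * _) = - n%:R * gnat n * \prod_(i < K.+1) unit_part i) //.
by rewrite mulrA mulrC mulrA.
Qed.

(** [- a geo N] approximates [a / (p - 1)] modulo [p^N]. *)
Definition geo N := (\sum_(i < N) p ^ i)%N.

Lemma geoS N : geo N.+1 = (1 + p * geo N)%N.
Proof.
rewrite /geo big_ord_recl expn0 big_distrr; congr (_ + _)%N.
by apply: eq_bigr => i _; rewrite /= expnS.
Qed.

Lemma geoSr N : geo N.+1 = (geo N + p ^ N)%N.
Proof. by rewrite /geo big_ord_recr. Qed.

Lemma geoE N : (p.-1 * geo N)%N = (p ^ N).-1.
Proof. by rewrite predn_exp. Qed.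

Lemma pred_prime_Ndvd : ~~ (p %| p.-1)%N.
Proof. by rewrite gtnNdvd // -?subn1 ?subn_gt0 ?prime_gt1 // subn1 ltn_predL prime_gt0. Qed.

(** The form in which the Gross-Koblitz formula meets [padic_gamma]: for
[K = a geo (N+1)], close to [- a / (p - 1)], the product is [K!] divided by
[p^(K / p) (K / p)!] (quotients rounded down). *)
Lemma padic_gamma_frac a N : (a < p.-1)%N ->
  eqm N.+1 (padic_gamma (ratr (a%:R / p.-1%:R)) *
    \prod_(i < (a * geo N.+1).+1) unit_part i) ((-1) ^+ (a * geo N)).
Proof.
move=> lt_ap; set K := (a * geo N.+1)%N.
have lt_ap' : (a < p)%N by apply: leq_trans lt_ap _; rewrite leq_pred.
have KE : (K %/ p = a * geo N)%N.
  by rewrite /K geoS mulnDr muln1 mulnCA addnC mulnC divnMDl ?prime_gt0 // divn_small ?addn0.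
have pK : (p.-1 * K + a = a * p ^ N.+1)%N.
  rewrite /K mulnCA geoE -[X in (_ + X)%N]muln1 -mulnDr addn1 prednK //.
  by rewrite expn_gt0 prime_gt0.
pose n := (K * (p ^ N.+1).-1)%N.
have nK : (n + K = K * p ^ N.+1)%N.
  by rewrite /n -[X in (_ + X)%N]muln1 -mulnDr addn1 prednK // expn_gt0 prime_gt0.
rewrite -KE; apply: eqmod_trans (gnat_reflect (isT : 0 < N.+1)%N (n := n) _); last first.
  by rewrite nK dvdn_mull.
apply: eqmodM => //; apply: (@padic_gamma_ratE _ _ p.-1 a); first exact: pred_prime_Ndvd.
  rewrite mulrC divfK // pnatr_eq0 -lt0n.
  by apply: leq_trans lt_ap.
apply/eqP; rewrite -(eqn_modDr (p.-1 * K)) -mulnDr nK addnC pK.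
by rewrite mulnA !modnMl.
Qed.

Lemma padic_gamma_reflect a : (a < p.-1)%N ->
  padic_gamma (ratr (a%:R / p.-1%:R)) * padic_gamma (ratr (1 - a%:R / p.-1%:R)) =
  (-1) ^+ a.+1 :> Zp.
Proof.
move=> lt_ap; apply: eqmod_eq => -[|N]; first exact: eqmod0.
have p1 : (p.-1%:R : rat) != 0.
  by rewrite pnatr_eq0 -lt0n; apply: leq_trans lt_ap.
set K := (a * geo N.+1)%N.
have pK : (p.-1 * K + a = a * p ^ N.+1)%N.
  rewrite /K mulnCA geoE -[X in (_ + X)%N]muln1 -mulnDr addn1 prednK //.
  by rewrite expn_gt0 prime_gt0.
have E2 : eqm N.+1 (padic_gamma (ratr (1 - a%:R / p.-1%:R))) (gnat K.+1).
  apply: (@padic_gamma_ratE _ _ p.-1 (p.-1 - a)); first exact: pred_prime_Ndvd.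
    by rewrite natrB ?(ltnW lt_ap) // mulrBr mulr1 mulrC divfK.
  apply/eqP; rewrite -(eqn_modDr a) subnK ?(ltnW lt_ap) //.
  by rewrite mulnS -addnA pK addnC modnMDl.
apply: (eqmod_trans (eqmodM (eqmod_refl _ _) E2)).
rewrite gnat_prod mulrCA.
apply: (eqmod_trans (eqmodM (eqmod_refl _ _) (padic_gamma_frac N lt_ap))).
rewrite -exprD; have parity : odd (K.+1 + a * geo N) = odd a.+1.
  by rewrite /K geoSr mulnDr addSn /= !oddD !oddM oddX p_odd orbT /= andbT addbAC addbb.
by rewrite -(signr_odd _ (K.+1 + _)) parity signr_odd.
Qed.

(** The ratio of [unit_part j] to the value at [j / 3]: it is 1 at the multiples of [p],
which [unit_part] ignores. *)
Definition three_part (j : nat) : Zp := if (p %| j)%N then 1 else 3%:R.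

Lemma prod_three_part n :
  (\prod_(j < n.+1) three_part j) * 3%:R ^+ (n %/ p).+1 = 3%:R ^+ n.+1.
Proof.
elim: n => [|n IHn]; first by rewrite big_ord1 /three_part dvdn0 mul1r div0n.
rewrite big_ord_recr /= divnS ?prime_gt0 // [RHS]exprS -IHn /three_part.
by case: (p %| n.+1)%N; rewrite ?add1n ?add0n ?exprS /=; ring.
Qed.

(** Triplication on integers, [c] being an inverse of 3. By induction on [m]: the three
factors gained on the left, each multiplied by 3, are those gained by
[padic_gamma_nat (3 m)]. *)
Lemma gnat_triple k m c : (0 < k)%N -> (3 * c = 1 %[mod p ^ k])%N ->
  eqm k (gnat m * gnat (m + c) * gnat (m + 2 * c) *
         \prod_(j < 3 * m) three_part j)
        (gnat (3 * m) * (gnat c * gnat (2 * c))).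
Proof.
move=> k0 Dc; have E3 : eqm k (3 * c)%:R 1%:R by apply/eqmod_nat.
have Dn n h : eqm k (3 * (n + h * c))%:R (3 * n + h)%:R.
  rewrite mulnDr mulnCA !natrD; apply: eqmodD => //.
  rewrite -[X in eqm _ _ X]mulr1 natrM; apply: eqmodM => //; exact: E3.
have step n h : eqm k (unit_part (n + h * c) * three_part (3 * n + h)) (unit_part (3 * n + h)).
  have Ep : (p %| n + h * c)%N = (p %| 3 * n + h)%N.
    have /(eqmod_leq k0)/eqmod_nat := Dn n h; rewrite expn1 => Em.
    by rewrite [RHS]/dvdn -Em -/(dvdn _ _) Gauss_dvdr // prime_coprime // gtnNdvd.
  have := unit_part_eqmod k0 (Dn n h).
  rewrite /unit_part /three_part Ep Gauss_dvdr ?Ep; last by rewrite prime_coprime // gtnNdvd.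
  by case: ifP => _; rewrite ?mulr1 // mulrC -natrM.
elim: m => [|m IHm].
  by rewrite muln0 big_ord0 !add0n gnat0 mulr1 !mul1r.
have -> : (3 * m.+1 = (3 * m).+3)%N by rewrite mulnS.
rewrite !big_ord_recr /= !addSn !gnatS.
move: (step m 0%N) (step m 1%N) (step m 2%N); rewrite !mul0n !addn0 !mul1n addn1 addn2 => s0 s1 s2.
pose M := gnat m * gnat (m + c) * gnat (m + 2 * c) * \prod_(j < 3 * m) three_part j.
apply: (@eqmod_trans _ _ _ (- (unit_part m * three_part (3 * m) *
   (unit_part (m + c) * three_part (3 * m).+1) *
   (unit_part (m + 2 * c) * three_part (3 * m).+2)) * M)).
  by apply: eqmod_of_eq; rewrite /M; ring.
rewrite [X in eqm _ _ X](_ : _ = - (unit_part (3 * m) * unit_part (3 * m).+1 *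
  unit_part (3 * m).+2) * (gnat (3 * m) * (gnat c * gnat (2 * c)))); last by ring.
apply: eqmodM => //; apply: eqmodN; apply: eqmodM => //; exact: eqmodM.
Qed.

Lemma teich_approx a (m : nat) N : eqm 1 m%:R (a : 'F_p)%:R ->
  eqm N.+1 (m%:R ^+ (p ^ N)) (teichmuller pr_p a).
Proof.
move=> Ema; elim: N => [|N IHN].
  by rewrite expn0 expr1; apply: eqmod_trans Ema (eqmod_sym (teich_eqmod _ _)).
rewrite expnSr exprM -[X in eqm _ _ X]teich_expp; exact: eqmod_expp.
Qed.

(** Division of [G P = X] by the unit [P], whose inverse [T] is known only modulo [p^k]. *)
Lemma eqmod_cancel k (L G P T X : Zp) :
  eqm k L G -> eqm k (P * T) 1 -> eqm k (G * P) X -> eqm k L (T * X).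
Proof.
move=> EL EPT EGP; apply: (eqmod_trans EL).
apply: (@eqmod_trans _ _ _ (G * (P * T))).
  by rewrite -[X in eqm _ X _]mulr1; apply: eqmodM => //; apply: eqmod_sym.
by rewrite mulrA mulrC; apply: eqmodM.
Qed.

(** Gauss multiplication formula for 3 at [y = a / (p - 1)]. The integer lemma is applied
to approximations [m], [n = 3 m] of [y / 3], [y]. The power of 3 it collects is
[n - A'], with [n + a = p A'], and its exponent is [- a p^N] modulo [p^(2N+1) (p - 1)];
as [3^(p^N)] tends to [teichmuller 3], this gives [teichmuller 3 ^ (- a)]. *)
Lemma padic_gamma_triple a : (a < p.-1)%N ->
  padic_gamma (ratr (a%:R / p.-1%:R / 3%:R)) *
  padic_gamma (ratr ((a%:R / p.-1%:R + 1) / 3%:R)) *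
  padic_gamma (ratr ((a%:R / p.-1%:R + 2%:R) / 3%:R)) =
  teichmuller pr_p 3%:R ^+ a * padic_gamma (ratr (a%:R / p.-1%:R)) *
  (padic_gamma (ratr (1 / 3%:R)) * padic_gamma (ratr (2%:R / 3%:R))) :> Zp.
Proof.
move=> lt_ap; have [->|] := posnP a.
  by rewrite !mul0r !add0r expr0 !mul1r mulrA.
move=> a0; apply: eqmod_eq => -[|N]; first exact: eqmod0.
have pX0 e : (0 < p ^ e)%N by rewrite expn_gt0 prime_gt0.
have p1 : (p.-1%:R : rat) != 0.
  by rewrite pnatr_eq0 -lt0n; apply: leq_trans lt_ap.
have n31 : ~~ (p %| 3 * p.-1)%N.
  by rewrite Euclid_dvdM // negb_or pred_prime_Ndvd andbT gtnNdvd.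
(* The even exponent 2 (N+1) makes n divisible by 3. *)
pose n := (a * geo N.+1 * (p ^ (2 * N.+1)).-1)%N.
pose A' := (a * geo N.+1 * p ^ (2 * N).+1 - a * geo N)%N.
have [c Dc] : exists c, (3 * c = 1 %[mod p ^ N.+1])%N.
  have co : coprime 3 (p ^ N.+1).
    by rewrite coprimeXr // coprime_sym prime_coprime // gtnNdvd.
  have [u v Duv _] := egcdnP (p ^ N.+1) (isT : 0 < 3)%N; exists u.
  by rewrite mulnC Duv (eqP co) modnMDl.
have [m Dm] : exists m, n = (3 * m)%N.
  suff /dvdnP[m Dm] : (3 %| n)%N by exists m; rewrite mulnC.
  rewrite dvdn_mull // -subn1 -eqn_mod_dvd ?pX0 //.
  have : (p ^ 2 = 1 %[mod 3])%N.
    have : (p %% 3 != 0)%N by rewrite -/(dvdn 3 p) dvdn_prime2 // ltn_eqF.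
    have : (p %% 3 < 3)%N by rewrite ltn_mod.
    by rewrite -modnXm; case: (p %% 3)%N => [|[|[|]]].
  by move=> E; rewrite expnM -modnXm E modnXm exp1n.
have p1n : (p.-1 * n = a %[mod p ^ N.+1])%N.
  rewrite /n mulnA mulnCA geoE mulnC expnM -mulnn expnMn.
  have : (0 < p ^ N.+1)%N by []. case: (p ^ N.+1)%N => // Q _.
  have -> : ((Q.+1 * Q.+1).-1 = Q + Q * Q.+1)%N by [].
  rewrite succnK.
  set L := (_ * _)%N; have : (L + a * Q.+1 = a * (Q * Q.+1) * Q.+1 + a)%N.
    by rewrite /L; ring.
  by move=> /(congr1 (modn^~ Q.+1)); rewrite modnMDl addnC modnMDl.
have Gm h : eqm N.+1 (padic_gamma (ratr ((a%:R / p.-1%:R + h%:R) / 3%:R))) (gnat (m + h * c)).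
  apply: (@padic_gamma_ratE _ _ (3 * p.-1) (a + h * p.-1)) => //.
    by rewrite natrM natrD natrM; field; rewrite p1.
  have -> : (3 * p.-1 * (m + h * c) = p.-1 * (3 * m) + h * p.-1 * (3 * c))%N by ring.
  rewrite -Dm.
  by rewrite -modnDm p1n -[in X in (_ + X)%N]modnMmr Dc modnMmr muln1 modnDm.
have G3 : eqm N.+1 (padic_gamma (ratr (a%:R / p.-1%:R))) (gnat n).
  apply: (@padic_gamma_ratE _ _ p.-1 a) => //; first exact: pred_prime_Ndvd.
  by rewrite mulrC divfK.
have Gc h : (0 < h)%N -> eqm N.+1 (padic_gamma (ratr (h%:R / 3%:R))) (gnat (h * c)).
  move=> _; apply: (@padic_gamma_ratE _ _ 3 h) => //; first by rewrite gtnNdvd.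
    by rewrite mulrC divfK.
  by rewrite mulnCA -modnMmr Dc modnMmr muln1.
have g1 : (0 < geo N.+1)%N by rewrite geoS.
have DA : (A' + a * geo N = a * geo N.+1 * p ^ (2 * N).+1)%N.
  by rewrite subnK // -mulnA leq_mul // geoSr mulnDl -[X in (X <= _)%N]muln1
     (leq_trans _ (leq_addr _ _)) // leq_mul.
have Dn : (n + a * geo N.+1 = a * geo N.+1 * p ^ (2 * N).+1 * p)%N.
  rewrite /n -mulnSr prednK //; have -> : (2 * N.+1 = (2 * N).+2)%N by rewrite mulnS add2n.
  by rewrite [(p ^ _.+2)%N]expnSr mulnA.
have n_a : (n + a = p * A')%N.
  apply: (@addIn (p * (a * geo N))); rewrite -mulnDr DA mulnC -Dn geoS.
  by ring.
have n_geo : (n + a * p ^ N = A' + p ^ (2 * N).+1 * (p.-1 * (a * geo N.+1)))%N.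
  apply: (@addIn (a * geo N)).
  rewrite -addnA -mulnDr [(p ^ N + _)%N]addnC -geoSr Dn addnAC DA.
  move: (a * geo N.+1)%N (p ^ _)%N => X Y.
  by rewrite -[in LHS](prednK (prime_gt0 pr_p)); ring.
have n0 : (0 < n)%N.
  rewrite /n !muln_gt0 a0 g1 -subn1 subn_gt0.
  have : (p ^ 0 < p ^ (2 * N.+1))%N by rewrite ltn_exp2l ?prime_gt1.
  by rewrite expn0.
have lt_ap' : (a < p)%N by apply: leq_trans lt_ap _; rewrite leq_pred.
have DA' : ((n.-1 %/ p).+1 = A')%N.
  have A0 : (0 < A')%N by rewrite -(ltn_pmul2l (prime_gt0 pr_p)) muln0 -n_a ltn_addr.
  apply: (ceil_div lt_ap' n0 n_a A0).
have T3 M : eqm M.+1 (3%:R ^+ (p ^ M)) (teichmuller pr_p 3%:R).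
  by apply: teich_approx; apply/(@Fp_natE p pr_p 3).
have E3 : eqm N.+1 (\prod_(j < n) three_part j * teichmuller pr_p 3%:R ^+ a) 1.
  have U : (3%:R ^+ A' : Zp) \is a GRing.unit.
    by rewrite unitrX // padic_nat_unit // gtnNdvd.
  suff : eqm N.+1
      (3%:R ^+ A' * (\prod_(j < n) three_part j * teichmuller pr_p 3%:R ^+ a))
      (3%:R ^+ A' * 1).
    by move/(eqmodM (eqmod_refl N.+1 (3%:R ^+ A')^-1)); rewrite !mulKr.
  have := prod_three_part n.-1; rewrite (prednK n0) DA' => PA'.
  rewrite mulrA [X in X * _]mulrC PA'.
  apply: (@eqmod_trans _ _ _ (3%:R ^+ n * (3%:R ^+ (p ^ N)) ^+ a)).
    by apply: eqmodM => //; apply/eqmodX/eqmod_sym/T3.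
  rewrite -exprM mulnC -exprD n_geo exprD; apply: eqmodM => //.
  rewrite exprM; apply: (@eqmod_trans _ _ _ (teichmuller pr_p 3%:R ^+ (p.-1 * (a * geo N.+1)))).
    apply: eqmodX; apply: eqmod_leq (T3 _); by rewrite ltnS leqW // mul2n -addnn leq_addr.
  rewrite exprM teich_exp ?expr1n //.
  apply/eqP => E0; have : eqm 1 3%:R ((0%R : 'F_p) : nat)%:R by apply/Fp_natE; rewrite E0.
  by move/eqmod_nat; rewrite expn1 mod0n modn_small.
have := gnat_triple m (isT : 0 < N.+1)%N Dc.
rewrite -Dm => T.
have := eqmodM (eqmodM (Gm 0%N) (Gm 1%N)) (Gm 2%N).
rewrite addr0 mul0n addn0 mul1n => E.
apply: (eqmod_trans (eqmod_cancel E E3 T)); rewrite -mulrA.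
apply: eqmodM => //; apply: eqmodM; first exact: eqmod_sym.
have := Gc 1%N isT; have := Gc 2%N isT; rewrite mul1n => G2 G1.
exact: eqmodM (eqmod_sym G1) (eqmod_sym G2).
Qed.

End PadicGamma.

(** * Formal power series *)

(** Series are coefficient functions. The ring laws are transported from polynomial
truncations, which have the same low coefficients. *)
Definition fps (R : Type) := nat -> R.

Section FpsRing.
Variable R : comNzRingType.
Implicit Types f g h : fps R.

Definition fps_const (c : R) : fps R := fun n => if n == 0%N then c else 0.
Definition fps_opp f : fps R := fun n => - f n.
Definition fps_add f g : fps R := fun n => f n + g n.
Definition fps_mul f g : fps R := fun n => \sum_(i < n.+1) f i * g (n - i)%N.

HB.instance Definition _ := gen_eqMixin (fps R).
HB.instance Definition _ := gen_choiceMixin (fps R).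

Lemma fpsP f g : (forall n, f n = g n) -> f = g.
Proof. exact: funext. Qed.

Fact fps_addA : associative fps_add.
Proof. by move=> f g h; apply: fpsP => n; rewrite /fps_add addrA. Qed.
Fact fps_addC : commutative fps_add.
Proof. by move=> f g; apply: fpsP => n; rewrite /fps_add addrC. Qed.
Fact fps_add0 : left_id (fps_const 0) fps_add.
Proof. by move=> f; apply: fpsP => n; rewrite /fps_add /fps_const; case: eqP; rewrite add0r. Qed.
Fact fps_addN : left_inverse (fps_const 0) fps_opp fps_add.
Proof. by move=> f; apply: fpsP => n; rewrite /fps_add /fps_opp /fps_const addNr; case: eqP. Qed.

HB.instance Definition _ :=
  GRing.isZmodule.Build (fps R) fps_addA fps_addC fps_add0 fps_addN.

Definition fps_trunc m f : {poly R} := \poly_(i < m) f i.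

Lemma fps_mul_poly f g m n : (n < m)%N ->
  fps_mul f g n = (fps_trunc m f * fps_trunc m g)`_n.
Proof.
move=> lt_nm; rewrite coefM; apply: eq_bigr => i _; rewrite !coef_poly.
rewrite (leq_ltn_trans _ lt_nm) ?(leq_ltn_trans _ lt_nm) ?leq_subr //.
by rewrite -ltnS ltn_ord.
Qed.

Fact fps_mulC : commutative fps_mul.
Proof. by move=> f g; apply: fpsP => n; rewrite !(fps_mul_poly _ _ (ltnSn n)) mulrC. Qed.

Fact fps_mulA : associative fps_mul.
Proof.
move=> f g h; apply: fpsP => n; pose T := fps_trunc n.+1.
transitivity (T f * (T g * T h))`_n.
  rewrite coefM; apply: eq_bigr => i _; rewrite coef_poly ltn_ord; congr (_ * _).
  by rewrite (@fps_mul_poly _ _ n.+1) // ltnS leq_subr.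
rewrite mulrA coefM; apply: eq_bigr => i _.
by rewrite coef_poly ltnS leq_subr (@fps_mul_poly _ _ n.+1).
Qed.

Fact fps_mul1 : left_id (fps_const 1) fps_mul.
Proof.
move=> f; apply: fpsP => n; rewrite /fps_mul big_ord_recl /= subn0 mul1r big1 ?addr0 // => i _.
by rewrite mul0r.
Qed.

Fact fps_mulDl : left_distributive fps_mul fps_add.
Proof.
move=> f g h; apply: fpsP => n; rewrite /fps_add /fps_mul -big_split /=.
by apply: eq_bigr => i _; rewrite mulrDl.
Qed.

Fact fps_one_neq0 : fps_const 1 != fps_const 0.
Proof. by apply/eqP => /(congr1 (fun f => f 0%N)) /eqP; rewrite oner_eq0. Qed.

HB.instance Definition _ := GRing.Zmodule_isComNzRing.Build (fps R)
  fps_mulA fps_mulC fps_mul1 fps_mulDl fps_one_neq0.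

Lemma fpsDE f g n : (f + g) n = f n + g n. Proof. by []. Qed.
Lemma fpsBE f g n : (f - g) n = f n - g n. Proof. by []. Qed.
Lemma fpsME f g n : (f * g) n = \sum_(i < n.+1) f i * g (n - i)%N. Proof. by []. Qed.
Lemma fps1E n : (1 : fps R) n = (n == 0%N)%:R.
Proof. by rewrite -[LHS]/(fps_const 1 n) /fps_const; case: eqP. Qed.
Lemma fps0E n : (0 : fps R) n = 0.
Proof. by rewrite -[LHS]/(fps_const 0 n) /fps_const; case: eqP. Qed.
Lemma fps_sumE (I : Type) (r : seq I) (P : pred I) (F : I -> fps R) n :
  (\sum_(i <- r | P i) F i) n = \sum_(i <- r | P i) F i n.
Proof. by elim/big_rec2: _ => [|i x y _ <-]; rewrite ?fps0E. Qed.
Lemma fpsMnE f m n : (f *+ m) n = f n *+ m.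
Proof. by elim: m => [|m IHm]; rewrite ?mulr0n ?fps0E // !mulrS fpsDE IHm. Qed.
Lemma fps_natM (m : nat) f n : (m%:R * f) n = m%:R * f n.
Proof. by rewrite !mulr_natl fpsMnE. Qed.

Lemma fpsM0 f g : (f * g) 0%N = f 0%N * g 0%N.
Proof. by rewrite fpsME big_ord1. Qed.

Lemma fpsX0 f m : (f ^+ m) 0%N = f 0%N ^+ m.
Proof. by elim: m => [|m IHm]; rewrite ?expr0 ?fps1E // !exprS fpsM0 IHm. Qed.

(** The series [f (X^k)]. *)
Definition dil k f : fps R := fun n => if (k %| n)%N then f (n %/ k)%N else 0.

Lemma dilM k f g : (0 < k)%N -> dil k (f * g) = dil k f * dil k g.
Proof.
move=> k0; apply: fpsP => n; pose T := fps_trunc n.+1.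
have dilE h i : (i <= n)%N -> dil k h i = (T h \Po 'X^k)`_i.
  move=> le_in; rewrite coef_comp_poly_Xn // /dil; case: ifP => // _.
  by rewrite coef_poly ltnS (leq_trans (leq_div _ _)).
rewrite fpsME; transitivity (((T f * T g) \Po 'X^k)`_n).
  rewrite coef_comp_poly_Xn // /dil; case: ifP => // _.
  by apply: fps_mul_poly; rewrite ltnS leq_div.
rewrite comp_polyM coefM; apply: eq_bigr => i _.
by rewrite !dilE ?leq_subr // -ltnS.
Qed.

Lemma dil1 k : (0 < k)%N -> dil k 1 = 1.
Proof.
move=> k0; apply: fpsP => n; rewrite /dil !fps1E; case: ifP => [/dvdnP[m ->]|ndvd].
  by rewrite mulnK // muln_eq0 [k == _]eqn0Ngt k0 orbF.
by case: n ndvd => // ; rewrite dvdn0.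
Qed.

Lemma dilX k f m : (0 < k)%N -> dil k (f ^+ m) = dil k f ^+ m.
Proof. by move=> k0; elim: m => [|m IHm]; rewrite ?dil1 // !exprS dilM // IHm. Qed.

Lemma dil_dil k l f : (0 < k)%N -> (0 < l)%N -> dil k (dil l f) = dil (k * l)%N f.
Proof.
move=> k0 l0; apply: fpsP => n; rewrite /dil.
case: ifPn => [/dvdnP[m ->]|ndvd].
  by rewrite mulnK // [(m * k)%N]mulnC dvdn_pmul2l // divnMl.
by rewrite ifN //; apply: contra ndvd; apply: dvdn_trans (dvdn_mulr _ _).
Qed.

(** The series [f (c X)]. *)
Definition scl (c : R) f : fps R := fun n => c ^+ n * f n.

Lemma sclM c f g : scl c (f * g) = scl c f * scl c g.
Proof.
apply: fpsP => n; rewrite /scl !fpsME mulr_sumr; apply: eq_bigr => i _.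
have le_in : (i <= n)%N by rewrite -ltnS.
by rewrite -{1}(subnKC le_in) exprD; ring.
Qed.

Lemma scl_dil k c f : (0 < k)%N -> scl c (dil k f) = dil k (scl (c ^+ k) f).
Proof.
move=> k0; apply: fpsP => n; rewrite /scl /dil.
case: ifP => [/dvdnP[m ->]|_]; last by rewrite mulr0.
by rewrite mulnK // mulnC exprM.
Qed.

(** The derivation [X d/dX]. *)
Definition euler f : fps R := fun n => n%:R * f n.

Lemma eulerM f g : euler (f * g) = euler f * g + f * euler g.
Proof.
apply: fpsP => n; rewrite /euler fpsDE !fpsME mulr_sumr -big_split /=.
apply: eq_bigr => i _; have le_in : (i <= n)%N by rewrite -ltnS.
by rewrite -{1}(subnKC le_in) natrD; ring.
Qed.

Definition fps_mon k (c : R) : fps R := fun n => if n == k then c else 0.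

Lemma fps_monM k c f n :
  (fps_mon k c * f) n = if (k <= n)%N then c * f (n - k)%N else 0.
Proof.
rewrite fpsME /fps_mon; case: leqP => [le_kn|lt_nk].
  rewrite (bigD1 (Ordinal (le_kn : k < n.+1)%N)) //= eqxx big1 ?addr0 // => i.
  by rewrite -val_eqE /= => /negbTE ->; rewrite mul0r.
rewrite big1 // => i _; rewrite ifN ?mul0r // neq_ltn (leq_trans _ lt_nk) //.
Qed.

Lemma fps_monX k c m : fps_mon k c ^+ m = fps_mon (m * k)%N (c ^+ m).
Proof.
elim: m => [|m IHm]; first by apply: fpsP => n; rewrite !expr0 fps1E /fps_mon mul0n; case: eqP.
rewrite exprS IHm; apply: fpsP => n; rewrite fps_monM /fps_mon mulSn exprS.
case: leqP => [le_kn|lt_nk]; last by rewrite ifN // neq_ltn (leq_trans lt_nk) ?leq_addr.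
by rewrite -(eqn_add2l k) subnKC //; case: eqP => _; rewrite ?mulr0.
Qed.

(** Changing the [n]-th coefficient of a series with constant term 1 by [d] changes that of
its [m]-th power by [m d]: this is how Dwork's congruence determines a coefficient
from the earlier ones. *)
Lemma fpsX_agree f g n m : (0 < n)%N -> f 0%N = 1 -> g 0%N = 1 ->
  (forall i, (i < n)%N -> f i = g i) ->
  (f ^+ m) n - (g ^+ m) n = m%:R * (f n - g n)
  /\ forall i, (i < n)%N -> (f ^+ m) i = (g ^+ m) i.
Proof.
move=> n0 f0 g0 fg; elim: m => [|m [IHn IHi]]; first by rewrite !expr0 subrr mul0r.
split; last first.
  move=> i lt_in; rewrite !exprS !fpsME; apply: eq_bigr => j _.
  rewrite fg ?IHi ?(leq_ltn_trans (leq_subr _ _) lt_in) //.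
  by rewrite (leq_ltn_trans _ lt_in) // -ltnS.
rewrite !exprS !fpsME; case: n n0 fg IHn IHi => // n _ fg IHn IHi.
rewrite big_ord_recl big_ord_recr [X in _ - X]big_ord_recl [X in _ - (_ + X)]big_ord_recr.
rewrite /= !subn0 /bump /= !add1n !subnn !fpsX0 f0 g0 !expr1n.
rewrite [X in 1 * _ + (X + _)](eq_bigr (fun i : 'I_n => g (1 + i)%N * (g ^+ m) (n.+1 - (1 + i))%N)).
  by rewrite -[m.+1]add1n natrD mulrDl -IHn; ring.
move=> i _; rewrite add1n fg ?ltnS ?ltn_ord // IHi //.
by rewrite subSS ltnS leq_subr.
Qed.

End FpsRing.

(** * The Dwork exponential and the size of its coefficients *)

Section Exponential.
Variable F : fieldType.
Hypothesis char0 : forall n, (n.+1)%:R != 0 :> F.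
Implicit Types c d : F.

Lemma natF_neq0 n : (0 < n)%N -> n%:R != 0 :> F.
Proof. by case: n => // n _; apply: char0. Qed.

Lemma fact_neq0F n : n`!%:R != 0 :> F.
Proof. exact/natF_neq0/fact_gt0. Qed.

Definition expf c : fps F := fun n => c ^+ n / n`!%:R.

Lemma expfD c d : expf (c + d) = expf c * expf d.
Proof.
apply: fpsP => n; rewrite fpsME /expf addrC exprDn mulr_suml; apply: eq_bigr => i _.
have le_in : (i <= n)%N by rewrite -ltnS.
have := congr1 (fun m => m%:R : F) (bin_fact le_in).
rewrite !natrM => <-; rewrite -mulr_natr.
have C0 : 'C(n, i)%:R != 0 :> F by rewrite natF_neq0 ?bin_gt0.
by field; rewrite C0 !fact_neq0F.
Qed.

Lemma expf0 : expf 0 = 1.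
Proof.
apply: fpsP => n; rewrite fps1E /expf; case: n => [|n]; first by rewrite expr0 divr1.
by rewrite expr0n mul0r.
Qed.

Lemma expfX c n : expf c ^+ n = expf (n%:R * c).
Proof.
elim: n => [|n IHn]; first by rewrite mul0r expf0.
by rewrite exprS IHn -expfD -natr1; congr expf; ring.
Qed.

Lemma scl_expf c d : scl c (expf d) = expf (c * d).
Proof. by apply: fpsP => n; rewrite /scl /expf exprMn mulrA. Qed.

Lemma euler_expf c n : euler (expf c) n.+1 = c * expf c n.
Proof.
rewrite /euler /expf factS natrM exprS.
by field; rewrite fact_neq0F -(natrD _ 1 n) char0.
Qed.

End Exponential.

Section DworkExponential.
Variable F : fieldType.
Hypothesis char0 : forall n, (n.+1)%:R != 0 :> F.
Variables (p : nat) (pr_p : prime p) (p_gt3 : (3 < p)%N).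
Local Notation expf := (@expf F).

(** [exp (X + X^p / p)], written as a product so that it needs only exponentials of
monomials. *)
Definition dwork : fps F := expf 1 * dil p (expf p%:R^-1).

Let p_gt0 : (0 < p)%N. Proof. exact: prime_gt0. Qed.
Let p_neq0 : p%:R != 0 :> F. Proof. exact: natF_neq0. Qed.

Lemma dwork0 : dwork 0%N = 1.
Proof. by rewrite /dwork fpsM0 /dil dvdn0 div0n /expf !expr0 divr1 mulr1. Qed.

(** The differential equation [X f' = (X + X^p) f]. *)
Lemma dwork_rec n : n.+1%:R * dwork n.+1 =
  dwork n + (if (p <= n.+1)%N then dwork (n.+1 - p)%N else 0).
Proof.
rewrite -[LHS]/(euler dwork n.+1) /dwork eulerM fpsDE; congr (_ + _).
  rewrite fpsME big_ord_recl {1}/euler mul0r mul0r add0r fpsME.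
  apply: eq_bigr => i _; rewrite /= /bump /= add1n subSS; congr (_ * _).
  by rewrite euler_expf // mul1r.
have -> : euler (dil p (expf p%:R^-1)) = fps_mon p 1 * dil p (expf p%:R^-1).
  apply: fpsP => m; rewrite fps_monM mul1r /euler /dil.
  case: leqP => [le_pm|lt_mp]; last first.
    case: m lt_mp => [|m] lt_mp; first by rewrite mul0r.
    by rewrite gtnNdvd // mulr0.
  rewrite dvdn_subl //; case: ifP => [/dvdnP[k Dm]|_]; last by rewrite mulr0.
  case: k Dm le_pm => [->|k -> _]; first by rewrite mul0n leqNgt p_gt0.
  rewrite mulnK // mulSn addKn mulnK // natrD natrM.
  have := @euler_expf F char0 p%:R^-1 k; rewrite /euler => E.
  have -> : p%:R + k%:R * p%:R = p%:R * k.+1%:R :> F by rewrite -natr1; ring.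
  by rewrite -mulrA E mulVKf.
rewrite mulrCA fps_monM mul1r //.
Qed.

(** Dwork's criterion compares [f^p] with [f (X^p)]: for [f = exp (X + X^p / p)] the
quotient is [exp (- p X) exp (X^(p^2) / p)], which is 1 modulo [p] in the ring of
series [wint] below. *)
Lemma dwork_frobenius :
  dwork ^+ p * (expf (- p%:R) * dil (p * p)%N (expf p%:R^-1)) = dil p dwork.
Proof.
rewrite /dwork exprMn mulrACA -dilX // !expfX // mulr1 -expfD // subrr expf0 //.
by rewrite mul1r mulfV // dilM // dil_dil.
Qed.

Lemma dwork_exp : dwork * dil p (expf (- p%:R^-1)) = expf 1.
Proof. by rewrite /dwork -mulrA -dilM // -expfD // subrr expf0 // dil1 // mulr1. Qed.

(** The exponent of [p] allowed in the denominator of the [n]-th coefficient. It is chosen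
to be superadditive, so that the series obeying the bound form a ring; to satisfy
[dwt_mul], so that the bound survives Dwork's induction; and to satisfy [dwt_pp], so
that [exp (X^(p^2) / p)] obeys it. It is still small enough for the sums
[dwork n * pi^n] to converge when [pi^(p-1) = - p]. *)
Definition dwt n := ((n - 3) %/ (2 * p))%N.

Lemma dwtD m n : (dwt m + dwt n <= dwt (m + n))%N.
Proof.
have d0 : (0 < 2 * p)%N by rewrite muln_gt0.
rewrite /dwt leq_divRL // mulnDl (leq_trans (leq_add (leq_divM _ _) (leq_divM _ _))) //.
lia.
Qed.

Lemma dwt_mul n : (0 < dwt n)%N -> (p * dwt n < dwt (p * n))%N.
Proof.
have d0 : (0 < 2 * p)%N by rewrite muln_gt0.
rewrite /dwt divn_gt0 // => h; rewrite leq_divRL // mulSn.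
have /(leq_mul (leqnn p)) := leq_divM (n - 3) (2 * p).
rewrite mulnA => h2.
have h3 : (2 * p + p * (n - 3) <= p * n - 3)%N by nia.
exact: leq_trans (leq_add (leqnn _) h2) h3.
Qed.

Lemma dwt_pp n : (0 < n)%N -> (2 * n <= dwt (n * (p * p)))%N.
Proof.
move=> n0; have d0 : (0 < 2 * p)%N by rewrite muln_gt0.
have p5 : (5 <= p)%N by move: pr_p p_gt3; case: p => [|[|[|[|[|m]]]]].
by rewrite /dwt leq_divRL //; nia.
Qed.

(* A is a model of the p-adic integers inside their fraction field F. *)
Variable A : subringClosed F.
Hypothesis A_unit : forall m : nat, ~~ (p %| m)%N -> m%:R^-1 \in A.
Hypothesis A_fermat : forall x, x \in A -> (x ^+ p - x) / p%:R \in A.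

Lemma p_logn_fact n : p%:R ^+ (logn p n`!) / n`!%:R \in A.
Proof.
have [m pNm Dn] := pfactor_coprime pr_p (fact_gt0 n).
rewrite {2}Dn natrM natrX invfM mulrA mulrAC divff ?expf_neq0 // mul1r.
by apply: A_unit; rewrite -prime_coprime.
Qed.

(** Legendre's formula and [n / p + n / p^2 + ... <= n / (p - 1)]. *)
Lemma logn_fact_half n : (2 * logn p n`! <= n)%N.
Proof.
rewrite logn_fact //.
suff H M : (2 * (\sum_(1 <= k < M.+1) n %/ p ^ k) + n %/ p ^ M <= n)%N.
  exact: leq_trans (leq_addr _ _) (H n).
elim: M => [|M IHM]; first by rewrite big_geq // expn0 divn1.
rewrite big_nat_recr //= expnSr divnMA mulnDr -addnA.
apply: leq_trans IHM; rewrite leq_add2l.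
apply: leq_trans (leq_divM (n %/ p ^ M) p).
rewrite -mulSnr [leqRHS]mulnC leq_mul2r; apply/orP; right; exact: ltnW.
Qed.

Lemma logn_fact_lt n : (0 < n)%N -> (logn p n`! < n)%N.
Proof. by move=> n0; have := logn_fact_half n; lia. Qed.

Lemma p_in : p%:R \in A. Proof. exact: rpred_nat. Qed.

Lemma p_fact_in m n : (logn p n`! <= m)%N -> p%:R ^+ m / n`!%:R \in A.
Proof.
move=> le_m; rewrite -(subnKC le_m) exprD mulrAC rpredM ?p_logn_fact //.
by rewrite rpredX ?p_in.
Qed.

Definition wint : {pred fps F} := fun f => `[< forall n, p%:R ^+ dwt n * f n \in A >].

Lemma wintP f : reflect (forall n, p%:R ^+ dwt n * f n \in A) (f \in wint).
Proof. exact: asboolP. Qed.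

Lemma wint_mon k c : p%:R ^+ dwt k * c \in A -> fps_mon k c \in wint.
Proof.
move=> Ac; apply/wintP => n; rewrite /fps_mon; case: eqP => [->//|_].
by rewrite mulr0 rpred0.
Qed.

Fact wint_subring : subring_closed wint.
Proof.
split=> [|f g /wintP Wf /wintP Wg|f g /wintP Wf /wintP Wg]; apply/wintP => n.
- by rewrite fps1E rpredM ?rpredX ?rpred_nat.
- by rewrite fpsBE mulrBr rpredB.
rewrite fpsME mulr_sumr rpred_sum // => i _.
have le_in : (i <= n)%N by rewrite -ltnS.
have := dwtD i (n - i); rewrite subnKC // => le_w.
have split5 (a b c u v : F) : a * b * c * (u * v) = a * u * (b * v) * c by ring.
rewrite -(subnKC le_w) !exprD split5.
apply: rpredM; last by rewrite rpredX ?p_in.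
exact: rpredM (Wf _) (Wg _).
Qed.
HB.instance Definition _ := GRing.isSubringClosed.Build (fps F) wint wint_subring.

Lemma wint_frobD f g : f \in wint -> g \in wint ->
  exists2 h, h \in wint & (f + g) ^+ p = f ^+ p + g ^+ p + p%:R * h.
Proof.
move=> Wf Wg; exists (\sum_(1 <= i < p) (f ^+ (p - i) * g ^+ i) *+ ('C(p, i) %/ p)).
  by apply: rpred_sum => i _; rewrite rpredMn // rpredM ?rpredX.
rewrite exprDn -(big_mkord xpredT (fun i => f ^+ (p - i) * g ^+ i *+ 'C(p, i))).
rewrite big_nat_recr //= big_ltn // subn0 bin0 expr0 mulr1 mulr1n subnn binn expr0 mul1r mulr1n.
rewrite addrAC; congr (_ + _); rewrite mulr_sumr !big_nat; apply: eq_bigr => i /andP[i0 ltip].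
by rewrite mulr_natl -mulrnA divnK // prime_dvd_bin // i0.
Qed.

Lemma wint_frob f m : f \in wint -> exists2 h, h \in wint &
  (\sum_(i < m) fps_mon i (f i)) ^+ p =
  \sum_(i < m) fps_mon (p * i)%N (f i ^+ p) + p%:R * h.
Proof.
move=> /wintP Wf; have Wm k : fps_mon k (f k) \in wint by apply: wint_mon.
elim: m => [|m [h Wh IHm]].
  exists 0; rewrite ?rpred0 // !big_ord0 expr0n mulr0 addr0.
  by rewrite gtn_eqF.
have Ws : \sum_(i < m) fps_mon i (f i) \in wint by apply: rpred_sum => i _.
have [h' Wh' E] := wint_frobD Ws (Wm m).
exists (h + h'); first exact: rpredD.
by rewrite !big_ord_recr /= E IHm fps_monX; ring.
Qed.

Lemma dwork_cofactor : exists2 h, h \in wint &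
  expf (- p%:R) * dil (p * p)%N (expf p%:R^-1) = 1 + p%:R * h.
Proof.
have [h1 W1 ->] : exists2 h, h \in wint & expf (- p%:R) = 1 + p%:R * h.
  exists (fun n => if n == 0%N then 0 else p%:R^-1 * expf (- p%:R) n).
    apply/wintP => n; case: eqP => [_|/eqP]; first by rewrite mulr0 rpred0.
    rewrite -lt0n => n0; rewrite rpredM ?rpredX ?p_in //.
    rewrite /expf exprNn -{2}(prednK n0) exprS.
    rewrite (_ : _ * _ = (-1) ^+ n * (p%:R ^+ n.-1 / n`!%:R)); last first.
      by field; rewrite fact_neq0F // p_neq0.
    rewrite rpredM ?rpredX ?rpredN1 // p_fact_in // -ltnS prednK //.
    exact: logn_fact_lt.
  apply: fpsP => n; rewrite fpsDE fps_natM fps1E; case: eqP => [->|_].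
    by rewrite mulr0 addr0 /expf expr0 divr1.
  by rewrite add0r mulVKf.
have [h2 W2 ->] : exists2 h, h \in wint & dil (p * p)%N (expf p%:R^-1) = 1 + p%:R * h.
  exists (fun n => if n == 0%N then 0 else p%:R^-1 * dil (p * p)%N (expf p%:R^-1) n).
    apply/wintP => n; case: eqP => [_|/eqP]; first by rewrite mulr0 rpred0.
    rewrite /dil; case: ifP => [/dvdnP[m ->]|_]; last by rewrite !mulr0 rpred0.
    rewrite muln_eq0 negb_or -lt0n => /andP[m0 _].
    rewrite mulnK ?muln_gt0 ?p_gt0 // /expf.
    rewrite -(subnKC (dwt_pp m0)) exprD mul2n -addnn exprD exprVn.
    rewrite [X in X \in A](_ : _ = p%:R ^+ m.-1 / m`!%:R * p%:R ^+ (dwt (m * (p * p)) - (m + m))).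
      apply: rpredM; last by rewrite rpredX ?p_in.
      by apply: p_fact_in; rewrite -ltnS prednK // logn_fact_lt.
    have -> : p%:R ^+ m = p%:R * p%:R ^+ m.-1 :> F by rewrite -exprS prednK.
    move: (p%:R ^+ (_ - _)) => u; field.
    by rewrite fact_neq0F // expf_neq0 p_neq0.
  apply: fpsP => n; rewrite fpsDE fps_natM fps1E; case: eqP => [->|_].
    by rewrite mulr0 addr0 /dil dvdn0 div0n /expf expr0 divr1.
  by rewrite add0r mulVKf.
exists (h1 + h2 + p%:R * h1 * h2); last by ring.
by rewrite !(rpredD, rpredM) ?rpred_nat.
Qed.

(** Dwork's lemma with weights. In degree [n], [dwork_frobenius] expresses [p * dwork n]
through the truncation [g] of [dwork] below [n]. Modulo [p] the power [g^p] has the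
coefficients [dwork k ^ p] in degrees [p k], and the difference with [f (X^p)] is
controlled by Fermat's congruence when [dwt k = 0], and by the slack in [dwt_mul]
otherwise. *)
Lemma dwork_wint : dwork \in wint.
Proof.
apply/wintP => n; elim/ltn_ind: n => n IHn.
have [->|] := posnP n; first by rewrite dwork0 mulr1 rpredX ?p_in.
move=> n0; pose g : fps F := \sum_(i < n) fps_mon i (dwork i).
have gE i : g i = if (i < n)%N then dwork i else 0.
  rewrite /g fps_sumE; case: ltnP => [lt_in|le_ni].
    rewrite (bigD1 (Ordinal lt_in)) //= /fps_mon eqxx big1 ?addr0 // => j.
    by rewrite -val_eqE /= eq_sym => /negbTE ->.
  rewrite big1 // => j _; rewrite /fps_mon gtn_eqF //.
  by apply: leq_trans le_ni.
have Wg : g \in wint.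
  apply/wintP => i; rewrite gE; case: ifP => [/IHn//|_]; by rewrite mulr0 rpred0.
have [h Wh Dh] := dwork_cofactor.
have [z Wz Dz] := wint_frob n Wg.
have {}Dz : g ^+ p = \sum_(i < n) fps_mon (p * i)%N (g i ^+ p) + p%:R * z.
  by rewrite -Dz; congr (_ ^+ p); apply: eq_bigr => i _; rewrite gE ltn_ord.
have h0 : h 0%N = 0.
  have := congr1 (fun f : fps F => f 0%N) Dh.
  rewrite fpsM0 /dil dvdn0 div0n /expf !expr0 divr1 mulr1 fpsDE fps1E fps_natM.
  by move/eqP; rewrite -subr_eq0 opprD addrA subrr sub0r oppr_eq0 mulf_eq0 (negbTE p_neq0) => /eqP.
have fg i : (i < n)%N -> dwork i = g i by move=> lt_in; rewrite gE lt_in.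
have g0 : g 0%N = 1 by rewrite -fg // dwork0.
have [Ep Elt] := fpsX_agree p n0 dwork0 g0 fg.
have gn : g n = 0 by rewrite gE ltnn.
have Emul : (dwork ^+ p * h) n = (g ^+ p * h) n.
  rewrite !fpsME !big_ord_recr /= subnn h0 !mulr0; congr (_ + _).
  by apply: eq_bigr => i _; rewrite Elt.
have Dn : p%:R * dwork n = dil p dwork n - (g ^+ p) n - p%:R * (g ^+ p * h) n.
  rewrite -dwork_frobenius Dh mulrDr mulr1 mulrCA fpsDE fps_natM Emul.
  by rewrite gn subr0 in Ep; rewrite -Ep; ring.
(* fr is what remains of g ^+ p modulo p; unlike dil p dwork it carries the p-th powers
   of the coefficients. *)
pose fr := dil p (fun i => dwork i ^+ p) : fps F.
have Dfr : (\sum_(i < n) fps_mon (p * i)%N (g i ^+ p)) n = fr n.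
  rewrite fps_sumE /fr /dil; case: ifP => [/dvdnP[k Dk]|ndvd]; last first.
    rewrite big1 // => i _; rewrite /fps_mon ifN //.
    by apply: contraFneq ndvd => ->; rewrite dvdn_mulr.
  have lt_kn : (k < n)%N.
    rewrite Dk ltn_Pmulr ?prime_gt1 //.
    by rewrite lt0n; apply: contraTneq n0 => k0; rewrite Dk k0.
  rewrite (bigD1 (Ordinal lt_kn)) //= /fps_mon [(p * k)%N]mulnC -Dk eqxx gE lt_kn.
  rewrite [in RHS]Dk mulnK // big1 ?addr0 // => i.
  rewrite -val_eqE /= => ne_ik; rewrite ifN //; apply: contra ne_ik => /eqP E.
  by rewrite -(eqn_pmul2l p_gt0) -E {1}Dk mulnC.
have -> : dwork n = (dil p dwork n - fr n) / p%:R - z n - (g ^+ p * h) n.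
  apply: (mulfI p_neq0); rewrite Dn Dz fpsDE fps_natM Dfr.
  by field.
have Wgh : g ^+ p * h \in wint by rewrite rpredM ?rpredX.
rewrite !mulrBr !rpredB //; last 2 first.
- exact: (elimT (wintP _) Wz n).
- exact: (elimT (wintP _) Wgh n).
rewrite /fr /dil; case: ifP => [/dvdnP[k Dk]|_]; last by rewrite subr0 mul0r mulr0 rpred0.
rewrite Dk mulnK //.
have lt_kn : (k < n)%N.
  rewrite Dk ltn_Pmulr ?prime_gt1 //.
  by rewrite lt0n; apply: contraTneq n0 => k0; rewrite Dk k0.
have := IHn k lt_kn; have [w0|w_gt0] := posnP (dwt k).
  rewrite w0 expr0 mul1r => Ak; rewrite rpredM ?rpredX ?p_in //.
  by rewrite -opprB mulNr rpredN A_fermat.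
move=> Ak; have := dwt_mul w_gt0; rewrite [(p * k)%N]mulnC => le_w.
have w1 : (0 < dwt (k * p))%N by apply: leq_trans le_w.
rewrite mulrA -{1}(prednK w1) exprSr mulrAC mulfK // mulrBr rpredB //.
  have le_w' : (dwt k <= (dwt (k * p)).-1)%N.
    rewrite -ltnS prednK //; apply: leq_trans le_w.
    by rewrite ltnS leq_pmull.
  by rewrite -(subnKC le_w') exprD mulrAC rpredM ?rpredX ?p_in.
have le_w' : (p * dwt k <= (dwt (k * p)).-1)%N by rewrite -ltnS prednK.
rewrite -(subnKC le_w') exprD mulrAC mulnC exprM -exprMn.
by rewrite rpredM ?rpredX ?p_in.
Qed.

End DworkExponential.

(** * The trace of Frobenius, truncated *)

Section Levels.
Variable F : fieldType.
Hypothesis char0 : forall n, (n.+1)%:R != 0 :> F.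
Variables (p : nat) (pr_p : prime p) (p_gt3 : (3 < p)%N).
Local Notation b := (dwork F p).

Variable A : subringClosed F.
Hypothesis A_unit : forall m : nat, ~~ (p %| m)%N -> m%:R^-1 \in A.
Hypothesis A_fermat : forall x, x \in A -> (x ^+ p - x) / p%:R \in A.

(** Divisibility by [p^N] in [A]. *)
Definition lev N (x : F) := x / p%:R ^+ N \in A.

Let p_neq0 : p%:R != 0 :> F. Proof. by apply: natF_neq0 => //; apply: prime_gt0. Qed.

Lemma lev0 N : lev N 0. Proof. by rewrite /lev mul0r rpred0. Qed.
Lemma levD N x y : lev N x -> lev N y -> lev N (x + y).
Proof. by rewrite /lev mulrDl; apply: rpredD. Qed.
Lemma levN N x : lev N x -> lev N (- x).
Proof. by rewrite /lev mulNr rpredN. Qed.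
Lemma levB N x y : lev N x -> lev N y -> lev N (x - y).
Proof. by move=> Lx Ly; apply: levD => //; apply: levN. Qed.
Lemma levM M N x y : lev M x -> lev N y -> lev (M + N) (x * y).
Proof. by rewrite /lev exprD invfM mulrACA; apply: rpredM. Qed.
Lemma lev_in x : lev 0 x = (x \in A).
Proof. by rewrite /lev expr0 divr1. Qed.
Lemma levMl N x y : x \in A -> lev N y -> lev N (x * y).
Proof. by rewrite -lev_in => Lx /(levM Lx). Qed.
Lemma lev_sum N (I : Type) (r : seq I) (P : pred I) (f : I -> F) :
  (forall i, P i -> lev N (f i)) -> lev N (\sum_(i <- r | P i) f i).
Proof. by move=> H; rewrite /lev mulr_suml; apply: rpred_sum. Qed.
Lemma lev_leq M N x : (M <= N)%N -> lev N x -> lev M x.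
Proof.
rewrite /lev => le_MN; have -> : p%:R ^+ N = p%:R ^+ (N - M) * p%:R ^+ M :> F.
  by rewrite -exprD subnK.
have u0 : p%:R ^+ (N - M) != 0 :> F by rewrite expf_neq0.
have v0 : p%:R ^+ M != 0 :> F by rewrite expf_neq0.
move=> Lx; rewrite (_ : x / _ = x / (p%:R ^+ (N - M) * p%:R ^+ M) * p%:R ^+ (N - M)).
  by rewrite rpredM ?rpredX ?rpred_nat.
by field; rewrite u0 v0.
Qed.
Lemma lev_p N : lev N (p%:R ^+ N).
Proof. by rewrite /lev divff ?expf_neq0 // rpred1. Qed.

Lemma lev_prodB N (I : Type) (r : seq I) (f g : I -> F) :
  (forall i, f i \in A) -> (forall i, g i \in A) -> (forall i, lev N (f i - g i)) ->
  lev N (\prod_(i <- r) f i - \prod_(i <- r) g i).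
Proof.
move=> Af Ag Lfg; elim: r => [|i r IHr]; first by rewrite !big_nil subrr lev0.
rewrite !big_cons (_ : _ - _ = f i * (\prod_(j <- r) f j - \prod_(j <- r) g j) +
  (\prod_(j <- r) g j) * (f i - g i)); last by ring.
by apply: levD; apply: levMl => //; apply: rpred_prod.
Qed.

(** The denominator [p^(dwt n)] uses up at most half of the [m] factors [p], rounded up. *)
Lemma dwork_lev m n : (n <= p + p * m)%N -> lev (m./2) ((- p%:R) ^+ m * b n).
Proof.
move=> le_n; have p_gt0 := prime_gt0 pr_p.
have le_w : (m./2 + dwt p n <= m)%N.
  suff : (dwt p n <= uphalf m)%N.
    have Em : (m = m./2 + uphalf m)%N.
      by rewrite uphalf_half addnCA addnn odd_double_half.
    by move=> h; apply: (@leq_trans (m./2 + uphalf m)); [rewrite leq_add2l | rewrite -Em].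
  rewrite /dwt -ltnS ltn_divLR ?muln_gt0 //.
  have hm : (m <= 2 * uphalf m)%N.
    rewrite mul2n uphalf_half doubleD -{1}(odd_double_half m) leq_add2r.
    by case: odd.
  by move: (uphalf m) hm => u hm; nia.
have Em : (- p%:R) ^+ m = (-1) ^+ m * (p%:R ^+ (m - (m./2 + dwt p n)) *
   (p%:R ^+ m./2 * p%:R ^+ dwt p n)) :> F.
  by rewrite [LHS]exprNn; congr (_ * _); rewrite -!exprD subnK.
have v0 : p%:R ^+ m./2 != 0 :> F by rewrite expf_neq0.
rewrite /lev Em (_ : _ / _ = (-1) ^+ m * p%:R ^+ (m - (m./2 + dwt p n)) *
   (p%:R ^+ dwt p n * b n)); last by field.
apply: rpredM; first by rewrite rpredM ?rpredX ?rpredN1 ?rpred_nat.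
exact: (elimT (wintP _ _ _) (dwork_wint char0 pr_p p_gt3 A_unit A_fermat)).
Qed.

End Levels.

(** The trace of the Dwork operator on the span of the [X^(n + s)], with
[s = a / (p - 1)], is a gamma value up to the factor [1 - p]. The proof is a finite
computation: an exact identity for the partial sums of the trace, [frob_trace], in which
the error terms tend to 0. *)
Section TraceFormula.
Variable F : fieldType.
Hypothesis char0 : forall n, (n.+1)%:R != 0 :> F.
Variables (p : nat) (pr_p : prime p) (p_gt3 : (3 < p)%N).
Local Notation b := (dwork F p).
Variable (a : nat).
Hypothesis lt_ap : (a < p.-1)%N.
Let s : F := a%:R / p.-1%:R.
Let z : F := - s.

Let p1_neq0 : p.-1%:R != 0 :> F.
Proof. by apply: natF_neq0 => //; apply: leq_trans lt_ap. Qed.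

(** The coefficient of [X^(p (m + s))] in [X^(n + s)] times the Dwork exponential. The power
of [- p] is, up to conjugation, the effect of replacing [X] by [pi X] in the exponential,
with [pi^(p-1) = - p]. *)
Definition frob_mx m n : F := (- p%:R) ^+ m * b (a + p * m - n)%N.

(** [(x - m) (x - m - 1) ... (x - n + 1)], so that [falling x 0] are the Newton polynomials. *)
Definition falling (x : F) m n := \prod_(m <= l < n) (x - l%:R).

(** The recurrence of [dwork]: up to a factor [p], the matrix intertwines the first-order
operator with eigenvalues [s + k] plus a shift with itself. *)
Lemma frob_mx_comm m k : (k <= m)%N ->
  (s + k%:R) * frob_mx m.+1 k + frob_mx m.+1 k.+1 =
  p%:R * ((s + m.+1%:R) * frob_mx m.+1 k + frob_mx m k).
Proof.
move=> le_km; have p_gt0 := prime_gt0 pr_p.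
have le_pm : (m <= p * m)%N by rewrite leq_pmull.
have Dn : (a + p * m.+1 - k = (a + p * m.+1 - k.+1).+1)%N by rewrite mulnS; lia.
have := dwork_rec char0 pr_p (a + p * m.+1 - k.+1); rewrite -Dn.
have -> : (p <= a + p * m.+1 - k)%N by rewrite mulnS; lia.
have -> : (a + p * m.+1 - k - p = a + p * m - k)%N by rewrite mulnS; lia.
have -> : (a + p * m.+1 - k)%:R = a%:R + p%:R * m.+1%:R - k%:R :> F.
  by rewrite natrB ?natrD ?natrM // mulnS; lia.
rewrite /frob_mx exprS => rec.
have Ds : a%:R = s * p.-1%:R by rewrite /s divfK.
have Dp : p%:R = p.-1%:R + 1 :> F by rewrite natr1 prednK.
move: rec; rewrite Ds.
move: (b (a + p * m.+1 - k)%N) (b (a + p * m.+1 - k.+1)%N) (b (a + p * m - k)%N) => b0 b1 b2 rec.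
apply/eqP; rewrite -subr_eq0; apply/eqP.
transitivity (- p%:R * (- p%:R) ^+ m * (b1 + b2 - (s * p.-1%:R + p%:R * m.+1%:R - k%:R) * b0)).
  by rewrite Dp; ring.
by rewrite rec subrr mulr0.
Qed.

(** The error term of the telescoping. It only involves row [m], hence tends to 0. *)
Definition frob_defect m : F :=
  (s + m%:R) * \sum_(k < m) frob_mx m k * falling z k.+1 m.

Lemma falling_recl k m : (k < m)%N -> falling z k m = (z - k%:R) * falling z k.+1 m.
Proof. by move=> lt_km; rewrite /falling big_ltn. Qed.

Lemma falling_recr k m : (k <= m)%N -> falling z k m.+1 = falling z k m * (z - m%:R).
Proof. by move=> le_km; rewrite /falling big_nat_recr. Qed.

Lemma falling_id m : falling z m m = 1.
Proof. by rewrite /falling big_geq. Qed.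

(** Moving along row [m + 1] from column 0 to the diagonal with [frob_mx_comm], weighted by
falling products so that the terms [(s + k) frob_mx] telescope. *)
Lemma frob_diag m : frob_mx m.+1 m.+1 =
  falling z 0 m.+1 * frob_mx m.+1 0 +
  p%:R * (frob_defect m.+1 + frob_mx m m - frob_defect m).
Proof.
have tel : \sum_(k < m.+1) ((s + k%:R) * frob_mx m.+1 k + frob_mx m.+1 k.+1) * falling z k.+1 m.+1
   = frob_mx m.+1 m.+1 - falling z 0 m.+1 * frob_mx m.+1 0.
  pose u k := falling z k m.+1 * frob_mx m.+1 k.
  transitivity (\sum_(0 <= k < m.+1) (u k.+1 - u k)).
    rewrite big_mkord; apply: eq_bigr => k _; rewrite /u (falling_recl (ltn_ord k)).
    by rewrite /z; ring.
  by rewrite telescope_sumr // /u falling_id mul1r.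
apply/eqP; rewrite addrC -subr_eq -tel; apply/eqP.
transitivity (p%:R * (\sum_(k < m.+1) (s + m.+1%:R) * (frob_mx m.+1 k * falling z k.+1 m.+1)
   + \sum_(k < m.+1) frob_mx m k * falling z k.+1 m.+1)).
  rewrite -big_split mulr_sumr; apply: eq_bigr => k _ /=.
  have le_km : (k <= m)%N by rewrite -ltnS.
  rewrite (frob_mx_comm le_km) -mulrA; congr (_ * _).
  by rewrite mulrDl mulrA.
rewrite -mulr_sumr /frob_defect -[X in _ = _ * X]addrA; congr (_ * (_ + _)).
rewrite big_ord_recr /= falling_id mulr1 addrC; congr (_ + _).
rewrite mulr_sumr -sumrN; apply: eq_bigr => k _.
by rewrite falling_recr // /z; ring.
Qed.

(** In the limit [M -> oo] this reads [tr = S + p tr], where [S] is the Newton series with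
the coefficients [frob_mx m 0] at [z = - s]. *)
Lemma frob_trace M :
  \sum_(m < M.+1) frob_mx m m =
  \sum_(m < M.+1) falling z 0 m * frob_mx m 0 +
  p%:R * (frob_defect M + \sum_(m < M) frob_mx m m).
Proof.
elim: M => [|M IHM].
  by rewrite !big_ord1 big_ord0 falling_id /frob_defect big_ord0 mulr0 addr0 mulr0 addr0 mul1r.
pose g m := falling z 0 m * frob_mx m 0.
have Eg : \sum_(m < M.+2) g m = \sum_(m < M.+1) g m + g M.+1 by rewrite big_ord_recr.
have Ed : \sum_(m < M.+1) frob_mx m m = \sum_(m < M) frob_mx m m + frob_mx M M.
  by rewrite big_ord_recr.
rewrite big_ord_recr /= frob_diag -/(g _) Eg [X in X + _ = _]IHM Ed; ring.
Qed.

(** At a natural number [k] the Newton series is finite, and is read off in degree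
[a + p k] from [dwork * exp (- X^p / p) = exp X]. *)
Lemma frob_interp k M : (k < M)%N ->
  \sum_(m < M) falling k%:R 0 m * frob_mx m 0 =
  (- p%:R) ^+ k * k`!%:R / (a + p * k)`!%:R.
Proof.
move=> lt_kM; have p_gt0 := prime_gt0 pr_p.
have lt_ap' : (a < p)%N by apply: leq_trans lt_ap _; rewrite leq_pred.
have p0 : - p%:R != 0 :> F by rewrite oppr_eq0; apply: natF_neq0.
pose u m := falling k%:R 0 m * frob_mx m 0.
rewrite -(big_mkord xpredT u) (@big_cat_nat _ _ _ k.+1) //= [X in _ + X]big1_seq ?addr0; last first.
  move=> m; rewrite mem_index_iota => /andP[_ /andP[lt_km _]].
  rewrite /u /falling (bigD1_seq k) ?iota_uniq //=; last by rewrite mem_index_iota.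
  by rewrite subrr !mul0r.
have := congr1 (fun f : fps F => f (a + p * k)%N) (dwork_exp char0 pr_p).
rewrite mulrC fpsME => E.
have {E} : expf 1 (a + p * k)%N =
   \sum_(j < k.+1) (- p%:R^-1) ^+ j / j`!%:R * b (a + p * (k - j))%N.
  rewrite -E.
  transitivity (\sum_(i < (a + p * k).+1 | (p %| i)%N)
    expf (- p%:R^-1) (i %/ p)%N * b (a + p * k - i)%N).
    rewrite [RHS]big_mkcond; apply: eq_bigr => i _; rewrite /dil.
    by case: ifP => _; rewrite ?mul0r.
  have lt_j (j : 'I_k.+1) : (p * j < (a + p * k).+1)%N.
    by rewrite ltnS (leq_trans _ (leq_addl _ _)) // leq_mul2l -ltnS ltn_ord orbT.
  have lt_i (i : 'I_(a + p * k).+1) : (i %/ p < k.+1)%N.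
    rewrite ltnS -ltnS ltn_divLR // mulSn; apply: leq_trans (ltn_ord i) _.
    by rewrite mulnC ltn_add2r.
  rewrite (reindex_onto (fun j : 'I_k.+1 => Ordinal (lt_j j)) (fun i => Ordinal (lt_i i))) /=.
    apply: eq_big => [j|j _]; last first.
      rewrite mulKn // /expf mulnBr addnBA //.
      by rewrite leq_mul2l -ltnS ltn_ord orbT.
    by rewrite dvdn_mulr //= -val_eqE /= mulKn // eqxx.
  by move=> i pi; apply: val_inj; rewrite /= mulnC divnK.
rewrite /expf expr1n mul1r => E.
rewrite E mulr_sumr big_mkord (reindex_inj rev_ord_inj) /=.
apply: eq_bigr => j _; rewrite subSS /u /frob_mx subn0.
have le_jk : (j <= k)%N by rewrite -ltnS.
have -> : falling k%:R 0 (k - j) = k`!%:R / j`!%:R.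
  elim: (nat_of_ord j) le_jk => [_|i IHi lt_ik].
    rewrite subn0 fact0 divr1 /falling fact_prod natr_prod.
    rewrite big_add1 big_nat_rev /= add0n big_nat [RHS]big_nat; apply: eq_bigr => l /andP[_ lt_lk].
    by rewrite natrB // subKr.
  have := IHi (ltnW lt_ik); rewrite -(subnSK lt_ik) /falling big_nat_recr //=.
  rewrite natrB // opprB [k%:R + _]addrC subrK factS natrM => H.
  have ni : i.+1%:R != 0 :> F by [].
  have nf : i`!%:R != 0 :> F by apply: fact_neq0F.
  apply: (mulIf ni); rewrite H; field.
  by rewrite -(natrD _ 1 i) ni nf.
have -> : (- p%:R) ^+ k = (- p%:R) ^+ (k - j) * (- p%:R) ^+ j :> F.
  by rewrite -exprD subnK.
have nf : j`!%:R != 0 :> F by apply: fact_neq0F.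
have -> : (- p%:R^-1) ^+ j = ((- p%:R) ^+ j)^-1 :> F by rewrite -exprVn invrN.
have pj : (- p%:R) ^+ j != 0 :> F by rewrite expf_neq0.
by field; rewrite pj nf.
Qed.

Variable A : subringClosed F.
Hypothesis A_unit : forall m : nat, ~~ (p %| m)%N -> m%:R^-1 \in A.
Hypothesis A_fermat : forall x, x \in A -> (x ^+ p - x) / p%:R \in A.
Local Notation lev := (@lev F p A).

Let s_in : s \in A.
Proof.
rewrite rpredM ?rpred_nat // A_unit // gtnNdvd // -?subn1 ?subn_gt0 ?prime_gt1 //.
by rewrite subn1 ltn_predL prime_gt0.
Qed.

Lemma falling_in x m n : x \in A -> falling x m n \in A.
Proof. by move=> Ax; rewrite rpred_prod // => i _; rewrite rpredB ?rpred_nat. Qed.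

Lemma frob_mx_lev m n : lev m./2 (frob_mx m n).
Proof.
apply: (dwork_lev char0 pr_p p_gt3 A_unit A_fermat).
apply: leq_trans (leq_subr _ _) _; rewrite leq_add2r.
by apply: leq_trans (ltnW lt_ap) (leq_pred _).
Qed.

Lemma frob_defect_lev m : lev m./2 (frob_defect m).
Proof.
apply: levMl; first by rewrite rpredD ?rpred_nat.
apply: lev_sum => k _; rewrite mulrC; apply: levMl; last exact: frob_mx_lev.
by apply: falling_in; rewrite rpredN.
Qed.

(** The Newton series at [- s] is compared with its value at a natural number [k] close to
[- s]: falling products are congruent at congruent arguments. *)
Lemma trace_gamma N k : lev N (s + k%:R) -> exists M0, forall M, (M0 <= M)%N ->
  lev N ((1 - p%:R) * (\sum_(m < M) (- p%:R) ^+ m * b (a + p.-1 * m)%N) -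
         (- p%:R) ^+ k * k`!%:R / (a + p * k)`!%:R).
Proof.
move=> Lk; exists (maxn k.+1 (2 * N).+1) => -[|M]; first by rewrite geq_max.
rewrite geq_max => /andP[lt_kM le_NM].
have le_N : (N <= M./2)%N by rewrite -[N]doubleK half_leq // -mul2n.
rewrite -(frob_interp lt_kM).
have -> : \sum_(m < M.+1) (- p%:R) ^+ m * b (a + p.-1 * m)%N = \sum_(m < M.+1) frob_mx m m.
  apply: eq_bigr => m _; congr (_ * b _); rewrite -subn1 mulnBl mul1n addnBA //.
  by rewrite leq_pmull ?prime_gt0.
have Et : \sum_(m < M.+1) frob_mx m m = \sum_(m < M) frob_mx m m + frob_mx M M.
  by rewrite big_ord_recr.
rewrite mulrBl mul1r {1}frob_trace Et.
set g := \sum_(m < M.+1) falling z 0 m * _; set t := \sum_(m < M) _.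
set h := \sum_(m < M.+1) _.
rewrite (_ : _ - h = (g - h) + p%:R * (frob_defect M - frob_mx M M)); last by ring.
apply: levD.
  rewrite /g /h -sumrB; apply: lev_sum => m _; rewrite -mulrBl mulrC; apply: levMl.
    by rewrite -(lev_in p); apply: lev_leq (frob_mx_lev m 0).
  apply: lev_prodB => [l|l|l].
  - by rewrite rpredB ?rpredN ?rpred_nat.
  - by rewrite rpredB ?rpred_nat.
  rewrite (_ : _ - _ = - (s + k%:R)) ?levN //.
  by rewrite /z; ring.
apply: levMl; first exact: rpred_nat.
by apply: levB; [apply: lev_leq (frob_defect_lev M) | apply: lev_leq (frob_mx_lev M M)].
Qed.
End TraceFormula.

(** * The Gross-Koblitz formula over the p-adic numbers *)

Lemma frac_cancel (F : fieldType) (u v f w : F) : v != 0 -> f != 0 -> w != 0 ->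
  u * v * f / (v * f * w) = u / w.
Proof. by move=> v0 f0 w0; field; rewrite v0 f0 w0. Qed.

Section PadicField.
Variables (p : nat) (pr_p : prime p).
Local Notation Zp := (padic_int pr_p).
Local Notation Qp := {fraction Zp}.
Local Notation "x %:F" := (@FracField.tofrac Zp x).

Definition pint : {pred Qp} := fun x => `[< exists z : Zp, x = z%:F >].

Lemma pintP x : reflect (exists z : Zp, x = z%:F) (x \in pint).
Proof. exact: asboolP. Qed.

Lemma pint_tofrac (z : Zp) : z%:F \in pint.
Proof. by apply/pintP; exists z. Qed.

Fact pint_subring : subring_closed pint.
Proof.
split=> [|x y /pintP[a ->] /pintP[b ->]|x y /pintP[a ->] /pintP[b ->]]; apply/pintP.
- by exists 1; rewrite tofrac1.
- by exists (a - b); rewrite tofracB.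
by exists (a * b); rewrite tofracM.
Qed.
HB.instance Definition _ := GRing.isSubringClosed.Build Qp pint pint_subring.

Lemma tofrac_nat n : (n%:R : Zp)%:F = n%:R.
Proof. by rewrite tofracMn tofrac1. Qed.

Lemma Qp_char0 n : (n.+1)%:R != 0 :> Qp.
Proof. by rewrite -tofrac_nat tofrac_eq0 padic_nat_neq0. Qed.

Lemma tofracV (z : Zp) : z \is a GRing.unit -> (z^-1)%:F = (z%:F)^-1.
Proof.
move=> zU; have z0 : z%:F != 0 by rewrite tofrac_eq0; apply: contraTneq zU => ->; rewrite unitr0.
by apply: (mulfI z0); rewrite -tofracM divff // divrr // tofrac1.
Qed.

Lemma pint_natV m : ~~ (p %| m)%N -> m%:R^-1 \in pint.
Proof.
by move=> pNm; rewrite -tofrac_nat -tofracV ?pint_tofrac // padic_nat_unit.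
Qed.

Lemma Qp_p_neq0 : p%:R != 0 :> Qp.
Proof. by apply: natF_neq0; [exact: Qp_char0 | exact: prime_gt0]. Qed.

Lemma lev_eqmod N (x y : Zp) : lev p pint N (x%:F - y%:F) <-> padic_eqmod N x y.
Proof.
have pN0 : p%:R ^+ N != 0 :> Qp by rewrite expf_neq0 ?Qp_p_neq0.
split=> [/pintP[z Dz]|[z Dz]].
  exists z; apply/eqP; rewrite -tofrac_eq tofracB tofracM tofracXn tofrac_nat -Dz.
  by rewrite mulrC divfK.
apply/pintP; exists z; rewrite -tofracB Dz tofracM tofracXn tofrac_nat.
by rewrite mulrAC divff // mul1r.
Qed.

Lemma padic_fermat (z : Zp) : padic_eqmod 1 (z ^+ p) z.
Proof.
have [m Dm] := padic_approx 1 z.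
apply: (eqmod_trans (eqmodX p Dm)); apply: eqmod_trans (eqmod_sym Dm).
by rewrite -natrX; apply/eqmod_nat; rewrite expn1 fermat_little.
Qed.

Lemma pint_fermat x : x \in pint -> (x ^+ p - x) / p%:R \in pint.
Proof.
case/pintP=> z ->; rewrite -tofracXn -[p%:R]expr1.
exact/lev_eqmod/padic_fermat.
Qed.

Hypothesis p_gt3 : (3 < p)%N.
Let p_odd : odd p. Proof. by case: (even_prime pr_p) p_gt3 => // ->. Qed.

Lemma fact_unit_part K :
  K`!%:R = p%:R ^+ (K %/ p) * (K %/ p)`!%:R * \prod_(i < K.+1) unit_part pr_p i.
Proof.
have p_gt0 := prime_gt0 pr_p.
elim: K => [|K IHK].
  by rewrite div0n expr0 !mul1r big_ord1 /unit_part dvdn0.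
rewrite factS natrM IHK [\prod_(i < K.+2) _]big_ord_recr /= divnS // [unit_part _ K.+1]/unit_part.
case: ifP => pK /=; last by rewrite ?add0n; ring.
have -> : K.+1%:R = p%:R * (K %/ p).+1%:R :> Zp.
  by rewrite -natrM -[in LHS](divnK pK) divnS // pK mulnC add1n.
by rewrite ?add1n exprS factS natrM; ring.
Qed.

(** The value [(-p)^k k! / (a + p k)!] of [trace_gamma] at [k = a geo N] is, up to
sign, the inverse of a product of unit parts, because [k] is the quotient of
[a + p k = a geo (N+1)] by [p]. *)
Lemma gross_koblitz a N : (a < p.-1)%N -> exists M0, forall M, (M0 <= M)%N ->
  lev p pint N ((1 - p%:R) *
    (\sum_(m < M) (- p%:R) ^+ m * dwork Qp p (a + p.-1 * m)%N) -
    (padic_gamma (ratr (a%:R / p.-1%:R)))%:F).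
Proof.
move=> lt_ap; have p_gt0 := prime_gt0 pr_p.
have lt_ap' : (a < p)%N by apply: leq_trans lt_ap _; rewrite leq_pred.
have p1_gt0 : (0 < p.-1)%N by apply: leq_trans lt_ap.
have p1_neq0 : p.-1%:R != 0 :> Qp by apply: natF_neq0 => //; apply: Qp_char0.
have pN0 : p%:R ^+ N != 0 :> Qp by rewrite expf_neq0 ?Qp_p_neq0.
pose k := (a * geo p N)%N.
have Lk : lev p pint N (a%:R / p.-1%:R + k%:R).
  have -> : a%:R / p.-1%:R + k%:R = a%:R * p%:R ^+ N / p.-1%:R :> Qp.
    apply: (mulIf p1_neq0); rewrite mulrDl !divfK // -natrX -!natrM -natrD.
    rewrite /k -mulnA [(geo p N * _)%N]mulnC geoE -mulnS prednK //.
    by rewrite expn_gt0 p_gt0.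
  rewrite /lev mulrAC mulfK // rpredM ?rpred_nat //.
  by apply: pint_natV; apply: pred_prime_Ndvd.
have [M0 HM] := trace_gamma Qp_char0 pr_p p_gt3 lt_ap pint_natV pint_fermat Lk.
exists M0 => M /HM H.
rewrite -[X in lev _ _ _ X](subrKA ((- p%:R) ^+ k * k`!%:R / (a + p * k)`!%:R)).
apply: levD => //.
have DK : (a + p * k = a * geo p N.+1)%N by rewrite /k geoS; ring.
have Kp : ((a + p * k) %/ p = k)%N by rewrite addnC mulnC divnMDl // divn_small ?addn0.
have := fact_unit_part (a + p * k); rewrite Kp.
set W := \prod_(i < _) _ => DW.
have := padic_gamma_frac pr_p p_odd N lt_ap; rewrite -DK -/W -/k.
have WU : W \is a GRing.unit.
  by rewrite rpred_prod // => i _; apply: unit_part_unit.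
move=> E.
have W0 : W%:F != 0 by rewrite tofrac_eq0; apply: contraTneq WU => ->; rewrite unitr0.
have -> : (- p%:R) ^+ k * k`!%:R / (a + p * k)`!%:R = ((-1) ^+ k * W^-1)%:F.
  rewrite -[(a + p * k)`!%:R]tofrac_nat DW !tofracM !tofracXn tofracV //.
  rewrite tofracN tofrac1 !tofrac_nat.
  rewrite exprNn; apply: frac_cancel => //; first by rewrite expf_neq0 ?Qp_p_neq0.
  by apply: fact_neq0F; apply: Qp_char0.
apply/lev_eqmod; apply: (@eqmod_leq _ _ N.+1) => //.
rewrite -[X in padic_eqmod _ _ X](mulrK WU); apply: eqmodM => //; exact: eqmod_sym.
Qed.

End PadicField.

(** * Additive characters from the Dwork exponential *)

Lemma sum_cauchy_product (K : comNzRingType) (u v : nat -> K) M :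
  \sum_(n < M) \sum_(i < n.+1) u i * v (n - i)%N =
  \sum_(i < M) \sum_(j < M - i) u i * v j.
Proof.
elim: M => [|M IHM]; first by rewrite !big_ord0.
rewrite big_ord_recr IHM /= !(big_ord_recr M) /= subSnn big_ord1 subnn addrA; congr (_ + _).
rewrite -big_split; apply: eq_bigr => i _ /=.
have le_iM : (i <= M)%N by rewrite ltnW.
by rewrite subSn // big_ord_recr.
Qed.

Section Ramified.
Variable F : fieldType.
Hypothesis char0 : forall n, (n.+1)%:R != 0 :> F.
Variables (p : nat) (pr_p : prime p) (p_gt3 : (3 < p)%N).
Variable A : subringClosed F.
Hypothesis A_unit : forall m : nat, ~~ (p %| m)%N -> m%:R^-1 \in A.
Hypothesis A_fermat : forall x, x \in A -> (x ^+ p - x) / p%:R \in A.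
(* Values at unif are defined as limits, which are unique because A is separated. *)
Hypothesis A_sep : forall x : F, (forall N, lev p A N x) -> x = 0.
Local Notation b := (dwork F p).

(** The class [unif] of [X] modulo this polynomial is the number that Dwork calls pi. *)
Definition eisenstein : {poly F} := 'X^(p.-1) + p%:R%:P.
Local Notation K := {poly %/ eisenstein}.

Let p_gt0 : (0 < p)%N. Proof. exact: prime_gt0. Qed.
Let p1_gt0 : (0 < p.-1)%N. Proof. by rewrite -subn1 subn_gt0 prime_gt1. Qed.
Let p_neq0 : p%:R != 0 :> F. Proof. exact: natF_neq0. Qed.

Lemma size_eisenstein : size eisenstein = p.
Proof.
rewrite /eisenstein size_polyDl size_polyXn ?prednK //.
by rewrite (leq_ltn_trans (size_polyC_leq1 _)) // prime_gt1.
Qed.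

Lemma eisenstein_monic : eisenstein \is monic.
Proof.
rewrite monicE lead_coefE size_eisenstein /eisenstein coefD coefXn coefC eqxx.
by rewrite gtn_eqF ?addr0.
Qed.

Lemma mk_eisenstein : mk_monic eisenstein = eisenstein.
Proof. by rewrite /mk_monic size_eisenstein prime_gt1 // eisenstein_monic. Qed.

Definition inK : {poly F} -> K := in_qpoly eisenstein.
Definition constK (c : F) : K := inK c%:P.
Definition unif : K := inK 'X.

HB.instance Definition _ := GRing.RMorphism.copy inK (in_qpoly eisenstein).
HB.instance Definition _ := GRing.RMorphism.copy constK (inK \o polyC).

Lemma inK_small (P : {poly F}) : (size P <= p.-1)%N -> val (inK P) = P.
Proof.
move=> sP; apply: in_qpoly_small; rewrite mk_eisenstein size_eisenstein.
by rewrite -(prednK p_gt0) ltnS.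
Qed.

Lemma constK_inj : injective constK.
Proof.
move=> c d /(congr1 val); rewrite !inK_small ?(leq_trans (size_polyC_leq1 _)) //.
exact: polyC_inj.
Qed.

Lemma unifXp : unif ^+ p.-1 = constK (- p%:R).
Proof.
rewrite /unif -rmorphXn; apply/eqP; rewrite -subr_eq0 -rmorphB polyCN opprK /=.
apply/eqP; apply: val_inj; rewrite /= mk_eisenstein.
by rewrite -/eisenstein Pdiv.RingMonic.rmodpp // eisenstein_monic.
Qed.

Lemma inKE (P : {poly F}) : inK P = \sum_(i < size P) constK P`_i * unif ^+ i.
Proof.
rewrite -{1}[P]coefK poly_def rmorph_sum; apply: eq_bigr => i _.
by rewrite -mul_polyC rmorphM rmorphXn.
Qed.

(** Divisibility by [p^N] in the subring generated by [A] and [unif]. *)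
Definition levK N (x : K) :=
  exists2 P : {poly F}, P \is a polyOver A & x = constK (p%:R ^+ N) * inK P.

(** Reducing the exponents of [unif] modulo [p - 1] only introduces powers of [- p]; as the
small powers form a basis, a divisible element has divisible coordinates. *)
Lemma levK_coef N x i : levK N x -> lev p A N (val x)`_i.
Proof.
case=> P AP ->.
pose Q := \sum_(j < size P) (P`_j * (- p%:R) ^+ (j %/ p.-1)) *: 'X^(j %% p.-1) : {poly F}.
have DP : inK P = inK Q.
  rewrite inKE rmorph_sum; apply: eq_bigr => j _.
  rewrite -mul_polyC rmorphM rmorphXn /= -/(constK _) -/unif rmorphM rmorphXn /= -unifXp.
  by rewrite -mulrA -exprM -exprD mulnC -divn_eq.
have sQ : (size Q <= p.-1)%N.
  apply: (leq_trans (size_sum _ _ _)); apply/bigmax_leqP => j _.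
  by rewrite (leq_trans (size_scale_leq _ _)) // size_polyXn ltn_mod.
have AQ : Q \is a polyOver A.
  apply: rpred_sum => j _; rewrite polyOverZ ?polyOverXn // rpredM //.
    exact: (polyOverP AP).
  by rewrite rpredX ?rpredN ?rpred_nat.
rewrite DP /constK -rmorphM mul_polyC inK_small; last first.
  exact: leq_trans (size_scale_leq _ _) sQ.
rewrite coefZ mulrC; apply: levMl; last exact: lev_p.
exact: (polyOverP AQ).
Qed.

Lemma levK_sep x : (forall N, levK N x) -> x = 0.
Proof.
move=> L; apply: val_inj; apply/polyP => i; rewrite [RHS]coef0.
by apply: A_sep => N; apply: levK_coef.
Qed.

Lemma levK0 N : levK N 0.
Proof. by exists 0; rewrite ?rpred0 // rmorph0 mulr0. Qed.
Lemma levKD N x y : levK N x -> levK N y -> levK N (x + y).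
Proof.
move=> [P AP ->] [Q AQ ->]; exists (P + Q); first exact: rpredD.
by rewrite rmorphD mulrDr.
Qed.
Lemma levKN N x : levK N x -> levK N (- x).
Proof. by move=> [P AP ->]; exists (- P); rewrite ?rpredN // rmorphN mulrN. Qed.
Lemma levKM M N x y : levK M x -> levK N y -> levK (M + N) (x * y).
Proof.
move=> [P AP ->] [Q AQ ->]; exists (P * Q); first exact: rpredM.
by rewrite rmorphM exprD rmorphM mulrACA.
Qed.
Lemma levK_sum N (I : Type) (r : seq I) (P : pred I) (f : I -> K) :
  (forall i, P i -> levK N (f i)) -> levK N (\sum_(i <- r | P i) f i).
Proof. by move=> H; elim/big_ind: _ => // *; [exact: levK0 | exact: levKD]. Qed.
Lemma levK_const N c n : lev p A N c -> levK N (constK c * unif ^+ n).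
Proof.
move=> Lc; exists ((c / p%:R ^+ N) *: 'X^n); first by rewrite polyOverZ ?polyOverXn.
have Dc : constK c = constK (p%:R ^+ N) * constK (c / p%:R ^+ N).
  by rewrite -rmorphM mulrC divfK ?expf_neq0.
by rewrite Dc -mulrA -mul_polyC [in RHS]rmorphM rmorphXn.
Qed.
Lemma levK_leq M N x : (M <= N)%N -> levK N x -> levK M x.
Proof.
move=> le_MN [P AP ->]; exists ((p%:R ^+ (N - M)) *: P).
  by rewrite polyOverZ ?rpredX ?rpred_nat.
have Dp : constK (p%:R ^+ N) = constK (p%:R ^+ M) * constK (p%:R ^+ (N - M)).
  by rewrite -rmorphM -exprD subnKC.
by rewrite Dp -mulrA -mul_polyC [in RHS]rmorphM.
Qed.
Lemma levKMr N x y : levK N x -> levK 0 y -> levK N (x * y).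
Proof. by move=> Lx /(levKM Lx); rewrite addn0. Qed.
Lemma levKMl N x y : levK 0 x -> levK N y -> levK N (x * y).
Proof. by move=> Lx /(levKM Lx). Qed.

Definition psum M (f : fps F) : K := \sum_(n < M) constK (f n) * unif ^+ n.

(** The terms of the series at [unif] are integral and tend to 0. *)
Definition null_fps (f : fps F) := (forall n, levK 0 (constK (f n) * unif ^+ n)) /\
  forall N, exists M0, forall n, (M0 <= n)%N -> levK N (constK (f n) * unif ^+ n).

(** The series [f], evaluated at [unif], converges to [s]. *)
Definition sums (f : fps F) (s : K) := forall N, exists M0, forall M, (M0 <= M)%N ->
  levK N (psum M f - s).

Lemma psum_int M f : null_fps f -> levK 0 (psum M f).
Proof. by case=> f0 _; apply: levK_sum. Qed.

Lemma psum_cauchy f : null_fps f -> forall N, exists M0, forall M M', (M0 <= M)%N -> (M0 <= M')%N ->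
  levK N (psum M f - psum M' f).
Proof.
move=> [_ fN] N; have [M0 HM] := fN N; exists M0.
have H M i : (M0 <= M)%N -> levK N (psum (M + i) f - psum M f).
  move=> le_M; elim: i => [|i IHi]; first by rewrite addn0 subrr; apply: levK0.
  rewrite addnS /psum big_ord_recr /= addrAC; apply: levKD => //.
  by apply: HM; apply: leq_trans le_M (leq_addr _ _).
move=> M M' hM hM'; case/orP: (leq_total M M') => le_M.
  by rewrite -opprB -(subnKC le_M); apply/levKN/H.
by rewrite -(subnKC le_M); apply: H.
Qed.

(** For a null series it suffices that [s] is a limit point of the partial sums. *)
Lemma sums_sub f s : null_fps f ->
  (forall N M0, exists2 M, (M0 <= M)%N & levK N (psum M f - s)) -> sums f s.
Proof.
move=> f0 fs N; have [M0 HM] := psum_cauchy f0 N; exists M0 => M le_M.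
have [M' le_M' L] := fs N M0; rewrite -(subrKA (psum M' f)); apply: levKD => //.
exact: HM.
Qed.

Lemma sums_int f s : null_fps f -> sums f s -> levK 0 s.
Proof.
move=> f0 fs; have [M0 /(_ _ (leqnn _)) L] := fs 0%N.
rewrite -[s](subKr (psum M0 f)); apply: levKD; first exact: psum_int.
by apply: levKN.
Qed.

Lemma sums_uniq f s t : sums f s -> sums f t -> s = t.
Proof.
move=> fs ft; apply/eqP; rewrite -subr_eq0; apply/eqP/levK_sep => N.
have [M0 H0] := fs N; have [M1 H1] := ft N; pose M := maxn M0 M1.
rewrite -(subrKA (psum M f)) -opprB; apply: levKD.
  by apply/levKN/H0/leq_maxl.
by apply: H1; apply: leq_maxr.
Qed.

Lemma psumM f g : null_fps f -> null_fps g -> forall N, exists M0, forall M, (M0 <= M)%N ->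
  levK N (psum M (f * g) - psum M f * psum M g).
Proof.
move=> [f0 fN] [g0 gN] N; have [M1 H1] := fN N; have [M2 H2] := gN N.
exists (M1 + M2)%N => M le_M.
pose u n := constK (f n) * unif ^+ n; pose v n := constK (g n) * unif ^+ n.
have -> : psum M (f * g) = \sum_(i < M) \sum_(j < M - i) u i * v j.
  rewrite -sum_cauchy_product; apply: eq_bigr => n _; rewrite fpsME rmorph_sum mulr_suml.
  apply: eq_bigr => i _; rewrite rmorphM /u /v mulrACA -exprD subnKC //.
  by rewrite -ltnS.
have -> : psum M f * psum M g = \sum_(i < M) \sum_(j < M) u i * v j.
  by rewrite /psum mulr_suml; apply: eq_bigr => i _; rewrite mulr_sumr.
rewrite -sumrB; apply: levK_sum => i _.
have -> : \sum_(j < M) u i * v j = \sum_(j < M - i) u i * v j + \sum_(M - i <= j < M) u i * v j.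
  rewrite -!(big_mkord xpredT (fun j => u i * v j)) -big_cat_nat ?leq_subr //.
rewrite opprD addrA subrr sub0r; apply: levKN.
rewrite big_nat; apply: levK_sum => j /andP[le_j lt_j].
have [le_i|lt_i] := leqP M1 i.
  by apply: levKMr; [apply: H1 | apply: g0].
apply: levKMl; [apply: f0 | apply: H2].
rewrite -(leq_add2l M1); apply: leq_trans le_M _; rewrite leq_subLR in le_j.
by apply: leq_trans le_j _; rewrite leq_add2r ltnW.
Qed.

Lemma null_fpsM f g : null_fps f -> null_fps g -> null_fps (f * g).
Proof.
move=> [f0 fN] [g0 gN].
have Dn n : constK ((f * g) n) * unif ^+ n =
    \sum_(i < n.+1) (constK (f i) * unif ^+ i) * (constK (g (n - i)%N) * unif ^+ (n - i)).
  rewrite fpsME rmorph_sum mulr_suml; apply: eq_bigr => i _.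
  by rewrite rmorphM mulrACA -exprD subnKC // -ltnS.
split=> [n|N]; first by rewrite Dn; apply: levK_sum => i _; apply: (levKM (M := 0) (N := 0)).
have [M1 H1] := fN N; have [M2 H2] := gN N; exists (M1 + M2)%N => n le_n.
rewrite Dn; apply: levK_sum => i _; have [le_i|lt_i] := leqP M1 i.
  by apply: levKMr; [apply: H1 | apply: g0].
apply: levKMl; [apply: f0 | apply: H2].
by rewrite -(leq_add2l M1) (leq_trans le_n) // -leq_subLR leq_sub2l // ltnW.
Qed.

Lemma sumsM f g s t : null_fps f -> null_fps g -> sums f s -> sums g t ->
  sums (f * g) (s * t).
Proof.
move=> f0 g0 fs gt N; have [M0 H0] := psumM f0 g0 N.
have [M1 H1] := fs N; have [M2 H2] := gt N.
exists (M0 + (M1 + M2))%N => M le_M.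
rewrite -(subrKA (psum M f * psum M g)); apply: levKD.
  by apply: H0; apply: leq_trans le_M; rewrite leq_addr.
rewrite (_ : _ - _ = (psum M f - s) * psum M g + s * (psum M g - t)); last by ring.
apply: levKD.
  apply: levKMr; last exact: psum_int.
  by apply: H1; apply: leq_trans le_M; rewrite addnCA leq_addr.
apply: levKMl; first exact: sums_int f0 fs.
by apply: H2; apply: leq_trans le_M; rewrite addnA leq_addl.
Qed.

Lemma half_div_tends d N : (0 < d)%N -> exists M0, forall n, (M0 <= n)%N -> (N <= (n %/ d)./2)%N.
Proof.
move=> d0; exists (N.*2 * d)%N => n le_n.
by rewrite -[N]doubleK half_leq // leq_divRL.
Qed.

Lemma null_of_lev d f : (0 < d)%N ->
  (forall n, levK (n %/ d)./2 (constK (f n) * unif ^+ n)) -> null_fps f.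
Proof.
move=> d0 Hf; split=> [n|N]; first exact: levK_leq (leq0n _) (Hf n).
by have [M0 H] := half_div_tends N d0; exists M0 => n /H le_N; apply: levK_leq le_N (Hf n).
Qed.

Lemma unif_divn c n : constK c * unif ^+ n =
  constK ((- p%:R) ^+ (n %/ p.-1) * c) * unif ^+ (n %% p.-1).
Proof.
rewrite rmorphM rmorphXn /= -unifXp -exprM mulrAC -exprD [(p.-1 * _)%N]mulnC -divn_eq.
exact: mulrC.
Qed.

(** [exp (x X + x^p X^p / p)]; for a Teichmuller representative [x] this is
[exp (x X) exp (x X^p / p)]. *)
Definition theta (x : F) : fps F := scl x b.

Lemma null_theta x : x \in A -> null_fps (theta x).
Proof.
move=> Ax; apply: (null_of_lev p1_gt0) => n; rewrite unif_divn; apply: levK_const.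
rewrite /theta /scl mulrCA; apply: levMl; first exact: rpredX.
apply: (dwork_lev char0 pr_p p_gt3 A_unit A_fermat).
rewrite {1}(divn_eq n p.-1) addnC leq_add //.
  by rewrite (leq_trans (ltnW (ltn_pmod _ _))) // leq_pred.
by rewrite mulnC leq_mul2r leq_pred orbT.
Qed.

Lemma lev_expp n : lev p A n./2 (p%:R ^+ n / n`!%:R).
Proof.
have hn : (n./2 + n./2 <= n)%N by rewrite addnn -{2}(odd_double_half n) leq_addl.
have En : (n = n./2 + (n - n./2))%N by rewrite subnKC // (leq_trans (leq_addr _ _) hn).
have Lf : (logn p n`! <= n - n./2)%N.
  have := logn_fact_half pr_p p_gt3 n; rewrite mul2n => h.
  have h2 : (logn p n`! <= n./2)%N by rewrite -[logn _ _]doubleK half_leq.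
  by apply: leq_trans h2 _; rewrite leq_subRL // (leq_trans (leq_addr _ _) hn).
rewrite /lev; have -> : p%:R ^+ n = p%:R ^+ n./2 * p%:R ^+ (n - n./2) :> F.
  by rewrite -exprD -En.
rewrite mulrAC [p%:R ^+ n./2 * _]mulrC mulfK ?expf_neq0 //.
exact: (p_fact_in char0 pr_p A_unit).
Qed.

Lemma lev_exp w n : w \in A -> lev p A n./2 ((p%:R * w) ^+ n / n`!%:R).
Proof.
move=> Aw; rewrite exprMn mulrC mulrA mulrC; apply: levMl; first exact: rpredX.
rewrite mulrC; exact: lev_expp.
Qed.

Lemma null_exp w : w \in A -> null_fps (expf (p%:R * w)).
Proof.
move=> Aw; apply: (null_of_lev (d := 1)) => // n; rewrite divn1.
by apply: levK_const; apply: lev_exp.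
Qed.

Lemma unif_expp j : unif ^+ (j * p) = constK ((- p%:R) ^+ j) * unif ^+ j.
Proof.
by rewrite mulnC exprM -{1}(prednK p_gt0) exprSr unifXp exprMn rmorphXn.
Qed.

Lemma null_dil_exp w : w \in A -> null_fps (dil p (expf w)).
Proof.
move=> Aw; apply: (null_of_lev p_gt0) => n; rewrite /dil.
case: ifP => [/dvdnP[j ->]|_]; last by rewrite rmorph0 mul0r; apply: levK0.
rewrite mulnK // unif_expp mulrA -rmorphM; apply: levK_const.
rewrite /expf mulrC mulrA -exprMn mulNr -mulrN.
by apply: lev_exp; rewrite rpredN.
Qed.

(** As [unif^p = - p unif], substituting [X^p] for [X] amounts to scaling by [- p]. *)
Lemma psum_dil w M : psum (M * p) (dil p (expf w)) = psum M (expf (- (p%:R * w))).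
Proof.
elim: M => [|M IHM]; first by rewrite /psum !big_ord0.
rewrite mulSn addnC /psum big_split_ord /= -/(psum _ _) IHM.
rewrite [RHS]big_ord_recr /=; congr (_ + _).
rewrite -(prednK p_gt0) big_ord_recl /= prednK // addn0 big1 ?addr0; last first.
  move=> i _; rewrite /dil /bump /= add1n dvdn_addr ?dvdn_mull //.
  by rewrite gtnNdvd ?rmorph0 ?mul0r // -ltn_predRL.
rewrite /dil dvdn_mull // mulnK // unif_expp mulrA -rmorphM.
by congr (constK _ * _); rewrite /expf mulrAC -exprMn -mulNr [w * _]mulrC.
Qed.

(** The product is [exp (p w pi) exp (w pi^p)] with [pi = unif] and [pi^p = - p pi]. It is
not 1 as a series, only its value is. *)
Lemma sums_exp_cancel w : w \in A -> sums (expf (p%:R * w) * dil p (expf w)) 1.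
Proof.
move=> Aw; have ne := null_exp Aw; have nd := null_dil_exp Aw.
have ne' : null_fps (expf (- (p%:R * w))).
  by rewrite -mulrN; apply: null_exp; rewrite rpredN.
have psum1 M : psum M.+1 1 = 1.
  rewrite /psum big_ord_recl fps1E rmorph1 expr0 mulr1 big1 ?addr0 // => i _.
  by rewrite fps1E rmorph0 mul0r.
have ned := null_fpsM ne nd.
apply: sums_sub => // N M0.
have [M1 H1] := psumM ne nd N; have [M2 H2] := psumM ne ne' N.
have [M3 H3] := psum_cauchy ne N.
pose M := (M0 + (M1 + (M2 + M3))).+1; have le_MMp : (M <= M * p)%N by rewrite leq_pmulr.
have [le0 le1 le2 le3] : [/\ M0 <= M, M1 <= M, M2 <= M & M3 <= M]%N.
  by rewrite /M; split; lia.
exists (M * p)%N; first exact: leq_trans le0 le_MMp.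
rewrite -(subrKA (psum (M * p) (expf (p%:R * w)) * psum (M * p) (dil p (expf w)))).
apply: levKD; first by apply: H1; apply: leq_trans le1 le_MMp.
rewrite psum_dil -(subrKA (psum M (expf (p%:R * w)) * psum M (expf (- (p%:R * w))))).
apply: levKD.
  rewrite -mulrBl; apply: levKMr; last exact: psum_int.
  by apply: H3 => //; apply: leq_trans le3 le_MMp.
rewrite -opprB; apply: levKN; have := H2 M le2.
by rewrite -expfD // subrr expf0 // psum1.
Qed.

Lemma thetaE x : x ^+ p = x -> theta x = expf x * dil p (expf (x / p%:R)).
Proof.
by move=> xp; rewrite /theta /dwork sclM scl_expf mulr1 scl_dil // xp scl_expf.
Qed.

(** Teichmuller representatives are additive up to a multiple of [p], and the exponential of
that error term has value 1 by [sums_exp_cancel]. *)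
Lemma theta_add x y z w : x ^+ p = x -> y ^+ p = y -> z ^+ p = z ->
  x + y = z + p%:R * w ->
  theta x * theta y = theta z * (expf (p%:R * w) * dil p (expf w)).
Proof.
move=> xp yp zp Dxy; rewrite (thetaE xp) (thetaE yp) (thetaE zp).
have dilD (c d : F) : dil p (expf c) * dil p (expf d) = dil p (expf (c + d)).
  by rewrite -dilM // -(expfD char0).
have expD (c d : F) : expf c * expf d = expf (c + d) by rewrite (expfD char0).
rewrite mulrACA [RHS]mulrACA !expD !dilD -mulrDl Dxy.
by rewrite mulrDl mulrAC divff ?mul1r.
Qed.

Lemma sums_theta_add x y z w r s t : x \in A -> y \in A -> z \in A -> w \in A ->
  x ^+ p = x -> y ^+ p = y -> z ^+ p = z -> x + y = z + p%:R * w ->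
  sums (theta x) r -> sums (theta y) s -> sums (theta z) t -> r * s = t.
Proof.
move=> Ax Ay Az Aw xp yp zp Dxy Sx Sy Sz; rewrite -[t]mulr1.
apply: (@sums_uniq (theta x * theta y)); first by apply: sumsM => //; apply: null_theta.
rewrite (theta_add xp yp zp Dxy); apply: sumsM => //; first exact: null_theta.
  by apply: null_fpsM; [apply: null_exp | apply: null_dil_exp].
exact: sums_exp_cancel.
Qed.

Lemma sums_theta0 : sums (theta 0) 1.
Proof.
move=> N; exists 1%N => -[//|M] _.
rewrite /psum big_ord_recl /theta /scl expr0 mul1r dwork0 // rmorph1 expr0 mulr1.
rewrite big1 ?addr0 ?subrr; first exact: levK0.
by move=> i _; rewrite expr0n mul0r rmorph0 mul0r.
Qed.

Variable G : nat -> F.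
Hypothesis G_lim : forall j N, (j < p.-1)%N -> exists M0, forall M, (M0 <= M)%N ->
  lev p A N ((1 - p%:R) * (\sum_(m < M) (- p%:R) ^+ m * b (j + p.-1 * m)%N) - G j).

(** The Gauss sum predicted by Gross and Koblitz when [G j] is the gamma value at
[j / (p - 1)]. *)
Definition gauss_gk j : K := - (constK (G j) * unif ^+ j).

(** The function of [x] with Mellin coefficients [gauss_gk]; at Teichmuller representatives
it is the value of [theta x]. *)
Definition gauss_interp (x : F) : K :=
  constK (p.-1%:R)^-1 * \sum_(j < p.-1) gauss_gk j * constK (x ^+ j).

(** The terms of [theta x] are grouped by the class of their degree modulo [p - 1], on which
[x^n] is constant; each class sums to a Gross-Koblitz series. *)
Lemma sums_theta x : x \in A -> x ^+ p.-1 = 1 -> sums (theta x) (gauss_interp x).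
Proof.
move=> Ax x1; apply: sums_sub; first exact: null_theta.
move=> N M0.
have p1_neq0 : p.-1%:R != 0 :> F by apply: natF_neq0.
have [M1 H1] : exists M1, forall j, (j < p.-1)%N -> lev p A N
    ((1 - p%:R) * (\sum_(m < maxn M0 M1) (- p%:R) ^+ m * b (j + p.-1 * m)%N) - G j).
  have /choice[f Hf] : forall j : 'I_p.-1, exists M2, forall M, (M2 <= M)%N ->
    lev p A N ((1 - p%:R) * (\sum_(m < M) (- p%:R) ^+ m * b (j + p.-1 * m)%N) - G j).
    by move=> j; apply: G_lim.
  exists (\max_j f j) => j lt_j; apply: (Hf (Ordinal lt_j)).
  by rewrite (leq_trans _ (leq_maxr _ _)) //; apply: (leq_bigmax (Ordinal lt_j)).
set M := maxn M0 M1 in H1.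
exists (M * p.-1)%N; first by rewrite (leq_trans (leq_maxl M0 M1)) // leq_pmulr.
rewrite /psum (big_ord_block _ (fun n => constK (theta x n) * unif ^+ n)) exchange_big.
rewrite /gauss_interp mulr_sumr -sumrB /=; apply: levK_sum => j _.
have -> : \sum_(m < M) constK (theta x (j + m * p.-1)%N) * unif ^+ (j + m * p.-1) =
   constK (x ^+ j * \sum_(m < M) (- p%:R) ^+ m * b (j + p.-1 * m)%N) * unif ^+ j.
  rewrite mulr_sumr rmorph_sum mulr_suml; apply: eq_bigr => m _.
  have -> : unif ^+ (j + m * p.-1) = constK ((- p%:R) ^+ m) * unif ^+ j.
    by rewrite addnC mulnC exprD exprM unifXp rmorphXn.
  rewrite mulrA -rmorphM; congr (constK _ * _).
  rewrite [(m * _)%N]mulnC /theta /scl exprD exprM x1 expr1n mulr1.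
  by rewrite -mulrA [b _ * _]mulrC.
rewrite /gauss_gk mulNr mulrN opprK mulrAC mulrA -!rmorphM -mulrDl -rmorphD.
apply: levK_const.
set S := \sum_(m < M) _.
rewrite (_ : _ + _ = - (p.-1%:R)^-1 * (x ^+ j * ((1 - p%:R) * S - G j))).
  apply: levMl; first by rewrite rpredN A_unit // gtnNdvd // ltn_predL.
  by apply: levMl; [exact: rpredX | exact: H1].
have -> : p%:R = p.-1%:R + 1 :> F by rewrite natr1 prednK.
by field.
Qed.

End Ramified.

(** * A product of Gauss sums as a point count *)

Lemma dvdn_lt_double q n : (q %| n)%N -> (0 < n)%N -> (n < q.*2)%N -> n = q.
Proof.
case/dvdnP=> -[|[|m]] ->; rewrite ?mul1n // mulSn mulSn addnA addnn.
by rewrite -{3}[q.*2]addn0 ltn_add2l ltn0.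
Qed.

(** Here [om] is a multiplicative and [e] an additive character with values in [K]. The [g j]
are introduced as the Mellin coefficients of [e], and turn out to be its Gauss sums. *)
Section GaussSums.
Variables (F : finFieldType) (K : comNzRingType).
Local Notation q1 := (#|F|.-1).
Variables (om e : F -> K) (g : nat -> K) (u : K).
Hypothesis uK : u * q1%:R = 1.
Hypothesis om1 : om 1 = 1.
Hypothesis omM : forall x y, om (x * y) = om x * om y.
Hypothesis om_exp : forall x, x != 0 -> om x ^+ q1 = 1.
Hypothesis om_orth : forall x, x != 0 ->
  \sum_(j < q1) om x ^+ j = if x == 1 then q1%:R else 0.
Hypothesis om_sum : forall k,
  \sum_(x | x != 0) om x ^+ k = if (q1 %| k)%N then q1%:R else 0.
Hypothesis e0 : e 0 = 1.
Hypothesis eD : forall x y, e (x + y) = e x * e y.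
Hypothesis eE : forall x, x != 0 -> e x = u * \sum_(j < q1) g j * om x ^+ j.
Hypothesis g0 : g 0 = -1.

Lemma card_units_gt0 : (0 < q1)%N.
Proof.
by rewrite -(cardC1 (0 : F)); apply/card_gt0P; exists 1; rewrite inE oner_eq0.
Qed.

Lemma omX x n : om (x ^+ n) = om x ^+ n.
Proof. by elim: n => [|n IHn]; rewrite ?om1 // !exprS omM IHn. Qed.

Lemma omVX x j : (j <= q1)%N -> x != 0 -> om x^-1 ^+ j = om x ^+ (q1 - j).
Proof.
move=> le_j x0; rewrite -[LHS]mul1r -(om_exp x0) -{1}(subnK le_j) exprD -mulrA.
by rewrite -exprMn -omM mulfV // om1 expr1n mulr1.
Qed.

(** Mellin inversion. *)
Lemma gauss_sumE j : (j < q1)%N -> g j = \sum_(x | x != 0) om x^-1 ^+ j * e x.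
Proof.
move=> lt_j.
transitivity (u * \sum_(i < q1) g i * \sum_(x | x != 0) om x ^+ (i + (q1 - j))).
  rewrite (bigD1 (Ordinal lt_j)) //= subnKC ?(ltnW lt_j) // om_sum dvdnn big1 => [|i ne_ij].
    by rewrite addr0 mulrCA uK mulr1.
  rewrite om_sum; case: ifPn; rewrite ?mulr0 // => dvd_q.
  case/eqP: ne_ij; apply: val_inj => /=.
  have Eq : (i + (q1 - j) = q1)%N.
    apply: (dvdn_lt_double dvd_q); first by rewrite addn_gt0 subn_gt0 lt_j orbT.
    by rewrite -addnn -addSn leq_add // leq_subr.
  by apply/eqP; rewrite -(eqn_add2r (q1 - j)) Eq subnKC // ltnW.
under eq_bigr do rewrite mulr_sumr.
rewrite exchange_big /= mulr_sumr; apply: eq_bigr => x x0.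
rewrite eE // mulrCA; congr (u * _); rewrite mulr_sumr; apply: eq_bigr => i _.
by rewrite (omVX (ltnW lt_j)) // exprD; ring.
Qed.

Lemma sum_e c : \sum_(w | w != 0) e (w * c) = if c == 0 then q1%:R else -1.
Proof.
have [->|c0] := eqVneq c 0.
  rewrite (eq_bigr (fun=> 1)) => [|w _]; last by rewrite mulr0 e0.
  by rewrite sumr_const cardC1.
rewrite -g0 (gauss_sumE card_units_gt0).
rewrite [RHS](reindex_onto (fun w => w * c) (fun w => w / c)) /=; last first.
  by move=> w _; rewrite divfK.
apply: eq_big => [w|w _]; last by rewrite expr0 mul1r.
by rewrite mulf_eq0 (negbTE c0) orbF mulfK // eqxx andbT.
Qed.

Lemma sum_scale (f : F -> K) c : c != 0 ->
  \sum_(x | x != 0) f x = \sum_(x | x != 0) f (c * x).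
Proof.
move=> c0; rewrite (reindex_onto (fun w => c * w) (fun w => w / c)) /=; last first.
  by move=> w _; rewrite mulrC divfK.
apply: eq_bigl => w.
by rewrite mulf_eq0 (negbTE c0) mulrAC divff // mul1r eqxx andbT.
Qed.

(** Multiplying out four Gauss sums and scaling three variables by the opposite of the
fourth makes the argument of [e] linear in [w]. *)
Lemma gauss_product j c : (j < q1)%N -> (c < q1)%N -> (q1 %| 3 * j + c)%N ->
  g j ^+ 3 * g c =
  \sum_(w | w != 0) \sum_(x | x != 0) \sum_(y | y != 0) \sum_(z | z != 0)
    om (- (x * y * z)^-1) ^+ j * e (w * (1 - x - y - z)).
Proof.
move=> lt_j lt_c dvd_q.
have gc : g c = \sum_(w | w != 0) om w ^+ (3 * j) * e w.
  rewrite (gauss_sumE lt_c); apply: eq_bigr => w w0; congr (_ * _).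
  have [m Dm] := dvdnP dvd_q.
  rewrite -[RHS]mulr1 -(expr1n _ c) -om1 -(mulfV w0) omM exprMn mulrA -exprD Dm.
  by rewrite mulnC exprM om_exp // expr1n mul1r.
rewrite mulrC gc mulr_suml; apply: eq_bigr => w w0.
have mw0 : - w != 0 by rewrite oppr_eq0.
have gw : g j = \sum_(x | x != 0) om (- (w * x))^-1 ^+ j * e (- (w * x)).
  rewrite (gauss_sumE lt_j) (sum_scale _ mw0).
  by under eq_bigr do rewrite mulNr.
rewrite exprS expr2 {1}gw mulr_suml mulr_sumr; apply: eq_bigr => x x0.
rewrite {1}gw mulr_suml mulr_sumr mulr_sumr; apply: eq_bigr => y y0.
rewrite gw !mulr_sumr; apply: eq_bigr => z z0.
rewrite (_ : w * (1 - x - y - z) = w + - (w * x) + - (w * y) + - (w * z)); last by ring.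
rewrite !eD exprM -omX.
have -> : - (x * y * z)^-1 = w ^+ 3 * (- (w * x))^-1 * (- (w * y))^-1 * (- (w * z))^-1.
  by field; rewrite !oppr_eq0 !mulf_eq0 !negb_or x0 y0 z0 w0.
by rewrite !omM !exprMn; ring.
Qed.

(** Summing over [j] detects [x y z = s], summing over [w] detects [x + y + z = 1]. *)
Lemma gauss_count (s : F) (c : nat -> nat) : s != 0 ->
  (forall j, (j < q1)%N -> (c j < q1)%N /\ (q1 %| 3 * j + c j)%N) ->
  \sum_(j < q1) om (- s) ^+ j * (g j ^+ 3 * g (c j)) =
  q1%:R * (#|F|%:R * #|sum1_prod s|%:R - (q1 ^ 2)%:R).
Proof.
move=> s0 Hc.
transitivity (\sum_(x | x != 0) \sum_(y | y != 0) \sum_(z | z != 0) \sum_(w | w != 0)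
  (\sum_(j < q1) om (s / (x * y * z)) ^+ j) * e (w * (1 - x - y - z))).
  transitivity (\sum_(j < q1) \sum_(x | x != 0) \sum_(y | y != 0) \sum_(z | z != 0)
     \sum_(w | w != 0) om (s / (x * y * z)) ^+ j * e (w * (1 - x - y - z))).
    apply: eq_bigr => j _; have [lt_c dvd_c] := Hc j (ltn_ord j).
    rewrite (gauss_product (ltn_ord j) lt_c dvd_c) exchange_big mulr_sumr.
    apply: eq_bigr => x _; rewrite exchange_big mulr_sumr.
    apply: eq_bigr => y _; rewrite exchange_big mulr_sumr.
    apply: eq_bigr => z _; rewrite mulr_sumr.
    apply: eq_bigr => w _; rewrite mulrA -exprMn -omM.
    by rewrite mulNr mulrN opprK.
  rewrite exchange_big; apply: eq_bigr => x _.
  rewrite exchange_big; apply: eq_bigr => y _.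
  rewrite exchange_big; apply: eq_bigr => z _.
  rewrite exchange_big; apply: eq_bigr => w _.
  by rewrite mulr_suml.
pose P x y z := x * y * z == s.
transitivity (\sum_(x | x != 0) \sum_(y | y != 0) \sum_(z | z != 0)
   q1%:R * ((P x y z)%:R * (#|F|%:R * (x + y + z == 1)%:R - 1)) : K).
  apply: eq_bigr => x x0; apply: eq_bigr => y y0; apply: eq_bigr => z z0.
  rewrite -mulr_sumr sum_e om_orth ?mulf_neq0 ?invr_neq0 ?mulf_neq0 //.
  rewrite (_ : (s / (x * y * z) == 1) = P x y z); last first.
    rewrite /P -(inj_eq (mulIf (mulf_neq0 (mulf_neq0 x0 y0) z0))) divfK ?mulf_neq0 //.
    by rewrite mul1r eq_sym.
  have -> : (1 - x - y - z == 0) = (x + y + z == 1).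
    by rewrite -!addrA -!opprD !addrA subr_eq0 eq_sym.
  case: (P x y z); rewrite ?mul0r ?mulr0 // mul1r; congr (_ * _).
  case: (_ == 1); rewrite ?mulr0 ?sub0r // mulr1.
  have : (0 < #|F|)%N by apply/card_gt0P; exists 0.
  by case: #|F| => // n _; rewrite /= -natr1 addrK.
under eq_bigr do (under eq_bigr do rewrite -mulr_sumr; rewrite -mulr_sumr).
rewrite -mulr_sumr; congr (_ * _).
have card_s : #|sum1_prod s|%:R = \sum_(x | x != 0) \sum_(y | y != 0) \sum_(z | z != 0)
    (P x y z)%:R * (x + y + z == 1)%:R :> K.
  transitivity (\sum_x \sum_y \sum_z (P x y z)%:R * (x + y + z == 1)%:R : K).
    rewrite pair_bigA /= (pair_bigA _ (fun w z => (P w.1 w.2 z)%:R * (w.1 + w.2 + z == 1)%:R)) /=.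
    rewrite -sum1_card natr_sum big_mkcond; apply: eq_bigr => -[[x y] z] _ /=.
    by rewrite inE /= andbC -natrM mulnb; case: (_ && _).
  have P0 x y z : [|| x == 0, y == 0 | z == 0] -> (P x y z)%:R * (x + y + z == 1)%:R = 0 :> K.
    rewrite /P orbA -!mulf_eq0 => /eqP ->; rewrite eq_sym (negbTE s0) mul0r //.
  rewrite [RHS]big_mkcond; apply: eq_bigr => x _; case: ifPn => [_|/negPn x0]; last first.
    by rewrite big1 // => y _; rewrite big1 // => z _; rewrite P0 // x0.
  rewrite [RHS]big_mkcond; apply: eq_bigr => y _; case: ifPn => [_|/negPn y0]; last first.
    by rewrite big1 // => z _; rewrite P0 // y0 orbT.
  rewrite [RHS]big_mkcond; apply: eq_bigr => z _; case: ifPn => [//|/negPn z0].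
  by rewrite P0 // z0 !orbT.
have -> : (q1 ^ 2)%:R = \sum_(x : F | x != 0) \sum_(y : F | y != 0) \sum_(z | z != 0)
    (P x y z)%:R :> K.
  rewrite (eq_bigr (fun=> q1%:R)) => [|x x0].
    by rewrite sumr_const cardC1 -[RHS]mulr_natl natrX expr2.
  rewrite (eq_bigr (fun=> 1)) => [|y y0]; first by rewrite sumr_const cardC1.
  have xy0 := mulf_neq0 x0 y0.
  rewrite (bigD1 (s / (x * y))) ?mulf_neq0 ?invr_neq0 //= big1 => [|z /andP[_ nz]].
    by rewrite addr0 /P mulrC divfK // eqxx.
  rewrite /P; case: eqP => // Ds; case/eqP: nz.
  by rewrite -Ds mulrC mulKf.
rewrite card_s mulr_sumr -sumrB; apply: eq_bigr => x x0.
rewrite mulr_sumr -sumrB; apply: eq_bigr => y y0.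
by rewrite mulr_sumr -sumrB; apply: eq_bigr => z z0; ring.
Qed.

End GaussSums.

(** * Gauss sums over the p-adic numbers *)

Section PadicGauss.
Variables (p : nat) (pr_p : prime p) (p_gt3 : (3 < p)%N).
Local Notation Zp := (padic_int pr_p).
Local Notation Qp := {fraction Zp}.
Local Notation "x %:F" := (@FracField.tofrac Zp x).
Local Notation pint := (@pint p pr_p).
Local Notation teich := (teichmuller pr_p).

Definition gamma_frac (j : nat) : Qp := (padic_gamma (ratr (j%:R / p.-1%:R)))%:F.

Lemma pint_sep (x : Qp) : (forall N, lev p pint N x) -> x = 0.
Proof.
move=> L; have := L 0%N; rewrite lev_in => /pintP[z Dx].
rewrite Dx -tofrac0; congr (_%:F); apply: eqmod_eq => N.
by apply/lev_eqmod; rewrite tofrac0 subr0 -Dx.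
Qed.

Local Notation K := {poly %/ eisenstein Qp p}.
Local Notation cK := (@constK Qp p).

Definition teichK (a : 'F_p) : K := cK (teich a)%:F.
(** The value at 0 is forced: the Mellin expansion only describes nonzero arguments. *)
Definition addcharK (a : 'F_p) : K := if a == 0 then 1 else gauss_interp p gamma_frac (teich a)%:F.
Local Notation g := (gauss_gk p gamma_frac).

Let sums_theta_addcharK (a : 'F_p) : sums pint (theta p (teich a)%:F) (addcharK a).
Proof.
rewrite /addcharK; case: eqP => [->|/eqP a0].
  rewrite teich0 tofrac0.
  by apply: sums_theta0 => //; apply: Qp_char0.
apply: (sums_theta (@Qp_char0 p pr_p) pr_p p_gt3 (@pint_natV p pr_p) (@pint_fermat p pr_p)).
- by move=> j N; apply: gross_koblitz.
- exact: pint_tofrac.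
by rewrite -tofracXn teich_exp // tofrac1.
Qed.

(** The sum of two Teichmuller representatives is a third one up to a multiple of [p]. *)
Let addcharKD (a c : 'F_p) : addcharK (a + c) = addcharK a * addcharK c.
Proof.
have [w Dw] : padic_eqmod 1 (teich a + teich c) (teich (a + c)).
  apply: (@eqmod_trans _ _ _ (a%:R + c%:R)); first by apply: eqmodD; apply: teich_eqmod.
  by apply: eqmod_trans (eqmod_sym (FpD _ a c)) _; apply/eqmod_sym/teich_eqmod.
have Dac : (teich a)%:F + (teich c)%:F = (teich (a + c))%:F + p%:R * w%:F.
  by rewrite -tofrac_nat -tofracM -!tofracD -[p%:R]expr1 -Dw addrCA subrr addr0.
have tp (d : 'F_p) : (teich d)%:F ^+ p = (teich d)%:F by rewrite -tofracXn teich_expp.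
apply/esym; apply: (sums_theta_add (@Qp_char0 p pr_p) pr_p p_gt3 (@pint_natV p pr_p)
  (@pint_fermat p pr_p) pint_sep _ _ _ _ (tp a) (tp c) (tp (a + c)) Dac) => //;
  exact: pint_tofrac.
Qed.

Let card_Fp' : #|'F_p| = p. Proof. exact: card_Fp. Qed.

Let p1_neq0 : p.-1%:R != 0 :> Qp.
Proof. by apply: natF_neq0; [exact: Qp_char0 | rewrite -subn1 subn_gt0 prime_gt1]. Qed.

Lemma gauss_count_teich (s : 'F_p) (c : nat -> nat) : s != 0 ->
  (forall j, (j < p.-1)%N -> (c j < p.-1)%N /\ (p.-1 %| 3 * j + c j)%N) ->
  \sum_(j < p.-1) teichK (- s) ^+ j * (g j ^+ 3 * g (c j)) =
  p.-1%:R * (p%:R * #|sum1_prod s|%:R - (p.-1 ^ 2)%:R).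
Proof.
move=> s0 Hc.
have := @gauss_count 'F_p K teichK addcharK g (cK (p.-1%:R)^-1).
rewrite card_Fp'; apply=> //.
- by rewrite -(rmorph_nat cK) -rmorphM mulVf // rmorph1.
- by rewrite /teichK teich1 tofrac1 rmorph1.
- by move=> x y; rewrite /teichK teichM tofracM rmorphM.
- by move=> x x0; rewrite /teichK -rmorphXn -tofracXn teich_exp // tofrac1 rmorph1.
- move=> x x0; have := sum_teich_exp pr_p x0.
  move/(congr1 (fun z => cK z%:F)); rewrite !rmorph_sum => S.
  under eq_bigr do rewrite /teichK -rmorphXn -tofracXn.
  by rewrite S; case: ifP => _; rewrite ?rmorph_nat ?rmorph0.
- move=> k; have := sum_teich pr_p k.
  move/(congr1 (fun z => cK z%:F)); rewrite !rmorph_sum => S.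
  under eq_bigr do rewrite /teichK -rmorphXn -tofracXn.
  by rewrite S; case: ifP => _; rewrite ?rmorph_nat ?rmorph0.
- move=> x x0; rewrite /addcharK (negbTE x0) /gauss_interp; congr (_ * _); apply: eq_bigr => j _.
  by rewrite /teichK rmorphXn.
- rewrite /gauss_gk expr0 mulr1 /gamma_frac mul0r.
  by rewrite /padic_gamma /ratr (_ : numq 0 = 0) // mul0r eqxx tofrac1 rmorph1.
Qed.

End PadicGauss.

(** * The hypergeometric sum as a point count *)

Lemma frac_partE (x : rat) (m : int) : m%:~R <= x < (m + 1)%:~R -> frac_part x = x - m%:~R.
Proof. by move=> /Num.Theory.floor_def; rewrite /frac_part => ->. Qed.

(** Up to order, the numbers [1/3 - r], [2/3 - r], [1 - r] are [(y + h) / 3] with [h] in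
[0, 1, 2], after the integer shifts that the fractional parts remove. These are the
arguments of the multiplication formula. *)
Lemma thirds_shift (V : comPzRingType) (f : rat -> V) (r y : rat) (l : nat) :
  y = l%:R - 3%:R * r -> 0 <= y < 1 -> (0 < l <= 3)%N ->
  - Num.floor (1 / 3%:R - r) - Num.floor (2%:R / 3%:R - r) = l.-1%:Z /\
  f (frac_part (1 / 3%:R - r)) * f (frac_part (2%:R / 3%:R - r)) * f (1 - r) =
  f (y / 3%:R) * f ((y + 1) / 3%:R) * f ((y + 2%:R) / 3%:R).
Proof.
move=> Dy /andP[y0 y1]; case: l Dy => [|[|[|[|l]]]] // Dy _.
- have b1 : (0 : int)%:~R <= 1 / 3%:R - r < (0 + 1 : int)%:~R by rewrite !rmorphD /=; lra.
  have b2 : (0 : int)%:~R <= 2%:R / 3%:R - r < (0 + 1 : int)%:~R by lra.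
  rewrite !(frac_partE b1) (frac_partE b2) (Num.Theory.floor_def b1) (Num.Theory.floor_def b2).
  by split=> //; congr (f _ * f _ * f _); rewrite Dy; field.
- have b1 : (-1 : int)%:~R <= 1 / 3%:R - r < (-1 + 1 : int)%:~R by lra.
  have b2 : (0 : int)%:~R <= 2%:R / 3%:R - r < (0 + 1 : int)%:~R by lra.
  rewrite !(frac_partE b1) (frac_partE b2) (Num.Theory.floor_def b1) (Num.Theory.floor_def b2).
  split=> //; rewrite mulrAC [RHS]mulrC mulrA [RHS]mulrAC.
  by congr (f _ * f _ * f _); rewrite Dy; field.
have b1 : (-1 : int)%:~R <= 1 / 3%:R - r < (-1 + 1 : int)%:~R by lra.
have b2 : (-1 : int)%:~R <= 2%:R / 3%:R - r < (-1 + 1 : int)%:~R by lra.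
rewrite !(frac_partE b1) (frac_partE b2) (Num.Theory.floor_def b1) (Num.Theory.floor_def b2).
split=> //; rewrite -[RHS]mulrA [RHS]mulrC.
by congr (f _ * f _ * f _); rewrite Dy; field.
Qed.

Lemma neg_div27_cube (F : fieldType) (t : F) : 3%:R != 0 :> F ->
  - (t / 27%:R) * 3%:R ^+ 3 = -1 * t.
Proof.
move=> h3; have -> : 27%:R = 3%:R ^+ 3 :> F by rewrite -natrX.
by rewrite [LHS]mulNr divfK ?mulN1r // expf_neq0.
Qed.

Lemma gamma_ratio (F : fieldType) (f g g' h w y s : F) :
  h != 0 -> g' != 0 -> s * s = 1 -> f * g' = w * y * h -> g * g' = - s ->
  f / h * g ^+ 2 = - s * w * (g ^+ 3 * y).
Proof.
move=> h0 g0 s2 Ef Eg; apply: (mulIf g0); apply: (mulIf h0).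
have -> : f / h * g ^+ 2 * g' * h = f * g' * g ^+ 2 by field.
have -> : - s * w * (g ^+ 3 * y) * g' * h = - s * (g * g') * (w * y * h) * g ^+ 2 by ring.
by rewrite Ef Eg mulrNN s2 mul1r.
Qed.

Lemma prod_ord2 (R : comNzRingType) (f : 'I_2 -> R) : \prod_(k < 2) f k = f ord0 * f ord_max.
Proof. by rewrite big_ord_recl big_ord1; congr (_ * f _); apply: val_inj. Qed.

Lemma quartic_rearrange (R : comNzRingType) (x y z w : R) :
  x ^+ 3 * y * (z ^+ 3 * w) = (- (z * x)) ^+ 3 * - (w * y).
Proof. by ring. Qed.

Lemma term_rearrange (R : comNzRingType) (x t y s w z : R) :
  x * (t * (y * (- s * w * z))) = s * t * w * (y * - x * z).
Proof. by ring. Qed.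

Lemma count_rearrange (F : fieldType) (x n S : F) (q : nat) :
  q%:R != 0 :> F -> x != 0 -> q%:R + 1 = x ->
  1 + x * S = q%:R * (x * n - (q ^ 2)%:R) ->
  - 1 / q%:R * (1 + S) = - (n - x + 2%:R).
Proof.
move=> q0 x0 Dx E; have -> : 1 + S = q%:R * (n - x + 2%:R).
  apply: (mulfI x0); rewrite mulrDr -[x * S](addKr 1) addrC E natrX -Dx; ring.
by field.
Qed.

Section SmallPrimes.
Variables (p : nat) (pr_p : prime p) (p_gt3 : (3 < p)%N).

Lemma Fp_two_neq0 : 2%:R != 0 :> 'F_p.
Proof.
by rewrite -(dvdn_pcharf (pchar_Fp pr_p)) dvdn_prime2 // neq_ltn (ltn_trans _ p_gt3) ?orbT.
Qed.

Lemma Fp_three_neq0 : 3%:R != 0 :> 'F_p.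
Proof. by rewrite -(dvdn_pcharf (pchar_Fp pr_p)) dvdn_prime2 // neq_ltn p_gt3 orbT. Qed.

End SmallPrimes.

Section CountFormula.
Variables (p : nat) (pr_p : prime p) (p_gt3 : (3 < p)%N).
Local Notation Zp := (padic_int pr_p).
Local Notation Qp := {fraction Zp}.
Local Notation "x %:F" := (@FracField.tofrac Zp x).
Local Notation teich := (teichmuller pr_p).
Local Notation K := {poly %/ eisenstein Qp p}.
Local Notation cK := (@constK Qp p).
Local Notation G := (gamma_frac pr_p).
Local Notation q := p.-1.

(** The residue of [- 3 j] modulo [p - 1]; the summand [3 q] keeps the truncated
subtraction exact for [j <= q]. *)
Definition neg_triple j := (((3 * q) - 3 * j) %% q)%N.

Let p_odd : odd p. Proof. by case: (even_prime pr_p) p_gt3 => // ->. Qed.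

Let three_neq0 := Fp_three_neq0 pr_p p_gt3.

Let q_gt0 : (0 < q)%N. Proof. by rewrite -subn1 subn_gt0 prime_gt1. Qed.

Lemma neg_triple_lt j : (neg_triple j < q)%N. Proof. by rewrite ltn_mod. Qed.

Lemma neg_triple_dvd j : (j < q)%N -> (q %| 3 * j + neg_triple j)%N.
Proof.
move=> lt_j; rewrite /dvdn modnDmr subnKC ?modnMl //.
by rewrite leq_mul2l ltnW.
Qed.

(** The powers of [unif] in the four Gauss sums combine to [unif^(3 j + neg_triple j)], a
power of [- p], so that the identity descends to the p-adic numbers. *)
Lemma gauss_count_padic (s : 'F_p) : s != 0 ->
  \sum_(j < q) (teich (- s) ^+ j)%:F *
     ((- p%:R) ^+ ((3 * j + neg_triple j) %/ q) * (G j ^+ 3 * G (neg_triple j))) =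
  q%:R * (p%:R * #|sum1_prod s|%:R - (q ^ 2)%:R).
Proof.
move=> s0; apply: (constK_inj pr_p).
transitivity (q%:R * (p%:R * #|sum1_prod s|%:R - (q ^ 2)%:R) : K); last first.
  move: (q ^ 2)%N => m; rewrite [RHS]rmorphM [X in _ = _ * X]rmorphB.
  by rewrite [X in _ = _ * (X - _)]rmorphM !rmorph_nat.
have Hc j : (j < q)%N -> (neg_triple j < q)%N /\ (q %| 3 * j + neg_triple j)%N.
  by move=> lt_j; split; [exact: neg_triple_lt | exact: neg_triple_dvd].
rewrite -(gauss_count_teich pr_p p_gt3 s0 Hc).
rewrite rmorph_sum; apply: eq_bigr => j _.
rewrite tofracXn [LHS]rmorphM [X in X * _ = _]rmorphXn; congr (_ * _).
rewrite [LHS]rmorphM [X in X * _ = _]rmorphXn /= -/(cK _) -unifXp // -exprM mulnC.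
rewrite divnK ?neg_triple_dvd //.
rewrite [X in _ * X = _]rmorphM [X in _ * (X * _) = _]rmorphXn /= /gauss_gk exprD mulnC exprM.
exact: quartic_rearrange.
Qed.

Local Notation Gr := (@padic_gamma_rat p pr_p).

Lemma padic_gamma_rat_neq0 x : Gr x != 0.
Proof.
rewrite /padic_gamma_rat tofrac_eq0.
by have := @padic_gamma_unit p pr_p p_odd (ratr x); apply: contraTneq => ->; rewrite unitr0.
Qed.

Lemma padic_gamma_rat0 : Gr 0 = 1.
Proof.
by rewrite /padic_gamma_rat /padic_gamma /ratr (_ : numq 0 = 0) // mul0r eqxx tofrac1.
Qed.

Lemma frac_part_id (x : rat) : 0 <= x < 1 -> frac_part x = x.
Proof. by move=> x01; rewrite (@frac_partE x 0) ?subr0. Qed.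

(** The summand of [mccarthyG] for the parameters 1/3, 2/3 and 0, 0, after the values of the
gamma function at 0 have been removed. *)
Definition mc_term (t : 'F_p) (j : nat) : Qp :=
  let r : rat := j%:R / q%:R in
  (teichmuller_conj_exp pr_p j t)%:F *
  ((- p%:R) ^ (- Num.floor (1 / 3%:R - r) - Num.floor (2%:R / 3%:R - r)) *
   (Gr (frac_part (1 / 3%:R - r)) * Gr (frac_part (2%:R / 3%:R - r)) /
      (Gr (1 / 3%:R) * Gr (2%:R / 3%:R)) * Gr r ^+ 2)).

Let ratio01 j : (j < q)%N -> 0 <= (j%:R / q%:R : rat) < 1.
Proof.
move=> lt_j; rewrite divr_ge0 ?ler0n // ltr_pdivrMr ?ltr0n // mul1r ltr_nat.
exact: lt_j.
Qed.

Lemma mccarthyG_thirds (t : 'F_p) :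
  mccarthyG pr_p [tuple 1 / 3%:R; 2%:R / 3%:R] [tuple 0; 0] t =
  - 1 / q%:R * \sum_(j < q) mc_term t j.
Proof.
rewrite /mccarthyG; congr (_ * _); apply: eq_bigr => j _.
rewrite mulnC exprM sqrrN expr1n expr1n mul1r /mc_term; congr (_ * _).
rewrite prod_ord2 !(tnth_nth 0) /=.
have r01 := ratio01 (ltn_ord j).
set r := (_ / _) in r01 *.
rewrite oppr0 [in frac_part (0 + r)]add0r (frac_part_id r01).
rewrite (@frac_part_id 0) // (@frac_part_id (1 / 3%:R)) // (@frac_part_id (2%:R / 3%:R)) //.
rewrite add0r (@Num.Theory.floor_def _ r 0) // !subr0 padic_gamma_rat0 divr1.
rewrite expfzDr ?oppr_eq0 ?Qp_p_neq0 // invfM expr2.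
rewrite mulrACA [X in X * _ = _]mulrACA -[LHS]mulrA; congr (_ * (_ * _)).
exact: mulrACA.
Qed.

Lemma mc_term0 t : t != 0 -> mc_term t 0 = 1.
Proof.
move=> t0; rewrite /mc_term /teichmuller_conj_exp (negbTE t0) expr0 invr1 tofrac1 mul1r.
rewrite mul0r !subr0 (@Num.Theory.floor_def _ (1 / 3%:R) 0) //.
rewrite (@frac_part_id (1 / 3%:R)) // (@frac_part_id (2%:R / 3%:R)) //.
by rewrite padic_gamma_rat0 expr1n mulr1 expr0z mul1r divff // mulf_neq0 // padic_gamma_rat_neq0.
Qed.

Lemma teich_conj_expV t j : t != 0 -> teichmuller_conj_exp pr_p j t^-1 = teich t ^+ j.
Proof.
move=> t0; rewrite /teichmuller_conj_exp invr_eq0 (negbTE t0) teichV //.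
by rewrite exprVn invrK.
Qed.

(** The factor [27^(-j) = 3^(-3 j)] absorbs the power of 3 in the multiplication formula,
as [m] is [- 3 j] modulo [p - 1]. *)
Lemma teich_neg_div27 t j m : t != 0 -> (3 * j + m = q * ((3 * j + m) %/ q))%N ->
  teich (- (t / 27%:R)) ^+ j = (-1) ^+ j * teich t ^+ j * teich 3%:R ^+ m.
Proof.
move=> t0 Dq.
have tN1 : teich (-1) = -1.
  have /eqP := teichX pr_p (-1) 2; rewrite sqrrN expr1n teich1 eq_sym sqrf_eq1.
  case/orP=> [|/eqP //]; rewrite -(teich1 pr_p) (inj_eq (@teich_inj p pr_p)).
  by rewrite eq_sym -addr_eq0 -(natrD _ 1 1) (negbTE (Fp_two_neq0 pr_p p_gt3)).
have T3 : teich 3%:R \is a GRing.unit.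
  by apply/unitrPr; exists (teich 3%:R ^+ q.-1); rewrite -exprS prednK // teich_exp.
apply: (mulIr (unitrX (3 * j)%N T3)).
rewrite -[RHS]mulrA -exprD [(m + _)%N]addnC Dq [X in _ = _ * X]exprM teich_exp // expr1n mulr1.
rewrite exprM -[LHS]exprMn -(teichX pr_p 3%:R) -teichM.
have -> : - (t / 27%:R) * 3%:R ^+ 3 = -1 * t.
  exact: (@neg_div27_cube 'F_p).
by rewrite teichM tN1 exprMn.
Qed.

(** The multiplication formula turns the gamma values at [1/3 - r], [2/3 - r] into one at
[- 3 r] divided by one at [1 - r], and reflection moves the latter to the numerator. *)
Lemma mc_term_gauss t j : t != 0 -> (0 < j < q)%N ->
  p%:R * mc_term t^-1 j = (teich (- (t / 27%:R)) ^+ j)%:F *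
     ((- p%:R) ^+ ((3 * j + neg_triple j) %/ q) * (G j ^+ 3 * G (neg_triple j))).
Proof.
move=> t0 /andP[j_gt0 lt_j]; set l := ((3 * j + neg_triple j) %/ q)%N.
have lq : (3 * j + neg_triple j = q * l)%N by rewrite [RHS]mulnC /l divnK ?neg_triple_dvd.
have l_gt0 : (0 < l)%N.
  by rewrite -(ltn_pmul2l q_gt0) muln0 -lq addn_gt0 muln_gt0 j_gt0.
have l_le3 : (l <= 3)%N.
  rewrite -ltnS -(ltn_pmul2l q_gt0) -lq mulnS addnC mulnC -addSn.
  by rewrite leq_add ?neg_triple_lt // leq_mul2r ltnW // orbT.
have q0 : q%:R != 0 :> rat by rewrite pnatr_eq0 -lt0n.
have Dy : (neg_triple j)%:R / q%:R = l%:R - 3%:R * (j%:R / q%:R) :> rat.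
  apply: (mulIf q0); rewrite mulrBl divfK // -[3%:R * _ * _]mulrA divfK // -!natrM.
  by rewrite [(l * q)%N]mulnC -lq natrD addrC addKr.
have l13 : (0 < l <= 3)%N by rewrite l_gt0.
have [De Df] := thirds_shift Gr Dy (ratio01 (neg_triple_lt j)) l13.
rewrite (teich_neg_div27 t0 lq) /mc_term De teich_conj_expV //.
have E3 := padic_gamma_triple pr_p p_odd p_gt3 (neg_triple_lt j).
have ER := padic_gamma_reflect pr_p p_odd lt_j.
have E3' : Gr (frac_part (1 / 3%:R - j%:R / q%:R)) * Gr (frac_part (2%:R / 3%:R - j%:R / q%:R)) *
    Gr (1 - j%:R / q%:R) =
    (teich 3%:R ^+ neg_triple j)%:F * G (neg_triple j) * (Gr (1 / 3%:R) * Gr (2%:R / 3%:R)).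
  by rewrite Df /padic_gamma_rat /gamma_frac -!tofracM E3.
have ER' : G j * Gr (1 - j%:R / q%:R) = - ((-1) ^+ j).
  by rewrite /padic_gamma_rat /gamma_frac -tofracM ER exprS mulN1r tofracN tofracXn tofracN tofrac1.
have s2 : (-1) ^+ j * (-1) ^+ j = 1 :> Qp by rewrite -expr2 sqrr_sign.
have h0 : Gr (1 / 3%:R) * Gr (2%:R / 3%:R) != 0 by rewrite mulf_neq0 ?padic_gamma_rat_neq0.
rewrite -[Gr (j%:R / q%:R)]/(G j).
rewrite (gamma_ratio h0 (padic_gamma_rat_neq0 _) s2 E3' ER') !tofracM.
have -> : ((-1) ^+ j)%:F = (-1) ^+ j :> Qp by rewrite tofracXn tofracN tofrac1.
have -> : (- p%:R) ^+ l = (- p%:R) ^+ l.-1 * - p%:R :> Qp by rewrite -exprSr prednK.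
exact: term_rearrange.
Qed.

(** [mc_term_gauss] covers all indices but 0, where the summand of [gauss_count_padic] is 1
instead of [p]; this difference accounts for the constants. *)
Lemma mccarthyG_count t : t != 0 ->
  mccarthyG pr_p [tuple 1 / 3%:R; 2%:R / 3%:R] [tuple 0; 0] (1 / t) =
  - (#|sum1_prod (t / 27%:R)|%:R - p%:R + 2%:R).
Proof.
move=> t0; rewrite div1r mccarthyG_thirds.
have s0 : - (t / 27%:R) * 3%:R ^+ 3 != 0 :> 'F_p.
  by rewrite (@neg_div27_cube 'F_p) // mulN1r oppr_eq0.
have {}s0 : t / 27%:R != 0 by apply: contraNneq s0 => ->; rewrite oppr0 mul0r.
have := gauss_count_padic s0; set n := #|_|.
have q0 : q%:R != 0 :> Qp by apply: natF_neq0 => //; apply: Qp_char0.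
have neg_triple0 : neg_triple 0 = 0%N by rewrite /neg_triple muln0 subn0 modnMl.
have G0 : G 0 = 1 by rewrite -padic_gamma_rat0 /gamma_frac mul0r.
rewrite (bigD1 (Ordinal q_gt0)) //= neg_triple0 muln0 div0n G0 !expr0 expr1n tofrac1 !mul1r => E.
rewrite [in LHS](bigD1 (Ordinal q_gt0)) //= mc_term0; last by rewrite invr_eq0.
apply: count_rearrange => //.
- exact: Qp_p_neq0.
- by rewrite natr1 prednK ?prime_gt0.
rewrite -{}E mulr_sumr; congr (_ + _); apply: eq_bigr => j j0.
by rewrite mc_term_gauss ?ltn_ord ?andbT // lt0n.
Qed.

End CountFormula.

Theorem theorem1p1 (p : nat) (pr_p : prime p) (p_gt3 : (3 < p)%N)
    (t : 'F_p) (t_neq0 : t != 0) (t_neq1 : t != 1) :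
  mccarthyG pr_p [tuple 1 / 3%:R; 2%:R / 3%:R] [tuple 0; 0] (1 / t) =
  (quad_char (- 3%:R : 'F_p))%:~R *
    mccarthyG pr_p [tuple 1 / 3%:R; 2%:R / 3%:R] [tuple 0; 0] (1 / (1 - t)).
Proof.
have t1_neq0 : 1 - t != 0 by rewrite subr_eq0 eq_sym.
rewrite !mccarthyG_count // mulrN; congr (- _).
have := card_sum1_prod_isogeny (Fp_two_neq0 pr_p p_gt3) (Fp_three_neq0 pr_p p_gt3) t_neq0 t1_neq0.
have -> : #|'F_p| = p by apply: card_Fp.
rewrite -[qchar _]/(quad_char (- 3%:R : 'F_p)).
move/(congr1 (fun z : int => z%:~R : padic_num pr_p)).
by rewrite intrM !intrD !intrN.
Qed.
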